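(* Let $T>\pi$ and let $\mathcal{G}_{\mathrm{Burg}}$ and $\mu$ be as in the context. There exists a constant $C>0$ such that for any $\epsilon\in(0,\tfrac12]$ there exists a shift-DeepONet $\mathcal{N}^{\mathrm{sDON}}_\epsilon$ (with ReLU component networks) with $m=3$ sensor points and $p\le C$ trunk/branch functions such that \[ \mathbb{E}_{\bar u\sim\mu}\big[\|\mathcal{G}_{\mathrm{Burg}}(\bar u)-\mathcal{N}^{\mathrm{sDON}}_\epsilon(\bar u)\|_{L^1(\mathbb{T})}\big]\le\epsilon, \] and $\mathrm{width}(\mathcal{N}^{\mathrm{sDON}}_\epsilon)\le C$, $\mathrm{depth}(\mathcal{N}^{\mathrm{sDON}}_\epsilon)\le C\log(\epsilon^{-1})^2$, $\mathrm{size}(\mathcal{N}^{\mathrm{sDON}}_\epsilon)\le C\log(\epsilon^{-1})^2$.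
   Context: $\mathbb{T}=\mathbb{R}/2\pi\mathbb{Z}$. $\mu$ is the law of the random function $\bar u(x)=-\sin(x-\xi)$ with $\xi\sim\mathrm{Unif}[0,2\pi]$. $\mathcal{G}_{\mathrm{Burg}}(\bar u)=u(\cdot,T)$ where $u$ is the entropy solution of the inviscid Burgers' equation $\partial_tu+\partial_x(u^2/2)=0$ on $\mathbb{T}$ with $u(\cdot,0)=\bar u$. A shift-DeepONet with sensor points $x_1,\dots,x_m$ and $p$ basis functions is $\mathcal{N}^{\mathrm{sDON}}(\bar u)(y)=\sum_{k=1}^p\beta_k(\mathcal{E}(\bar u))\,\tau_k\big(\mathcal{A}_k(\mathcal{E}(\bar u))\,y+\gamma_k(\mathcal{E}(\bar u))\big)$, with $\mathcal{E}(\bar u)=(\bar u(x_1),\dots,\bar u(x_m))$ and neural networks $\boldsymbol\beta:\mathbb{R}^m\to\mathbb{R}^p$ (branch), $\boldsymbol\tau:\mathbb{R}\to\mathbb{R}^p$ (trunk), $\mathcal{A}:\mathbb{R}^m\to\mathbb{R}^p$ (scale), $\boldsymbol\gamma:\mathbb{R}^m\to\mathbb{R}^p$ (shift). Network depth = number of hidden layers, width = maximal hidden layer width. Shift-DeepONet width = sum of the four widths, depth = maximum of the four depths, size $=(m+p)\,\mathrm{width}+\mathrm{width}^2\,\mathrm{depth}$. *)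

(* Defs.v *)
From HB Require Import structures.
From mathcomp Require Import all_boot all_order all_algebra.
From mathcomp Require Import all_classical all_reals all_analysis.
Set Implicit Arguments. Unset Strict Implicit. Unset Printing Implicit Defensive.
Import Order.TTheory GRing.Theory Num.Theory.
Import numFieldNormedType.Exports.
Local Open Scope classical_set_scope.
Local Open Scope ring_scope.

Section Defs.
Context (R : realType).

Definition relu (x : R) : R := Num.max x 0.

(* a layer: weight matrix given by its rows, and a bias vector *)
Definition layer := (seq (seq R) * seq R)%type.

Definition dot (r x : seq R) : R := \sum_(i < size r) r`_i * x`_i.

Definition affine (L : layer) (x : seq R) : seq R :=
  map (fun rb : seq R * R => dot rb.1 x + rb.2) (zip L.1 L.2).

(* a network is a nonempty list of affine layers; ReLU is applied after every
   layer except the last (output) one *)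
Definition network := seq layer.

Fixpoint nn_eval (N : network) (x : seq R) : seq R :=
  match N with
  | [::] => x
  | [:: L] => affine L x
  | L :: N' => nn_eval N' (map relu (affine L x))
  end.

Definition layer_wf (din : nat) (L : layer) (dout : nat) : bool :=
  [&& size L.2 == dout, size L.1 == dout & all (fun r => size r == din) L.1].

Fixpoint nn_wf (din : nat) (N : network) (dout : nat) : bool :=
  match N with
  | [::] => false
  | [:: L] => layer_wf din L dout
  | L :: N' => layer_wf din L (size L.2) && nn_wf (size L.2) N' dout
  end.

Definition nn_depth (N : network) : nat := (size N).-1.
Definition nn_width (N : network) : nat :=
  foldr maxn 0%N (map (fun L : layer => size L.2) (take (size N).-1 N)).

Record sdon := SDON {
  sdon_sensors : seq R;
  sdon_p : nat;
  sdon_branch : network;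
  sdon_trunk : network;
  sdon_scale : network;
  sdon_shift : network
}.

Definition sdon_m (D : sdon) : nat := size (sdon_sensors D).

Definition sdon_wf (m : nat) (D : sdon) : bool :=
  [&& sdon_m D == m,
      nn_wf m (sdon_branch D) (sdon_p D),
      nn_wf 1 (sdon_trunk D) (sdon_p D),
      nn_wf m (sdon_scale D) (sdon_p D) &
      nn_wf m (sdon_shift D) (sdon_p D)].

Definition sdon_eval (D : sdon) (u : R -> R) (y : R) : R :=
  let e := map u (sdon_sensors D) in
  \sum_(k < sdon_p D)
    (nn_eval (sdon_branch D) e)`_k *
    (nn_eval (sdon_trunk D)
       [:: (nn_eval (sdon_scale D) e)`_k * y + (nn_eval (sdon_shift D) e)`_k])`_k.

Definition sdon_width (D : sdon) : nat :=
  (nn_width (sdon_branch D) + nn_width (sdon_trunk D)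
   + nn_width (sdon_scale D) + nn_width (sdon_shift D))%N.

Definition sdon_depth (D : sdon) : nat :=
  maxn (maxn (nn_depth (sdon_branch D)) (nn_depth (sdon_trunk D)))
       (maxn (nn_depth (sdon_scale D)) (nn_depth (sdon_shift D))).

Definition sdon_size (D : sdon) : nat :=
  ((sdon_m D + sdon_p D) * sdon_width D + sdon_width D ^ 2 * sdon_depth D)%N.

Definition burgers_flux (v : R) : R := v ^+ 2 / 2.

Definition dx (phi : R -> R -> R) (x t : R) : R := derive1 (fun y => phi y t) x.
Definition dt (phi : R -> R -> R) (x t : R) : R := derive1 (fun s => phi x s) t.

Definition test_fn (phi : R -> R -> R) : Prop :=
  [/\ (forall x t, phi (x + 2 * pi) t = phi x t),
      (exists M : R, forall x t, M < t -> phi x t = 0),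
      (forall x t, 0 <= phi x t),
      (forall x t, derivable (fun y => phi y t) x 1 /\ derivable (fun s => phi x s) t 1) &
      (continuous (fun p : R * R => dx phi p.1 p.2) /\
       continuous (fun p : R * R => dt phi p.1 p.2))].

(* Kruzkov entropy solution u(x,t) of u_t + (u^2/2)_x = 0 on T x [0,oo),
   u(.,0) = u0, taken in its representative that is continuous in time with
   values in L^1(T) (so that u(.,T) is meaningful). *)
Definition entropy_solution (u0 : R -> R) (u : R -> R -> R) : Prop :=
  [/\ measurable_fun setT (fun p : R * R => u p.1 p.2),
      (exists M : R, forall x t, `|u x t| <= M),
      (forall x t, u (x + 2 * pi) t = u x t),
      (forall t0 : R, 0 <= t0 -> forall e : R, 0 < e -> exists2 d : R, 0 < d &
         forall t : R, 0 <= t -> `|t - t0| < d ->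
         (\int[lebesgue_measure]_(x in `[0%R, (2 * pi)%R]) (`|u x t - u x t0|)%:E
           < e%:E)%E) &
      (forall (k : R) (phi : R -> R -> R), test_fn phi ->
         (0%E <=
          \int[lebesgue_measure]_(t in `[0%R, +oo[)
             \int[lebesgue_measure]_(x in `[0%R, (2 * pi)%R])
               (`|u x t - k| * dt phi x t
                + Num.sg (u x t - k) * (burgers_flux (u x t) - burgers_flux k)
                  * dx phi x t)%:E
          + \int[lebesgue_measure]_(x in `[0%R, (2 * pi)%R]) (`|u0 x - k| * phi x 0)%:E)%E)].

Definition sin_datum (xi : R) : R -> R := fun x => - sin (x - xi).

(* E_{bar u ~ mu} || G_Burg(bar u) - N(bar u) ||_{L^1(T)}, with xi ~ Unif[0, 2 pi]
   and U xi the entropy solution with initial datum sin_datum xi *)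
Definition sdon_burgers_error (U : R -> R -> R -> R) (T : R) (D : sdon) : \bar R :=
  ((2 * pi)^-1)%:E *
  \int[lebesgue_measure]_(xi in `[0%R, (2 * pi)%R])
     \int[lebesgue_measure]_(x in `[0%R, (2 * pi)%R])
        (`|U xi x T - sdon_eval D (sin_datum xi) x|)%:E.

End Defs.

(* Main.v *)
(* At time T > pi the solution with datum - sin (x - xi) is a single sawtooth: it equals
   sin (w (x - xi - pi)) on the period starting at the shock x = xi, where w inverts the
   characteristic map o |-> o + T sin o on [-pi / 2, pi / 2].

   Identification. No general uniqueness theorem is used. Kruzkov's inequality is tested
   with finitely many constants k, each against a smooth partition cell bounded by two
   neighbouring characteristics of the exact solution. Summing over the cells, every front
   contributes an error cubic in the mesh (Rankine-Hugoniot up to second order), while the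
   characteristics that have entered the shock contribute with the right sign; letting the
   mesh go to 0 bounds the L^1 distance between the solution and the profile by 0.

   Approximation. asin and w have nonnegative derivatives of all orders, so by Bernstein's
   theorem they are, on 4/5 of the interval, within C (4/5)^n of polynomials of degree < n
   with nonnegative coefficients. Such polynomials are evaluated by Horner's scheme with
   Yarotsky's ReLU multiplication, at bounded width and depth O(n^2). The trunk network is
   z |-> sin (w z) = (z - w z) / T on [0, pi], cut off outside; the shift network recovers
   xi from sin xi and cos xi, except near the multiples of pi. With n of order
   log (1 / eps) and cutoff slopes of order 1 / eps the expected error is at most eps. *)
Require Import Defs.
From HB Require Import structures.
From mathcomp Require Import all_boot all_order all_algebra.
From mathcomp Require Import all_classical all_reals all_analysis.
From mathcomp Require Import measurable_realfun.
From mathcomp Require Import ring lra.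
Import Order.TTheory GRing.Theory Num.Theory.
Import numFieldNormedType.Exports.
Local Open Scope classical_set_scope.
Local Open Scope ring_scope.
Set Implicit Arguments.
Unset Strict Implicit.
Unset Printing Implicit Defensive.


(** * Calculus in one variable and smooth steps *)

Section Derivatives.
Context {R : realType}.
Implicit Types (f g : R -> R) (x a b : R).

(** Kruzkov's inequality compares the solution with constants, and the profile is not constant.
    Instead of doubling the variables, the constant is changed from cell to cell and the price is
    paid at the moving edges. With mesh [d] and edges smeared over a length [h] this price is of
    order [d / h], so [d] is taken of order [h ^+ 2]. A test function has continuous first
    derivatives, so a front cannot stop abruptly at the shock: its stop is smoothed over a length
    [eta] so short that only one front at a time is stopping.

    Nonnegative coefficients keep Horner's scheme stable: every partial value is at most the value
    at 1, so all products are taken on [[0, 1]] and rounding errors merely add up. The room beyond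
    [pi] that Bernstein's theorem requires for [w] comes from [T > pi].

    The sign of [sin xi] is not a continuous function of the sensor values at the multiples of [pi],
    so the angle is lost there, on a set of measure of order [1 / K], which is harmless in the mean.
    Only the position of the wave depends on the datum: branch and scale are constant, and four
    basis functions suffice. *)

Lemma der_ext f g x a : (forall y, f y = g y) -> is_derive x 1 f a ->
  is_derive x 1 g a.
Proof. by move=> fg; have -> : f = g by apply/funext. Qed.

Lemma der_val f x a b : a = b -> is_derive x 1 f a -> is_derive x 1 f b.
Proof. by move=> ->. Qed.

Lemma der_cst c x : is_derive x 1 (fun _ => c) (0 : R).
Proof. exact: is_derive_cst. Qed.

Lemma der_id x : is_derive x 1 (fun y : R => y) (1 : R).
Proof. exact: is_derive_id. Qed.

Lemma derD f g x a b : is_derive x 1 f a -> is_derive x 1 g b ->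
  is_derive x 1 (fun y => f y + g y) (a + b).
Proof. by move=> *; exact: is_deriveD. Qed.

Lemma derN f x a : is_derive x 1 f a -> is_derive x 1 (fun y => - f y) (- a).
Proof. by move=> *; exact: is_deriveN. Qed.

Lemma derB f g x a b : is_derive x 1 f a -> is_derive x 1 g b ->
  is_derive x 1 (fun y => f y - g y) (a - b).
Proof. by move=> *; exact: is_deriveB. Qed.

Lemma derM f g x a b : is_derive x 1 f a -> is_derive x 1 g b ->
  is_derive x 1 (fun y => f y * g y) (a * g x + f x * b).
Proof.
move=> fa gb; apply: der_val (is_deriveM fa gb).
by rewrite /GRing.scale /= addrC [g x * a]mulrC.
Qed.

Lemma derZ f c x a : is_derive x 1 f a -> is_derive x 1 (fun y => c * f y) (c * a).
Proof. by move=> *; exact: is_deriveZ. Qed.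

Lemma der_comp f g x a b : is_derive (g x) 1 f a -> is_derive x 1 g b ->
  is_derive x 1 (fun y => f (g y)) (a * b).
Proof. by move=> *; exact: is_derive1_comp. Qed.

Lemma derV f x a : f x != 0 -> is_derive x 1 f a ->
  is_derive x 1 (fun y => (f y)^-1) (- (f x) ^- 2 * a).
Proof. by move=> *; exact: is_deriveV. Qed.

Lemma der_continuous f x a : is_derive x 1 f a -> {for x, continuous f}.
Proof.
by move=> [fx _]; apply/differentiable_continuous/derivable1_diffP.
Qed.

Lemma lip_continuous f (L : R) : (forall x y, `|f x - f y| <= L * `|x - y|) ->
  continuous f.
Proof.
move=> fL x; apply/cvgrPdist_lt => e e0 /=.
have L1 : 0 < `|L| + 1 by rewrite ltr_pwDr.
near=> y; apply: le_lt_trans (fL _ _) _.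
apply: (@le_lt_trans _ _ ((`|L| + 1) * `|x - y|)).
  by rewrite ler_wpM2r// (le_trans (ler_norm L))// lerDl.
rewrite mulrC -ltr_pdivlMr//.
by near: y; apply: cvgr_dist_lt => //; rewrite divr_gt0.
Unshelve. all: by end_near. Qed.

(** A quadratic Taylor remainder makes Caratheodory's slope function continuous. This differentiates
    [relu y ^+ 2] at its kink, where the product rule does not apply. *)
Lemma der_quad f x a C :
  (forall z, `|f z - f x - a * (z - x)| <= C * (z - x) ^+ 2) ->
  is_derive x 1 f a.
Proof.
move=> H; apply/is_derive1_caratheodory.
exists (fun z => if z == x then a else (f z - f x) / (z - x)); split.
- move=> z; case: eqP => [->|/eqP]; first by rewrite !subrr mulr0.
  by rewrite -subr_eq0 => /divfK->.
- apply/cvgrPdist_lt => e e0 /=; rewrite eqxx.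
  have C1 : 0 < `|C| + 1 by rewrite ltr_pwDr.
  near=> y; case: eqP => [_|/eqP yx]; first by rewrite subrr normr0.
  have yx0 : 0 < `|y - x| by rewrite normr_gt0 subr_eq0.
  rewrite distrC -(ltr_pM2r yx0) -normrM mulrBl divfK -?normr_gt0//.
  apply: le_lt_trans (H _) _; rewrite -real_normK ?num_real// expr2 mulrA ltr_pM2r//.
  apply: (@le_lt_trans _ _ ((`|C| + 1) * `|y - x|)).
    by rewrite ler_wpM2r// (le_trans (ler_norm C))// lerDl.
  rewrite mulrC -ltr_pdivlMr// distrC.
  by near: y; apply: cvgr_dist_lt => //; rewrite divr_gt0.
- by rewrite eqxx.
Unshelve. all: by end_near. Qed.

Lemma der_ge0_le f df x y : x <= y ->
  (forall z, x <= z <= y -> is_derive z 1 f (df z)) ->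
  (forall z, x <= z <= y -> 0 <= df z) -> f x <= f y.
Proof.
move=> xy fd d0.
have [||c cxy E] := @MVT_segment R f df x y xy.
- by move=> z; rewrite in_itv/= => /andP[/ltW ? /ltW ?]; apply: fd; apply/andP.
- apply: continuous_in_subspaceT => z; rewrite inE/= in_itv/= => zxy.
  exact: der_continuous (fd _ zxy).
- by rewrite -subr_ge0 E mulr_ge0 ?subr_ge0// d0.
Qed.

Lemma der_gt0_lt f df x y : x < y ->
  (forall z, x <= z <= y -> is_derive z 1 f (df z)) ->
  (forall z, x < z < y -> 0 < df z) -> f x < f y.
Proof.
move=> xy fd d0.
have [||c cxy E] := @MVT R f df x y xy.
- by move=> z; rewrite in_itv/= => /andP[/ltW ? /ltW ?]; apply: fd; apply/andP.
- apply: continuous_in_subspaceT => z; rewrite inE/= in_itv/= => zxy.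
  exact: der_continuous (fd _ zxy).
- by rewrite -subr_gt0 E mulr_gt0 ?subr_gt0// d0//; move: cxy; rewrite in_itv.
Qed.

Lemma relu_ge0 x : 0 <= relu x. Proof. by rewrite le_max lexx orbT. Qed.

Lemma relu_pos x : 0 <= x -> relu x = x. Proof. by move=> /max_idPl. Qed.

Lemma relu_neg x : x <= 0 -> relu x = 0. Proof. by move=> /max_idPr. Qed.

Lemma relu_le x y : x <= y -> relu x <= relu y.
Proof.
move=> xy; have [y0|/ltW y0] := leP 0 y.
  by rewrite (relu_pos y0) ge_max xy.
by rewrite !relu_neg// (le_trans xy).
Qed.

Lemma relu_lip x y : `|relu x - relu y| <= `|x - y|.
Proof.
have [x0|/ltW x0] := leP 0 x; have [y0|/ltW y0] := leP 0 y;
  rewrite ?(relu_pos x0) ?(relu_neg x0) ?(relu_pos y0) ?(relu_neg y0)//.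
- by rewrite !ger0_norm; lra.
- by rewrite distrC [leRHS]distrC !ger0_norm; lra.
- by rewrite subrr normr0.
Qed.

Lemma der_relu_sqr x : is_derive x 1 (fun y => relu y ^+ 2) (2 * relu x).
Proof.
apply: (@der_quad _ _ _ 1) => z; rewrite mul1r.
have [x0|/ltW x0] := leP 0 x; have [z0|/ltW z0] := leP 0 z;
  rewrite ?(relu_pos x0) ?(relu_neg x0) ?(relu_pos z0) ?(relu_neg z0)//;
  rewrite ler_norml; apply/andP; split;
  have := sqr_ge0 (z - x); have := sqr_ge0 z; have := sqr_ge0 x;
  (try have : x * z <= 0 by nra); rewrite !expr2; nra.
Qed.

End Derivatives.

Section Step.
Context {R : realType}.
Implicit Types (x y r : R).

(* A C^1 spline rising from 0 to 1 on [0, 1]. *)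
Definition step r : R :=
  2 * relu r ^+ 2 - 4 * relu (r - 2^-1) ^+ 2 + 2 * relu (r - 1) ^+ 2.

Definition step' r : R := 4 * relu r - 8 * relu (r - 2^-1) + 4 * relu (r - 1).

Lemma der_step r : is_derive r 1 step (step' r).
Proof.
have sh c : is_derive r 1 (fun y => y - c) (1 : R).
  by apply: der_val (derB (der_id r) (der_cst c r)); rewrite subr0.
have sq c : is_derive r 1 (fun y => relu (y - c) ^+ 2) (2 * relu (r - c)).
  by apply: der_val (der_comp (der_relu_sqr _) (sh c)); rewrite mulr1.
apply: der_val (derD (derB (derZ 2 (der_relu_sqr r)) (derZ 4 (sq _))) (derZ 2 (sq _))).
by rewrite /step'; lra.
Qed.

Lemma step_le0 r : r <= 0 -> step r = 0.
Proof. by move=> r0; rewrite /step !relu_neg; lra. Qed.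

Lemma step_ge1 r : 1 <= r -> step r = 1.
Proof. by move=> r1; rewrite /step !relu_pos; try lra; field. Qed.

Lemma step'_le0 r : r <= 0 -> step' r = 0.
Proof. by move=> r0; rewrite /step' !relu_neg; lra. Qed.

Lemma step'_ge1 r : 1 <= r -> step' r = 0.
Proof. by move=> r1; rewrite /step' !relu_pos; lra. Qed.

Lemma step'_bound r : 0 <= step' r <= 2.
Proof.
rewrite /step'.
have [r0|r0] := leP r 0; first by rewrite !relu_neg; lra.
have [r1|r1] := leP r 2^-1.
  by rewrite (relu_pos (ltW r0)) !relu_neg; lra.
have [r2|r2] := leP r 1.
  by rewrite (relu_neg (x := r - 1)) ?relu_pos; lra.
by rewrite !relu_pos; lra.
Qed.

Lemma step_homo x y : x <= y -> step x <= step y.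
Proof.
move=> xy; apply: (der_ge0_le (df := step')) => // z _; first exact: der_step.
by case/andP: (step'_bound z).
Qed.

Lemma step_bound r : 0 <= step r <= 1.
Proof.
apply/andP; split.
  have [r0|r0] := leP r 0; first by rewrite step_le0.
  by rewrite -(step_le0 (lexx 0)) step_homo// ltW.
have [r1|r1] := leP 1 r; first by rewrite step_ge1.
by rewrite -(step_ge1 (lexx 1)) step_homo// ltW.
Qed.

Lemma step_continuous : continuous step.
Proof. by move=> r; exact: der_continuous (der_step r). Qed.

Lemma step'_continuous : continuous step'.
Proof.
(* [16 = 4 + 8 + 4], the coefficients of the three ReLUs. *)
apply: (@lip_continuous _ _ 16) => x y; rewrite /step'.
have := relu_lip x y; have := relu_lip (x - 2^-1) (y - 2^-1).
have := relu_lip (x - 1) (y - 1).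
rewrite (_ : x - 1 - (y - 1) = x - y); last by ring.
rewrite (_ : x - 2^-1 - (y - 2^-1) = x - y); last by ring.
rewrite !ler_norml => /andP[? ?] /andP[? ?] /andP[? ?].
by apply/andP; split; lra.
Qed.

End Step.

(** * Bumps and Kruzkov's inequality across fronts *)

Section PeriodicStep.
Context {R : realType}.
Implicit Types (h x y a b : R) (n : int).

Let pi2_gt0 : 0 < 2 * @pi R. Proof. by rewrite mulr_gt0 ?pi_gt0. Qed.

Definition turns x : int := Num.floor (x / (2 * pi)).

(* The primitive of a 2pi-periodic C^0 bump supported in [0, h] mod 2pi, of
   mass 1 per period. *)
Definition pstep h x : R := (turns x)%:~R + step ((x - 2 * pi * (turns x)%:~R) / h).

Definition pstep' h x : R := step' ((x - 2 * pi * (turns x)%:~R) / h) / h.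

Lemma turnsP x : 2 * pi * (turns x)%:~R <= x < 2 * pi * (turns x)%:~R + 2 * pi.
Proof.
have := floor_le (x / (2 * pi)); have := floorD1_gt (x / (2 * pi)).
rewrite -/(turns x) intrD ltr_pdivrMr// ler_pdivlMr// => H1 H2.
by apply/andP; split; nra.
Qed.

Lemma turns_eq n x : 2 * pi * n%:~R <= x < 2 * pi * n%:~R + 2 * pi -> turns x = n.
Proof.
move=> /andP[H1 H2]; apply: floor_def; apply/andP; split.
  by rewrite ler_pdivlMr// mulrC.
by rewrite ltr_pdivrMr// intrD; nra.
Qed.

Lemma turnsD2pi x : turns (x + 2 * pi) = (turns x + 1)%R.
Proof. by apply: turns_eq; have := turnsP x; rewrite intrD => /andP[? ?]; lra. Qed.

Lemma pstepD2pi h x : pstep h (x + 2 * pi) = pstep h x + 1.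
Proof.
rewrite /pstep turnsD2pi intrD addrAC; congr (_ + step (_ / h) + _); ring.
Qed.

Lemma pstep'D2pi h x : pstep' h (x + 2 * pi) = pstep' h x.
Proof.
by rewrite /pstep' turnsD2pi intrD; congr (step' (_ / h) / _); ring.
Qed.

Lemma turns_local n x : - (2 * pi) < x - 2 * pi * n%:~R < 2 * pi ->
  [\/ turns x = n /\ 0 <= x - 2 * pi * n%:~R |
      turns x = (n - 1)%R /\ x - 2 * pi * n%:~R < 0].
Proof.
move=> /andP[H1 H2]; have [H|H] := leP 0 (x - 2 * pi * n%:~R).
  by left; split => //; apply: turns_eq; apply/andP; split; lra.
right; split => //; apply: turns_eq; rewrite intrB mulrBr mulr1.
by apply/andP; split; lra.
Qed.

(** The formula of turn [n] remains valid at the end of turn [n - 1], because past [h] the step has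
    already reached 1 there. Hence one smooth expression on an open window, even across a jump of
    [turns]. *)
Lemma pstepE h n x : 0 < h -> h < 2 * pi ->
  h - 2 * pi < x - 2 * pi * n%:~R < 2 * pi ->
  pstep h x = n%:~R + step ((x - 2 * pi * n%:~R) / h) /\
  pstep' h x = step' ((x - 2 * pi * n%:~R) / h) / h.
Proof.
move=> h0 hpi /andP[H1 H2]; rewrite /pstep /pstep'.
have [|[-> H]|[-> H]] := @turns_local n x _ => //; first by apply/andP; split; lra.
have E : x - 2 * pi * (n - 1)%:~R = x - 2 * pi * n%:~R + 2 * pi.
  by rewrite intrB; ring.
have G1 : 1 <= (x - 2 * pi * (n - 1)%:~R) / h by rewrite ler_pdivlMr// E; lra.
have G0 : (x - 2 * pi * n%:~R) / h <= 0 by rewrite ler_pdivrMr//; lra.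
rewrite step_ge1// step'_ge1// (step_le0 G0) (step'_le0 G0) intrB; split => //.
by rewrite subrK addr0.
Qed.

Lemma pstep_near h x : 0 < h -> h < 2 * pi ->
  let n := turns x in
  \forall y \near x, h - 2 * pi < y - 2 * pi * n%:~R < 2 * pi.
Proof.
move=> h0 hpi n; have /andP[H1 H2] := turnsP x.
rewrite -/n in H1 H2.
have : x \in `](h - 2 * pi + 2 * pi * n%:~R), (2 * pi + 2 * pi * n%:~R)[.
  by rewrite in_itv/=; apply/andP; split; lra.
move=> /near_in_itvoo; apply: filterS => y; rewrite in_itv/= => /andP[? ?].
by apply/andP; split; lra.
Qed.

Lemma der_pstep h x : 0 < h -> h < 2 * pi -> is_derive x 1 (pstep h) (pstep' h x).
Proof.
move=> h0 hpi; pose n := turns x.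
apply: (@near_eq_is_derive _ _ _
  (fun y => n%:~R + step ((y - 2 * pi * n%:~R) / h))).
  by near=> y; rewrite (proj1 (@pstepE h n y h0 hpi _))//; near: y; exact: pstep_near.
have lin : is_derive x 1 (fun y => h^-1 * (y - 2 * pi * n%:~R)) (h^-1).
  by apply: der_val (derZ h^-1 (derB (der_id x) (der_cst (2 * pi * n%:~R) x)));
    rewrite subr0 mulr1.
rewrite /pstep' -/n.
apply: (@der_ext _ (fun y => n%:~R + step (h^-1 * (y - 2 * pi * n%:~R)))).
  by move=> y; rewrite mulrC.
apply: der_val (derD (der_cst _ x) (der_comp (der_step _) lin)).
by rewrite add0r [h^-1 * _]mulrC.
Unshelve. all: by end_near. Qed.

Lemma pstep_continuous h : 0 < h -> h < 2 * pi -> continuous (pstep h).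
Proof. by move=> h0 hpi x; exact: der_continuous (der_pstep _ h0 hpi). Qed.

Lemma pstep'_continuous h : 0 < h -> h < 2 * pi -> continuous (pstep' h).
Proof.
move=> h0 hpi x; pose n := turns x.
have E : {near x, (fun y => step' ((y - 2 * pi * n%:~R) / h) / h) =1 pstep' h}.
  by near=> y; rewrite (proj2 (@pstepE h n y h0 hpi _))//; near: y; exact: pstep_near.
suff : pstep' h y @[y --> x] --> step' ((x - 2 * pi * n%:~R) / h) / h by [].
apply: cvg_trans; first exact: (near_eq_cvg E).
have lin : (fun y : R => (y - 2 * pi * n%:~R) / h) y @[y --> x] -->
    (x - 2 * pi * n%:~R) / h.
  by apply: cvgMr_tmp; apply: cvgB; [exact: cvg_id|exact: cvg_cst].
apply: cvgMr_tmp; apply: (@cvg_comp _ _ _ _ step' _ _ _ lin).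
exact: step'_continuous.
Unshelve. all: by end_near. Qed.

Lemma pstep'_bound h x : 0 < h -> 0 <= pstep' h x <= 2 / h.
Proof.
move=> h0; have /andP[? ?] := step'_bound ((x - 2 * pi * (turns x)%:~R) / h).
by rewrite divr_ge0 ?(ltW h0)//= ler_pM2r ?invr_gt0.
Qed.

Lemma pstep_homo h x y : 0 < h -> h < 2 * pi -> x <= y -> pstep h x <= pstep h y.
Proof.
move=> h0 hpi xy; apply: (der_ge0_le (df := pstep' h)) => // z _.
  exact: der_pstep.
by case/andP: (pstep'_bound z h0).
Qed.

(** [pstep h] is constant between its rises, which occupy the intervals from [2 * pi * n] to
    [2 * pi * n + h]. This localises the support of a cell. *)
Lemma pstep_supp h a b : 0 < h -> h < 2 * pi -> a <= b ->
  pstep h a != pstep h b -> exists n, 2 * pi * n%:~R <= b /\ a <= 2 * pi * n%:~R + h.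
Proof.
move=> h0 hpi ab; have [b1 b2] := andP (turnsP b) => neq.
exists (turns b); split => //; rewrite leNgt; apply/negP => a1.
move/eqP: neq; apply.
have G z : 2 * pi * (turns b)%:~R + h < z -> z <= b -> pstep h z = (turns b)%:~R + 1.
  move=> z1 z2; rewrite (proj1 (@pstepE h (turns b) z h0 hpi _)); last first.
    by apply/andP; split; lra.
  by rewrite step_ge1// ler_pdivlMr//; lra.
by rewrite !G//; lra.
Qed.

End PeriodicStep.

Section Ramp.
Context {R : realType}.
Implicit Types (eta x y : R).

(** A continuously differentiable substitute for [relu], exact outside [[0, eta]]: it brings a front
    to rest at the shock along a trajectory admissible in a test function. *)
Definition ramp eta x : R := x * step (x / eta).
Definition ramp' eta x : R := step (x / eta) + x * (step' (x / eta) / eta).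

Lemma der_ramp eta x : is_derive x 1 (ramp eta) (ramp' eta x).
Proof.
have lin : is_derive x 1 (fun y => y / eta) (eta^-1).
  apply: (@der_ext _ (fun y => eta^-1 * y)); first by move=> y; rewrite mulrC.
  by apply: der_val (derZ eta^-1 (der_id x)); rewrite mulr1.
apply: (@der_ext _ (fun y => y * step (y / eta))) => //.
have := derM (der_id x)
  (@der_comp _ step (fun y => y / eta) _ _ _ (der_step (x / eta)) lin).
by apply: der_val; rewrite mul1r.
Qed.

Lemma ramp'_continuous eta : continuous (ramp' eta).
Proof.
have lin : continuous (fun y : R => y / eta).
  by move=> y; apply: cvgMr_tmp; exact: cvg_id.
move=> x; apply: cvgD.
  by apply: (@cvg_comp _ _ _ _ step _ _ _ (lin x)); exact: step_continuous.
apply: cvgM; first exact: cvg_id.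
apply: cvgMr_tmp.
by apply: (@cvg_comp _ _ _ _ step' _ _ _ (lin x)); exact: step'_continuous.
Qed.

Lemma ramp_le0 eta x : 0 < eta -> x <= 0 -> ramp eta x = 0 /\ ramp' eta x = 0.
Proof.
move=> e0 x0; have xe : x / eta <= 0 by rewrite ler_pdivrMr// mul0r.
by rewrite /ramp /ramp' step_le0// step'_le0// !(mul0r, mulr0, addr0).
Qed.

Lemma ramp_ge eta x : 0 < eta -> eta <= x -> ramp eta x = x /\ ramp' eta x = 1.
Proof.
move=> e0 x0; have xe : 1 <= x / eta by rewrite ler_pdivlMr// mul1r.
by rewrite /ramp /ramp' step_ge1// step'_ge1// !(mul0r, mulr0, addr0, mulr1).
Qed.

(** With [r = x / eta] in [[0, 1]] the derivative is [step r + r * step' r], at most [1 + 2]. *)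
Lemma ramp'_bound eta x : 0 < eta -> 0 <= ramp' eta x <= 3.
Proof.
move=> e0; have [x0|x0] := leP x 0; first by rewrite (ramp_le0 e0 x0).2 lexx/=.
have [x1|x1] := leP eta x; first by rewrite (ramp_ge e0 x1).2; lra.
rewrite /ramp' mulrA mulrAC.
have : 0 < x / eta < 1.
  by rewrite divr_gt0//= ltr_pdivrMr// mul1r.
have := step_bound (x / eta); have := step'_bound (x / eta).
move: (x / eta) => r /andP[? ?] /andP[? ?] /andP[? ?].
by apply/andP; split; nra.
Qed.

Lemma ramp_homo eta x y : 0 < eta -> x <= y -> ramp eta x <= ramp eta y.
Proof.
move=> e0 xy; apply: (der_ge0_le (df := ramp' eta)) => // z _; first exact: der_ramp.
by case/andP: (ramp'_bound z e0).
Qed.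

Lemma ramp_ge0 eta x : 0 < eta -> 0 <= ramp eta x.
Proof.
move=> e0; have [x0|x0] := leP x 0; first by rewrite (ramp_le0 e0 x0).1.
by rewrite mulr_ge0 ?(ltW x0)//; case/andP: (step_bound (x / eta)).
Qed.

Lemma ramp_le eta x : 0 <= x -> ramp eta x <= x.
Proof.
by move=> x0; rewrite /ramp ler_piMr//; case/andP: (step_bound (x / eta)).
Qed.

Lemma ramp_geB eta x : 0 < eta -> x - eta <= ramp eta x.
Proof.
move=> e0; have [x1|x1] := leP eta x; first by rewrite (ramp_ge e0 x1).1; lra.
by have := ramp_ge0 x e0; lra.
Qed.

End Ramp.

Section KruzkovAlgebra.
Context {R : realType}.
Implicit Types (u k s : R) (n : nat).

Definition kflux u k : R := Num.sg (u - k) * (burgers_flux u - burgers_flux k).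

Lemma kfluxE u k : kflux u k = `|u - k| * (u + k) / 2.
Proof.
rewrite /kflux /burgers_flux.
have -> : u ^+ 2 / 2 - k ^+ 2 / 2 = (u - k) * ((u + k) / 2) by field.
by rewrite [RHS]mulrAC (normrEsg (u - k)); ring.
Qed.

(* For [s = (k + k') / 2] the excess vanishes unless [u] lies between [k] and
   [k'], where it is at most [(k' - k)^2 / 4]. *)
Lemma front_excess u k k' s :
  (kflux u k' - kflux u k) - s * (`|u - k'| - `|u - k|) <=
  (k' - k) ^+ 2 / 4 + `|s - (k + k') / 2| * `|k' - k|.
Proof.
have E0 : (kflux u k' - kflux u k) - (k + k') / 2 * (`|u - k'| - `|u - k|) <=
    (k' - k) ^+ 2 / 4.
  rewrite !kfluxE.
  have := sqr_ge0 (k' - k); have := sqr_ge0 (2 * u - k - k').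
  have [A|/ltW A] := leP 0 (u - k); have [B|/ltW B] := leP 0 (u - k');
    rewrite ?(ger0_norm A) ?(ler0_norm A) ?(ger0_norm B) ?(ler0_norm B);
    rewrite !expr2; nra.
set a := `|u - k'| - `|u - k|.
have Ha : `|a| <= `|k' - k|.
  rewrite /a; apply: le_trans (ler_dist_dist _ _) _.
  by rewrite (_ : u - k' - (u - k) = - (k' - k)) ?normrN//; ring.
have : - ((s - (k + k') / 2) * a) <= `|s - (k + k') / 2| * `|k' - k|.
  apply: le_trans (ler_norm _) _; rewrite normrN normrM.
  by rewrite ler_wpM2l.
move: E0; rewrite -/a; lra.
Qed.

(** A jump from [b] on the left down to [- b] on the right is a stationary entropy shock. The upper
    bound is its dissipation, which gives the fronts at rest the right sign; the lower bound
    controls the opposite jump. *)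
Lemma kflux_opp_le0 u b : 0 <= b ->
  - b ^+ 2 <= kflux u (- b) - kflux u b <= 0.
Proof.
move=> b0; rewrite !kfluxE.
by have [A|/ltW A] := leP 0 (u - - b); have [B|/ltW B] := leP 0 (u - b);
    rewrite ?(ger0_norm A) ?(ler0_norm A) ?(ger0_norm B) ?(ler0_norm B);
    rewrite !expr2; apply/andP; split; nra.
Qed.

Lemma abel_sum (w g : nat -> R) n :
  \sum_(j < n.+1) (w j - w j.+1) * g j =
  w 0%N * g 0%N - w n.+1 * g n + \sum_(j < n) w j.+1 * (g j.+1 - g j).
Proof.
elim: n => [|n IH]; first by rewrite big_ord_recr !big_ord0/=; ring.
by rewrite big_ord_recr/= IH [in RHS]big_ord_recr/=; ring.
Qed.

(** The indices satisfying [st] form an initial segment, so the sum telescopes to the last [G j]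
    among them, whatever the signs of the increments. In use, [st] marks the fronts absorbed by the
    shock. *)
Lemma sum_initial_segment (st : nat -> bool) (G : nat -> R) n :
  (forall j, st j.+1 -> st j) -> G 0%N = 0 -> (forall j, G j <= 0) ->
  \sum_(j < n) (st j.+1)%:R * (G j.+1 - G j) <= 0.
Proof.
move=> stS G0 Gle.
suff : forall n, \sum_(j < n) (st j.+1)%:R * (G j.+1 - G j) <= 0 /\
    (st n -> \sum_(j < n) (st j.+1)%:R * (G j.+1 - G j) = G n).
  by move=> /(_ n)[].
elim=> [|m [IH1 IH2]]; first by rewrite big_ord0 G0.
rewrite big_ord_recr/=; case S: (st m.+1) => /=.
  by have E := IH2 (stS _ S); rewrite E mul1r addrC subrK; split.
by rewrite mul0r addr0; split.
Qed.

Lemma sum_at_most_one (tr : nat -> bool) n :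
  (forall i j, (i < j)%N -> tr i -> ~~ tr j) ->
  \sum_(j < n) (tr j.+1)%:R <= 1 :> R.
Proof.
move=> tr1; elim: n => [|n IH]; first by rewrite big_ord0.
rewrite big_ord_recr/=; case T: (tr n.+1); last by rewrite addr0.
rewrite big1 ?add0r// => i _; case S: (tr i.+1) => //.
by have := tr1 i.+1 n.+1 (ltn_ord i) S; rewrite T.
Qed.

(* [a j] and [b j] are the values at [y] of the bumps carried by the right and
   left fronts number [j], [V j] is the velocity of the right one. *)
Lemma fronts_inequality n u (beta V a b : nat -> R) (L d r : R)
    (st tr : nat -> bool) :
  0 <= d -> 0 <= r ->
  (forall j, 0 <= a j <= L) -> (forall j, 0 <= b j <= L) ->
  (forall j, 0 <= beta j) -> beta 0%N = 0 ->
  (forall j, `|beta j.+1 - beta j| <= d) ->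
  V 0%N = 0 -> V n.+1 = 0 -> a 0%N = b 0%N -> a n.+1 = b n.+1 ->
  (forall j, st j.+1 -> st j) ->
  (forall i j, (i < j)%N -> tr i -> ~~ tr j) ->
  (forall j, st j -> V j = 0 /\ a j = r /\ b j = r) ->
  (forall j, tr j -> `|V j| <= 3) ->
  (forall j, ~~ st j -> ~~ tr j -> V j = - beta j) ->
  (forall j, beta j <= 1) ->
  \sum_(j < n.+1) (`|u + beta j| * (V j.+1 * a j.+1 - V j * a j) +
                   kflux u (- beta j) * (a j - a j.+1)) +
  \sum_(j < n.+1) (`|u - beta j| * (V j.+1 * b j.+1 - V j * b j) +
                   kflux u (beta j) * (b j.+1 - b j))
  <= L * (2 * n%:R * d ^+ 2 + 8 * d + beta n ^+ 2).
Proof.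
move=> d0 r0 aL bL be0 be00 bed V0 VN ab0 abN stS tr1 stE trE mvE be1.
pose q j := kflux u (- beta j); pose p j := kflux u (beta j).
pose Q j := `|u + beta j|; pose P j := `|u - beta j|.
pose G j := q j - p j.
have L0 : 0 <= L by case/andP: (aL 0%N) => /le_trans; apply.
(* Abel summation moves the differences onto the constants: each bump is multiplied by a jump of
   entropy flux minus the velocity times a jump of entropy, the Rankine-Hugoniot defect of its
   front. *)
have E1 : \sum_(j < n.+1) (`|u + beta j| * (V j.+1 * a j.+1 - V j * a j) +
      kflux u (- beta j) * (a j - a j.+1)) =
    a 0%N * q 0%N - a n.+1 * q n +
    \sum_(j < n) a j.+1 * ((q j.+1 - q j) - V j.+1 * (Q j.+1 - Q j)).
  transitivity (\sum_(j < n.+1) ((a j - a j.+1) * q j +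
      - ((V j * a j - V j.+1 * a j.+1) * Q j))).
    by apply: eq_bigr => j _; rewrite /Q /q; ring.
  rewrite big_split/= sumrN (abel_sum a q) (abel_sum (fun j => V j * a j) Q) /=.
  rewrite V0 VN !mul0r subr0 add0r -addrA -sumrB; congr (_ + _).
  by apply: eq_bigr => j _ /=; ring.
have E2 : \sum_(j < n.+1) (`|u - beta j| * (V j.+1 * b j.+1 - V j * b j) +
      kflux u (beta j) * (b j.+1 - b j)) =
    - (b 0%N * p 0%N - b n.+1 * p n) +
    \sum_(j < n) b j.+1 * ((p j - p j.+1) - (- V j.+1) * (P j - P j.+1)).
  transitivity (\sum_(j < n.+1) (- ((b j - b j.+1) * p j) +
      - ((V j * b j - V j.+1 * b j.+1) * P j))).
    by apply: eq_bigr => j _; rewrite /P /p; ring.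
  rewrite big_split/= !sumrN (abel_sum b p) (abel_sum (fun j => V j * b j) P).
  rewrite V0 VN !mul0r subr0 add0r opprD -addrA -opprD -big_split/= -sumrN.
  by congr (_ + _); apply: eq_bigr => j _ /=; ring.
rewrite {}E1 {}E2.
have Gle j : - beta j ^+ 2 <= G j <= 0 by exact: kflux_opp_le0.
have G0 : G 0%N = 0 by rewrite /G /q /p be00 oppr0 subrr.
(* The three terms correspond to the three states of a front: moving, coming to rest ([tr]), at rest
   ([st]). Only the last one keeps its sign, for the telescoping sum. *)
have step1 j : a j.+1 * ((q j.+1 - q j) - V j.+1 * (Q j.+1 - Q j)) +
    b j.+1 * ((p j - p j.+1) - (- V j.+1) * (P j - P j.+1)) <=
    2 * L * d ^+ 2 + 8 * L * d * (tr j.+1)%:R + r * ((st j.+1)%:R * (G j.+1 - G j)).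
  have Ld : 0 <= L * d ^+ 2 by rewrite mulr_ge0// sqr_ge0.
  have Ld' : 0 <= L * d by rewrite mulr_ge0.
  case S: (st j.+1).
    have [-> [-> ->]] := stE _ S.
    have : 0 <= 8 * L * d * (tr j.+1)%:R by rewrite !mulr_ge0.
    by rewrite mul1r /G; lra.
  have FR := front_excess u (- beta j) (- beta j.+1) (V j.+1).
  have FL := front_excess u (beta j.+1) (beta j) (- V j.+1).
  rewrite !opprK -/(q j) -/(q j.+1) -/(p j) -/(p j.+1) -/(Q j) -/(Q j.+1) in FR.
  rewrite -/(p j) -/(p j.+1) -/(P j) -/(P j.+1) in FL.
  have N1 : `|- beta j.+1 + beta j| <= d by rewrite addrC distrC.
  have N2 : `|beta j - beta j.+1| <= d by rewrite distrC.
  have S1 : (beta j - beta j.+1) ^+ 2 <= d ^+ 2.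
    by rewrite -real_normK ?num_real// ler_sqr ?nnegrE.
  have S2 : (- beta j.+1 + beta j) ^+ 2 <= d ^+ 2 by rewrite addrC.
  (* [c] bounds the deviation from the Rankine-Hugoniot speed: [d / 2] for a front moving with one
     of the two adjacent speeds, [3 + 1] for a front coming to rest. The [3 / 4] completes the
     [1 / 4] of [front_excess]. *)
  have [c [c0 c1 cR cL]] : exists c, [/\ 0 <= c, c * d <= 3 / 4 * d ^+ 2 + 4 * d * (tr j.+1)%:R,
      `|V j.+1 - (- beta j - beta j.+1) / 2| <= c &
      `|- V j.+1 - (beta j.+1 + beta j) / 2| <= c].
    have Eabs : `|- V j.+1 - (beta j.+1 + beta j) / 2| =
        `|V j.+1 - (- beta j - beta j.+1) / 2|.
      rewrite -[LHS]normrN; congr `|_|; lra.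
    have := be0 j; have := be0 j.+1; have := be1 j; have := be1 j.+1 => ????.
    case T: (tr j.+1).
      exists 4; rewrite Eabs; split => //; first by rewrite mulr1; have := sqr_ge0 d; lra.
        move: (trE _ T); rewrite !ler_norml => /andP[? ?]; apply/andP; split; lra.
      move: (trE _ T); rewrite !ler_norml => /andP[? ?]; apply/andP; split; lra.
    exists (d / 2); rewrite Eabs mvE ?S ?T//; split => //.
    - by rewrite divr_ge0.
    - by rewrite mulr0 addr0 expr2; have := sqr_ge0 d; rewrite expr2; lra.
    - by move: N2; rewrite !ler_norml => /andP[? ?]; apply/andP; split; lra.
    - by move: N2; rewrite !ler_norml => /andP[? ?]; apply/andP; split; lra.
  have MR : `|V j.+1 - (- beta j - beta j.+1) / 2| * `|- beta j.+1 + beta j| <= c * d.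
    exact: ler_pM.
  have ML : `|- V j.+1 - (beta j.+1 + beta j) / 2| * `|beta j - beta j.+1| <= c * d.
    exact: ler_pM.
  have := aL j.+1; have := bL j.+1 => /andP[b0 b1] /andP[a0 a1].
  rewrite mul0r mulr0 addr0.
  set W := d ^+ 2 + 4 * d * (tr j.+1)%:R.
  have W0 : 0 <= W by rewrite addr_ge0 ?sqr_ge0// !mulr_ge0.
  have HR : q j.+1 - q j - V j.+1 * (Q j.+1 - Q j) <= W by rewrite /W; lra.
  have HL : p j - p j.+1 - - V j.+1 * (P j - P j.+1) <= W by rewrite /W; lra.
  have : a j.+1 * (q j.+1 - q j - V j.+1 * (Q j.+1 - Q j)) <= L * W.
    by apply: (le_trans (ler_wpM2l a0 HR)); rewrite ler_wpM2r.
  have : b j.+1 * (p j - p j.+1 - - V j.+1 * (P j - P j.+1)) <= L * W.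
    by apply: (le_trans (ler_wpM2l b0 HL)); rewrite ler_wpM2r.
  by rewrite /W; lra.
have key : \sum_(j < n) a j.+1 * ((q j.+1 - q j) - V j.+1 * (Q j.+1 - Q j)) +
    \sum_(j < n) b j.+1 * ((p j - p j.+1) - (- V j.+1) * (P j - P j.+1)) <=
    2 * n%:R * L * d ^+ 2 + 8 * L * d.
  rewrite -big_split/=; 
  apply: (@le_trans _ _ (\sum_(j < n) (2 * L * d ^+ 2 +
      8 * L * d * (tr j.+1)%:R + r * ((st j.+1)%:R * (G j.+1 - G j))))).
    by apply: ler_sum => j _; exact: step1.
  rewrite !big_split/= -!mulr_sumr.
  have := sum_initial_segment n stS G0 (fun j => proj2 (andP (Gle j))).
  have := sum_at_most_one n tr1.
  rewrite sumr_const card_ord -mulr_natl.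
  set s1 := \sum_(i < n) _; set s2 := \sum_(i < n) _ => s1le s2le.
  have : 8 * L * d * s1 <= 8 * L * d by rewrite ler_piMr// !mulr_ge0.
  have : r * s2 <= 0 by nra.
  by lra.
(* At the antipode of the shock the two families of cells meet in an upward jump from [- beta n] to
   [beta n]. Its sign is unfavourable, but its size is only quadratic in [beta n]. *)
have bnd : - (a n.+1 * (q n - p n)) <= L * beta n ^+ 2.
  have /andP[? ?] := Gle n; have /andP[? ?] := aL n.+1.
  rewrite -/(G n) -mulrN; apply: ler_pM => //; lra.
have cb0 : a 0%N * q 0%N = b 0%N * p 0%N.
  by rewrite ab0 /q /p be00 oppr0.
by rewrite -abN in key bnd *; lra.
Qed.

End KruzkovAlgebra.

(** * Characteristics and the sawtooth profile *)

Section SineFacts.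
Context {R : realType}.
Implicit Types (x y z m t : R).

Let pi0 : 0 < @pi R. Proof. exact: pi_gt0. Qed.

Lemma der_sin x : is_derive x 1 sin (cos x : R). Proof. exact: is_derive_sin. Qed.

Lemma der_cos x : is_derive x 1 cos (- sin x : R). Proof. exact: is_derive_cos. Qed.

Lemma sin_lip x y : `|sin x - sin y| <= `|x - y|.
Proof.
wlog xy : x y / x <= y.
  move=> H; have [/H//|/ltW/H] := leP x y.
  by rewrite distrC [leRHS]distrC.
have A : x - sin x <= y - sin y.
  apply: (der_ge0_le (f := fun z => z - sin z) (df := fun z => 1 - cos z)) => // z _.
have B : x + sin x <= y + sin y.
  apply: (der_ge0_le (f := fun z => z + sin z) (df := fun z => 1 + cos z)) => // z _.
by rewrite distrC [leRHS]distrC (ger0_norm (x := y - x)) ?ler_norml; lra.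
Qed.

Lemma sin_continuous : continuous (@sin R).
Proof. by apply: (@lip_continuous _ _ 1) => x y; rewrite mul1r sin_lip. Qed.

Lemma sin_gt_mul_cos m : 0 < m <= pi -> m * cos m < sin m.
Proof.
move=> /andP[m0 mpi].
have : sin 0 - 0 * cos 0 < sin m - m * cos m.
  apply: (der_gt0_lt (f := fun z => sin z - z * cos z) (df := fun z => z * sin z)) => // z.
    move=> _; apply: der_val (derB (der_sin z) (derM (der_id z) (der_cos z))); ring.
  move=> /andP[z0 zm]; rewrite mulr_gt0// sin_gt0_pi// z0/=.
  exact: lt_le_trans zm mpi.
by rewrite sin0; lra.
Qed.

(** The monotonicity of [sin z / z] without denominators: for [z > m] the derivative
    [sin m - m * cos z] exceeds [sin m - m * cos m], which is positive. *)
Lemma sin_div_decr m m' : 0 < m -> m < m' -> m' <= pi -> 0 < m' * sin m - m * sin m'.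
Proof.
move=> m0 mm' m'pi.
have : m * sin m - m * sin m < m' * sin m - m * sin m'.
  apply: (der_gt0_lt (f := fun z => z * sin m - m * sin z)
    (df := fun z => sin m - m * cos z)) => // z.
    move=> _; apply: der_val (derB (derM (der_id z) (der_cst (sin m) z))
      (derZ m (der_sin z))); ring.
  move=> /andP[mz zm'].
  have := @sin_gt_mul_cos m _; rewrite m0 (le_trans (ltW mm'))// => /(_ isT).
  have : cos z < cos m by rewrite ltr_cos// in_itv/=; apply/andP; split; lra.
  by nra.
by rewrite subrr.
Qed.

Lemma jordan m : 0 <= m <= pi / 2 -> m <= pi / 2 * sin m.
Proof.
move=> /andP[]; rewrite le_eqVlt => /predU1P[<-|m0]; first by rewrite sin0 mulr0.
rewrite le_eqVlt => /predU1P[->|mpi]; first by rewrite sin_pihalf mulr1.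
by have := @sin_div_decr m (pi / 2) m0 mpi; rewrite sin_pihalf; lra.
Qed.

End SineFacts.

Section Fronts.
Context {R : realType}.
Implicit Types (t m eta : R) (n i j : nat).

Let pi0 : 0 < @pi R. Proof. exact: pi_gt0. Qed.

(* The characteristic of [- sin] issued from [m]. *)
Definition front t m : R := m - t * sin m.

(** The [minn] freezes the grid at [pi] beyond index [n.+1], so that bounds and monotonicity hold
    for all [j]. *)
Definition grid n j : R := (minn j n.+1)%:R * pi / n.+1%:R.

Lemma grid0 n : grid n 0 = 0. Proof. by rewrite /grid min0n !mul0r. Qed.

Lemma gridN n : grid n n.+1 = pi.
Proof. by rewrite /grid minnn mulrAC divff ?mul1r// pnatr_eq0. Qed.

Lemma grid_bound n j : 0 <= grid n j <= pi.
Proof.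
rewrite /grid divr_ge0 ?mulr_ge0 ?ler0n ?(ltW pi0)//=.
by rewrite ler_pdivrMr ?ltr0n// mulrC ler_pM2l// ler_nat geq_minr.
Qed.

Lemma grid_step n j : 0 <= grid n j.+1 - grid n j <= pi / n.+1%:R.
Proof.
rewrite /grid; have N0 : 0 < n.+1%:R :> R by rewrite ltr0n.
rewrite -mulrBl -mulrBl.
set c : R := (minn j.+1 n.+1)%:R - (minn j n.+1)%:R.
have /andP[A B] : 0 <= c <= 1.
  rewrite /c.
  have [jn|nj] := ltnP j n.+1.
    by rewrite (minn_idPl jn) -natr1; lra.
  by rewrite (minn_idPr (leqW nj)) subrr lexx ler01.
rewrite divr_ge0 ?mulr_ge0 ?(ltW pi0) ?(ltW N0)//= ler_pM2r ?invr_gt0//.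
by rewrite ler_piMl ?(ltW pi0).
Qed.

Lemma front0 t : front t 0 = 0. Proof. by rewrite /front sin0 mulr0 subr0. Qed.

Lemma front_pi t : front t pi = pi. Proof. by rewrite /front sinpi mulr0 subr0. Qed.

(** [sin m * front t m'] equals the gap plus [sin m' * front t m], and [sin m <= 1]. The gap does
    not depend on [t]: as long as the inner front has not reached the shock, the outer one stays at
    a fixed distance from it. *)
Lemma front_gap t m m' : 0 < m -> m < m' -> m' <= pi -> 0 < front t m ->
  m' * sin m - m * sin m' <= front t m'.
Proof.
move=> m0 mm' m'pi; rewrite /front => F.
have s0 : 0 < sin m by apply: sin_gt0_pi; rewrite m0 (lt_le_trans mm').
have s'0 : 0 <= sin m' by apply: sin_ge0_pi; rewrite m'pi andbT; lra.
have D := sin_div_decr m0 mm' m'pi.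
have s1 := sin_le1 m.
have E : sin m * (m' - t * sin m') =
    (m' * sin m - m * sin m') + sin m' * (m - t * sin m) by ring.
have P : 0 <= sin m' * (m - t * sin m) by rewrite mulr_ge0// ltW.
have Q : 0 < m' - t * sin m' by rewrite -(pmulr_rgt0 _ s0); lra.
have : sin m * (m' - t * sin m') <= m' - t * sin m' by rewrite ler_piMl// ltW.
by lra.
Qed.

Lemma front_pos t m m' : 0 <= m -> m <= m' -> m' <= pi -> 0 < front t m ->
  0 < front t m'.
Proof.
move=> m0 + m'pi F; rewrite le_eqVlt => /predU1P[<-//|mm'].
move: m0; rewrite le_eqVlt => /predU1P[m0|m0]; first by rewrite -m0 front0 ltxx in F.
exact: lt_le_trans (sin_div_decr m0 mm' m'pi) (front_gap m0 mm' m'pi F).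
Qed.

(** Up to time 1 this is the Lipschitz bound for the sine; later,
    [front t m / m = 1 - t * sin m / m] increases in [m]. Negative times occur because the temporal
    cutoff reaches back to -1. *)
Lemma front_homo t m m' : -1 <= t -> 0 <= m -> m <= m' -> m' <= pi ->
  0 < front t m -> front t m <= front t m'.
Proof.
move=> t1 m0 mm' m'pi F; have [t0|t0] := leP t 1.
  have := sin_lip m m'; rewrite distrC [leRHS]distrC.
  rewrite (ger0_norm (x := m' - m)) ?subr_ge0// ler_norml /front => /andP[? ?].
  have [|/ltW] := leP 0 (sin m' - sin m); nra.
move: mm'; rewrite le_eqVlt => /predU1P[<-//|mm'].
move: m0; rewrite le_eqVlt => /predU1P[m0|m0]; first by rewrite -m0 front0 ltxx in F.
have D := sin_div_decr m0 mm' m'pi.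
rewrite -(ler_pM2l m0).
have : m * front t m' - m' * front t m = t * (m' * sin m - m * sin m').
  by rewrite /front; ring.
have : 0 < t * (m' * sin m - m * sin m') by rewrite mulr_gt0//; lra.
have : m * front t m <= m' * front t m by rewrite ler_pM2r// ltW.
by lra.
Qed.

Definition pos eta t m : R := ramp eta (front t m).
Definition vel eta t m : R := ramp' eta (front t m) * - sin m.

Lemma der_pos eta t m : is_derive t 1 (fun s => pos eta s m) (vel eta t m).
Proof.
have F : is_derive t 1 (fun s => front s m) (- sin m).
  apply: der_val (derB (der_cst m t) (derM (der_id t) (der_cst (sin m) t))); ring.
by have := @der_comp _ (ramp eta) (fun s => front s m) _ _ _ (der_ramp eta _) F.
Qed.

Lemma vel_continuous eta m : continuous (fun t => vel eta t m).
Proof.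
have F : continuous (fun s => front s m).
  move=> s; apply: cvgB; first exact: cvg_cst.
  by apply: cvgMr_tmp; exact: cvg_id.
move=> t; apply: cvgMr_tmp.
by apply: (@cvg_comp _ _ _ _ (ramp' eta) _ _ _ (F t)); exact: ramp'_continuous.
Qed.

Lemma pos_homo eta t m m' : 0 < eta -> -1 <= t -> 0 <= m -> m <= m' -> m' <= pi ->
  pos eta t m <= pos eta t m'.
Proof.
move=> e0 t1 m0 mm' m'pi; rewrite /pos; have [F|F] := leP (front t m) 0.
  by rewrite (ramp_le0 e0 F).1 ramp_ge0.
by rewrite ramp_homo// front_homo.
Qed.

Lemma pos0 eta t : 0 < eta -> pos eta t 0 = 0.
Proof. by move=> e0; rewrite /pos front0 (ramp_le0 e0 (lexx 0)).1. Qed.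

Lemma pos_pi eta t : 0 < eta -> eta <= pi -> pos eta t pi = pi.
Proof. by move=> e0 e1; rewrite /pos front_pi (ramp_ge e0 e1).1. Qed.

Lemma pos_bound eta t m : 0 < eta -> eta <= pi -> -1 <= t -> 0 <= m <= pi ->
  0 <= pos eta t m <= pi.
Proof.
move=> e0 e1 t1 /andP[m0 m1]; rewrite ramp_ge0//=.
by rewrite -[leRHS](pos_pi t e0 e1) pos_homo.
Qed.

(* At most one front at a time is being slowed down before it sticks at 0. *)
Lemma grid_separation n : exists2 eta1 : R, 0 < eta1 &
  forall t i j, (i < j)%N -> 0 < front t (grid n i) -> eta1 <= front t (grid n j).
Proof.
have [f fP] : exists f : nat -> R, forall i, 0 < f i /\
    forall t, 0 < front t (grid n i) -> f i <= front t (grid n i.+1).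
  suff : forall i, exists c : R, 0 < c /\
      forall t, 0 < front t (grid n i) -> c <= front t (grid n i.+1).
    by move=> /choice[f fP]; exists f.
  move=> i; have /andP[A B] := grid_bound n i; have /andP[C D] := grid_bound n i.+1.
  have /andP[E _] := grid_step n i.
  move: A; rewrite le_eqVlt => /predU1P[<-|A].
    by exists 1; split => // t; rewrite front0 ltxx.
  have [G|G] := leP (grid n i.+1) (grid n i).
    have -> : grid n i = grid n i.+1 by lra.
    have ipi : grid n i.+1 = pi.
      have [ni|ni] := leqP n.+1 i.
        by rewrite -[RHS](gridN n) /grid (minn_idPr (leqW ni)) minnn.
      move: G; rewrite /grid (minn_idPl (ltnW ni)) (minn_idPl ni).
      by rewrite ler_pM2r ?invr_gt0 ?ltr0n// ler_pM2r// ler_nat ltnn.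
    by exists pi; split => // t _; rewrite ipi front_pi.
  exists (grid n i.+1 * sin (grid n i) - grid n i * sin (grid n i.+1)); split.
    exact: sin_div_decr.
  by move=> t; exact: front_gap.
have [e [e0 eP]] : exists e : R, 0 < e /\ forall i, (i < n.+1)%N -> e <= f i.
  elim: (n.+1) => [|k [e [e0 eP]]]; first by exists 1.
  exists (Num.min e (f k)); split; first by rewrite lt_min e0 (fP k).1.
  move=> i; rewrite ltnS leq_eqVlt => /predU1P[->|/eP]; first by rewrite ge_min lexx orbT.
  by rewrite ge_min => ->.
exists (Num.min e pi); first by rewrite lt_min e0.
move=> t i j ij F; have [jn|nj] := leqP j n.+1; last first.
  rewrite /grid (minn_idPr (ltnW nj)) mulrAC divff ?pnatr_eq0// mul1r front_pi.
  by rewrite ge_min lexx orbT.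
case: j => // j in ij jn *.
have F' : 0 < front t (grid n j).
  apply: front_pos F; [by case/andP: (grid_bound n i)| |by case/andP: (grid_bound n j)].
  by rewrite /grid ler_pM2r ?invr_gt0 ?ltr0n// ler_pM2r//
    ler_nat leq_min geq_minr andbT (leq_trans (geq_minl _ _)).
by rewrite ge_min (le_trans (eP j jn)) ?(fP j).2.
Qed.

End Fronts.

Section Profile.
Context {R : realType}.
Implicit Types (T x y z o : R).

Let pi0 : 0 < @pi R. Proof. exact: pi_gt0. Qed.

Definition clamp_pihalf o : R := relu (o + pi / 2) - relu (o - pi / 2) - pi / 2.

(* [x |-> x + pi] conjugates [o |-> o + T * sin o] to [front T]; clamping the
   argument of the sine makes it a bijection of the line. *)
Definition zmap T o : R := o + T * sin (clamp_pihalf o).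

Lemma clamp_id x : - (pi / 2) <= x <= pi / 2 -> clamp_pihalf x = x.
Proof. by move=> /andP[? ?]; rewrite /clamp_pihalf relu_pos ?relu_neg; lra. Qed.

Lemma clamp_ge x : pi / 2 <= x -> clamp_pihalf x = pi / 2.
Proof. by move=> ?; have p0 := pi0; rewrite /clamp_pihalf !relu_pos; lra. Qed.

Lemma clamp_le x : x <= - (pi / 2) -> clamp_pihalf x = - (pi / 2).
Proof. by move=> ?; have p0 := pi0; rewrite /clamp_pihalf !relu_neg; lra. Qed.

Lemma clampP x : [\/ - (pi / 2) <= x <= pi / 2 /\ clamp_pihalf x = x,
  pi / 2 <= x /\ clamp_pihalf x = pi / 2 |
  x <= - (pi / 2) /\ clamp_pihalf x = - (pi / 2)].
Proof.
have [xp|xp] := leP (pi / 2) x; first by constructor 2; rewrite clamp_ge.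
have [xm|xm] := leP x (- (pi / 2)); first by constructor 3; rewrite clamp_le.
have H : - (pi / 2) <= x <= pi / 2 by rewrite !ltW.
by constructor 1; rewrite clamp_id.
Qed.

Lemma clamp_bound x : - (pi / 2) <= clamp_pihalf x <= pi / 2.
Proof. have p0 := pi0; case: (clampP x) => -[].
- by move=> ? ->.
- by move=> _ ->; apply/andP; split; lra.
- by move=> _ ->; apply/andP; split; lra. Qed.

Lemma clamp_homo x y : x <= y -> clamp_pihalf x <= clamp_pihalf y.
Proof.
have p0 := pi0 => xy.
case: (clampP x) => -[+ ->] => [/andP[? ?]|?|?];
  case: (clampP y) => -[+ ->] => [/andP[? ?]|?|?]; lra.
Qed.

Lemma zmap_expand T x y : 0 <= T -> x <= y -> y - x <= zmap T y - zmap T x.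
Proof.
move=> T0 xy; rewrite /zmap.
have : sin (clamp_pihalf x) <= sin (clamp_pihalf y).
  have := clamp_homo xy; rewrite le_eqVlt => /predU1P[->//|xy'].
  by apply: ltW; rewrite ltr_sin// in_itv/= clamp_bound.
by nra.
Qed.

Lemma zmap_continuous T : continuous (zmap T).
Proof.
have C : continuous clamp_pihalf.
  apply: (@lip_continuous _ _ 2) => x y; rewrite /clamp_pihalf.
  have := relu_lip (x + pi / 2) (y + pi / 2); have := relu_lip (x - pi / 2) (y - pi / 2).
  rewrite (_ : x + pi / 2 - (y + pi / 2) = x - y); last by ring.
  rewrite (_ : x - pi / 2 - (y - pi / 2) = x - y); last by ring.
  by rewrite !ler_norml => /andP[? ?] /andP[? ?]; apply/andP; split; lra.
move=> o; apply: cvgD; first exact: cvg_id.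
apply: cvgMl_tmp; apply: (@cvg_comp _ _ _ _ sin _ _ _ (C o)); exact: sin_continuous.
Qed.

Lemma zmap_inverse T : 0 <= T -> exists w : R -> R, forall z, zmap T (w z) = z.
Proof.
move=> T0; suff : forall z, exists o, zmap T o = z by move=> /choice[w wP]; exists w.
move=> z; pose B := `|z| + T; have B0 : 0 <= B by rewrite addr_ge0.
have zB : - B <= B by lra.
have bnd o : - T <= T * sin (clamp_pihalf o) <= T.
  have := sin_le1 (clamp_pihalf o); have := sin_geN1 (clamp_pihalf o).
  by move=> *; apply/andP; split; nra.
have := ler_norm z; have := ler_norm (- z); rewrite normrN => n1 n2.
have [| |c _ cz] := @IVT R (zmap T) (- B) B z zB.
- exact/continuous_subspaceT/zmap_continuous.
- have := bnd B; have := bnd (- B); rewrite /zmap => /andP[? ?] /andP[? ?].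
  rewrite ge_min le_max; apply/andP; split; apply/orP; [left|right]; rewrite /B; lra.
by exists c.
Qed.

Lemma zmap_le_inv T w y z : 0 <= T -> (forall z, zmap T (w z) = z) ->
  z <= zmap T y -> w z <= y.
Proof.
move=> T0 wP zy; rewrite leNgt; apply/negP => yw.
by have := zmap_expand T0 (ltW yw); rewrite wP; lra.
Qed.

Lemma zmap_ge_inv T w y z : 0 <= T -> (forall z, zmap T (w z) = z) ->
  zmap T y <= z -> y <= w z.
Proof.
move=> T0 wP zy; rewrite leNgt; apply/negP => yw.
by have := zmap_expand T0 (ltW yw); rewrite wP; lra.
Qed.

Lemma winv_lip T w y z : 0 <= T -> (forall z, zmap T (w z) = z) -> y <= z ->
  0 <= w z - w y <= z - y.
Proof.
move=> T0 wP yz.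
have A : w y <= w z by apply: (zmap_ge_inv T0 wP); rewrite wP.
by have := zmap_expand T0 A; rewrite !wP; lra.
Qed.

Lemma winv_continuous T w : 0 <= T -> (forall z, zmap T (w z) = z) -> continuous w.
Proof.
move=> T0 wP; apply: (@lip_continuous _ _ 1) => x y; rewrite mul1r.
wlog xy : x y / x <= y.
  by move=> H; have [/H//|/ltW/H] := leP x y; rewrite distrC [leRHS]distrC.
have /andP[? ?] := winv_lip T0 wP xy.
by rewrite distrC [leRHS]distrC !ger0_norm; lra.
Qed.

Lemma zmapN T o : zmap T (- o) = - zmap T o.
Proof.
rewrite /zmap (_ : clamp_pihalf (- o) = - clamp_pihalf o); first by rewrite sinN; ring.
have p0 := pi0.
case: (clampP o) => -[+ ->] => [/andP[? ?]|?|?];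
  case: (clampP (- o)) => -[+ ->] => [/andP[? ?]|?|?]; lra.
Qed.

Lemma winvN T w z : 0 <= T -> (forall z, zmap T (w z) = z) -> w (- z) = - w z.
Proof.
move=> T0 wP; apply/eqP; rewrite eq_le.
by rewrite (zmap_le_inv T0 wP) ?(zmap_ge_inv T0 wP)// zmapN wP.
Qed.

Lemma zmap_sub_pi T m : pi / 2 <= m <= pi -> zmap T (m - pi) = front T m - pi.
Proof.
move=> /andP[? ?]; rewrite /zmap clamp_id /front; last by apply/andP; split; lra.
by rewrite -[m in RHS](subrK pi) sinDpi; ring.
Qed.

(** Between two fronts the profile is close to the constant of the cell. Besides the mesh, the
    smearing [h], the delay [theta] and the smoothing [eta] each cost at most their own length,
    because [zmap T] expands distances. *)
Lemma winv_between_fronts T w theta t eta h m m' z :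
  pi < T -> (forall z, zmap T (w z) = z) -> 0 < eta -> 0 <= h ->
  T <= t <= T + theta -> 0 <= m -> m <= m' -> m' <= pi ->
  pos eta t m - pi - h <= z <= pos eta t m' - pi + h -> - pi < z ->
  0 < pos eta t m' ->
  `|w z - (m - pi)| <= (m' - m) + h + theta + eta.
Proof.
move=> Tpi wP e0 h0 /andP[t1 t2] m0 mm' m'pi /andP[z1 z2] zpi X'.
have T0 : 0 <= T by lra.
have F' : 0 < front t m'.
  by rewrite ltNge; apply/negP => F; move: X'; rewrite /pos (ramp_le0 e0 F).1 ltxx.
have sm' : 0 <= sin m' by apply: sin_ge0_pi; rewrite m'pi andbT; lra.
have sm : 0 <= sin m by apply: sin_ge0_pi; rewrite m0/=; lra.
have sm1 := sin_le1 m.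
(* A characteristic alive at time [T] has label at least [pi / 2], where the clamp in [zmap] is
   inactive: below, Jordan's inequality gives [x <= pi / 2 * sin x <= t' * sin x]. *)
have big x t' : T <= t' -> 0 <= x -> 0 < front t' x -> pi / 2 <= x.
  move=> Tt' x0 Fx; rewrite leNgt; apply/negP => xpi.
  have J := @jordan R x; rewrite x0 (ltW xpi) in J; have {}J := J isT.
  by move: Fx; rewrite /front; nra.
have up : w z <= m' - pi + h.
  apply: (zmap_le_inv T0 wP).
  have E : zmap T (m' - pi) = front T m' - pi.
    by apply: zmap_sub_pi; rewrite m'pi (big _ t)//; lra.
  have := @zmap_expand T (m' - pi) (m' - pi + h) T0; rewrite E => H.
  have {H} : m' - pi + h - (m' - pi) <= zmap T (m' - pi + h) - (front T m' - pi).
    by apply: H; lra.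
  have := ramp_le eta (ltW F'); rewrite -/(pos _ _ _).
  have : front t m' <= front T m' by rewrite /front; nra.
  by lra.
have lo : m - pi - (theta + eta + h) <= w z.
  apply: (zmap_ge_inv T0 wP).
  have th0 : 0 <= theta + eta + h by lra.
  have Hx x : zmap T x <= z + (theta + eta + h) -> zmap T (x - (theta + eta + h)) <= z.
    have := @zmap_expand T (x - (theta + eta + h)) x T0 => H1 H2.
    by have := H1 ltac:(lra); lra.
  apply: Hx.
  (* For [m <= pi / 2] compare with [- (pi / 2)] instead, whose image [- (pi / 2) - T] is already
     below [- pi < z]. *)
  have [mp|mp] := leP m (pi / 2).
    apply: (@le_trans _ _ (zmap T (- (pi / 2)))).
      have := @zmap_expand T (m - pi) (- (pi / 2)) T0 => H.
      by have := H ltac:(lra); lra.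
    rewrite /zmap clamp_id; last by apply/andP; split; lra.
    by rewrite sinN sin_pihalf; lra.
  have -> : zmap T (m - pi) = front T m - pi.
    by apply: zmap_sub_pi; apply/andP; split; lra.
  have := ramp_geB (front t m) e0; rewrite -/(pos _ _ _) /front => ?.
  have : t * sin m <= (T + theta) * sin m by rewrite ler_wpM2r.
  have : theta * sin m <= theta by rewrite ler_piMr//; lra.
  by lra.
by rewrite ler_norml; apply/andP; split; lra.
Qed.

End Profile.

(** * Test functions supported on moving cells *)

Section TestFunctions.
Context {R : realType}.
Implicit Types (x y t h xi : R).

Lemma continuous_comp2 (f : R -> R) (g : R * R -> R) :
  continuous f -> continuous g -> continuous (fun p => f (g p)).
Proof. by move=> cf cg p; apply: continuous_comp; [exact: cg|exact: cf]. Qed.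

Lemma continuousD2 (f g : R * R -> R) :
  continuous f -> continuous g -> continuous (fun p => f p + g p).
Proof. by move=> cf cg p; apply: cvgD; [exact: cf|exact: cg]. Qed.

Lemma continuousB2 (f g : R * R -> R) :
  continuous f -> continuous g -> continuous (fun p => f p - g p).
Proof. by move=> cf cg p; apply: cvgB; [exact: cf|exact: cg]. Qed.

Lemma continuousM2 (f g : R * R -> R) :
  continuous f -> continuous g -> continuous (fun p => f p * g p).
Proof. by move=> cf cg p; apply: cvgM; [exact: cf|exact: cg]. Qed.

Lemma continuous_fst2 : continuous (fun p : R * R => p.1).
Proof. by move=> p; exact: cvg_fst. Qed.

Lemma continuous_snd2 : continuous (fun p : R * R => p.2).
Proof. by move=> p; exact: cvg_snd. Qed.

Lemma continuous_cst2 (c : R) : continuous (fun p : R * R => c).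
Proof. by move=> p; exact: cvg_cst. Qed.

(** The periodic indicator of the arc from [a] to [b], its edges smeared over a length [h]. As a
    difference of values of one primitive it telescopes, so adjacent cells form a partition of
    unity. *)
Definition cell h (a b y : R) : R := pstep h (y - a) - pstep h (y - b).

Definition cell_fn h xi (chi X Y : R -> R) x t : R := chi t * cell h (X t) (Y t) (x - xi).

Definition cell_dx h xi (chi X Y : R -> R) x t : R :=
  chi t * (pstep' h (x - xi - X t) - pstep' h (x - xi - Y t)).

Definition cell_dt h xi (chi chi' X Y VX VY : R -> R) x t : R :=
  chi' t * cell h (X t) (Y t) (x - xi) +
  chi t * (VY t * pstep' h (x - xi - Y t) - VX t * pstep' h (x - xi - X t)).

Lemma cell_derivatives h xi (chi chi' X Y VX VY : R -> R) x t :
  0 < h -> h < 2 * pi ->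
  (forall s : R, is_derive s 1 X (VX s)) -> (forall s : R, is_derive s 1 Y (VY s)) ->
  (forall s : R, is_derive s 1 chi (chi' s)) ->
  is_derive x 1 (fun y => cell_fn h xi chi X Y y t) (cell_dx h xi chi X Y x t) /\
  is_derive t 1 (fun s => cell_fn h xi chi X Y x s)
    (cell_dt h xi chi chi' X Y VX VY x t).
Proof.
move=> h0 hpi dX dY dchi; split.
  have sh c : is_derive x 1 (fun y => y - xi - c) 1.
    by apply: der_val (derB (derB (der_id x) (der_cst xi x)) (der_cst c x)); lra.
  have st c : is_derive x 1 (fun y => pstep h (y - xi - c)) (pstep' h (x - xi - c)).
    apply: der_val (@der_comp _ (pstep h) (fun y => y - xi - c) _ _ _
      (der_pstep _ h0 hpi) (sh c)).
    by rewrite mulr1.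
  exact: derZ (derB (st _) (st _)).
have st (Z VZ : R -> R) : (forall s : R, is_derive s 1 Z (VZ s)) ->
    is_derive t 1 (fun s => pstep h (x - xi - Z s)) (- (VZ t * pstep' h (x - xi - Z t))).
  move=> dZ.
  apply: der_val (@der_comp _ (pstep h) (fun s => x - xi - Z s) _ _ _
    (der_pstep _ h0 hpi) (derB (der_cst (x - xi) t) (dZ t))).
  by ring.
apply: der_val (derM (dchi t) (derB (st _ _ dX) (st _ _ dY))).
by rewrite /cell_dt /cell; ring.
Qed.

Lemma cell_derive1 h xi (chi chi' X Y VX VY : R -> R) x t :
  0 < h -> h < 2 * pi ->
  (forall s : R, is_derive s 1 X (VX s)) -> (forall s : R, is_derive s 1 Y (VY s)) ->
  (forall s : R, is_derive s 1 chi (chi' s)) ->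
  dx (cell_fn h xi chi X Y) x t = cell_dx h xi chi X Y x t /\
  dt (cell_fn h xi chi X Y) x t = cell_dt h xi chi chi' X Y VX VY x t.
Proof.
move=> h0 hpi dX dY dchi.
have [A B] := @cell_derivatives h xi chi chi' X Y VX VY x t h0 hpi dX dY dchi.
by rewrite /dx /dt !derive1E !derive_val.
Qed.

Lemma continuous_cell_dx h xi (chi X Y : R -> R) :
  0 < h -> h < 2 * pi -> continuous chi -> continuous X -> continuous Y ->
  continuous (fun p : R * R => cell_dx h xi chi X Y p.1 p.2).
Proof.
move=> h0 hpi cchi cX cY.
have st (Z : R -> R) : continuous Z ->
    continuous (fun p : R * R => pstep' h (p.1 - xi - Z p.2)).
  move=> cZ; apply: continuous_comp2; first exact: pstep'_continuous.
  apply: continuousB2; first exact: (continuousB2 continuous_fst2 (@continuous_cst2 xi)).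
  exact: (continuous_comp2 cZ continuous_snd2).
apply: continuousM2; first exact: (continuous_comp2 cchi continuous_snd2).
by apply: continuousB2; exact: st.
Qed.

Lemma continuous_cell_fn h xi (chi X Y : R -> R) :
  0 < h -> h < 2 * pi -> continuous chi -> continuous X -> continuous Y ->
  continuous (fun p : R * R => cell_fn h xi chi X Y p.1 p.2).
Proof.
move=> h0 hpi cchi cX cY.
have st (Z : R -> R) : continuous Z ->
    continuous (fun p : R * R => pstep h (p.1 - xi - Z p.2)).
  move=> cZ; apply: continuous_comp2; first exact: pstep_continuous.
  apply: continuousB2; first exact: (continuousB2 continuous_fst2 (@continuous_cst2 xi)).
  exact: (continuous_comp2 cZ continuous_snd2).
apply: continuousM2; first exact: (continuous_comp2 cchi continuous_snd2).
by apply: continuousB2; exact: st.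
Qed.

Lemma continuous_cell_dt h xi (chi chi' X Y VX VY : R -> R) :
  0 < h -> h < 2 * pi -> continuous chi -> continuous chi' ->
  continuous X -> continuous Y -> continuous VX -> continuous VY ->
  continuous (fun p : R * R => cell_dt h xi chi chi' X Y VX VY p.1 p.2).
Proof.
move=> h0 hpi cchi cchi' cX cY cVX cVY.
have st (Z : R -> R) : continuous Z ->
    continuous (fun p : R * R => pstep' h (p.1 - xi - Z p.2)).
  move=> cZ; apply: continuous_comp2; first exact: pstep'_continuous.
  apply: continuousB2; first exact: (continuousB2 continuous_fst2 (@continuous_cst2 xi)).
  exact: (continuous_comp2 cZ continuous_snd2).
apply: continuousD2; first exact: continuous_cell_fn.
apply: continuousM2; first exact: (continuous_comp2 cchi continuous_snd2).
by apply: continuousB2; apply: continuousM2;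
  [exact: (continuous_comp2 cVY continuous_snd2)|exact: st|
   exact: (continuous_comp2 cVX continuous_snd2)|exact: st].
Qed.

Lemma test_fn_cell h xi (chi chi' X Y VX VY : R -> R) (M : R) :
  0 < h -> h < 2 * pi ->
  (forall s : R, is_derive s 1 X (VX s)) -> (forall s : R, is_derive s 1 Y (VY s)) ->
  (forall s : R, is_derive s 1 chi (chi' s)) ->
  continuous chi' -> continuous VX -> continuous VY ->
  (forall t, 0 <= chi t) -> (forall t, M < t -> chi t = 0) ->
  (forall t, chi t != 0 -> X t <= Y t) ->
  test_fn (cell_fn h xi chi X Y).
Proof.
move=> h0 hpi dX dY dchi cchi' cVX cVY chi0 chiM XY.
have cont (f f' : R -> R) : (forall s : R, is_derive s 1 f (f' s)) -> continuous f.
  by move=> df s; exact: der_continuous (df s).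
split.
- move=> x t; rewrite /cell_fn /cell; congr (_ * _).
  have E c : x + 2 * pi - xi - c = (x - xi - c) + 2 * pi by ring.
  by rewrite !E !pstepD2pi; ring.
- by exists M => x t /chiM; rewrite /cell_fn => ->; rewrite mul0r.
- move=> x t; rewrite /cell_fn; have [->|chit] := eqVneq (chi t) 0; first by rewrite mul0r.
  by rewrite mulr_ge0// /cell subr_ge0 pstep_homo//; have := XY _ chit; lra.
- move=> x t.
  have [A B] := @cell_derivatives h xi chi chi' X Y VX VY x t h0 hpi dX dY dchi.
  by split; apply: ex_derive.
- have E x t := @cell_derive1 h xi chi chi' X Y VX VY x t h0 hpi dX dY dchi.
  split.
    rewrite (_ : (fun p : R * R => _) = (fun p => cell_dx h xi chi X Y p.1 p.2)).
      by apply: continuous_cell_dx => //; exact: cont.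
    by apply/funext => p; rewrite (E _ _).1.
  rewrite (_ : (fun p : R * R => _) =
     (fun p => cell_dt h xi chi chi' X Y VX VY p.1 p.2)).
    by apply: continuous_cell_dt => //; exact: cont.
  by apply/funext => p; rewrite (E _ _).2.
Qed.

End TestFunctions.

(** * Front tracking *)

Section Integration.
Context {R : realType}.
Implicit Types (a b B M : R).
Local Notation mu := (@lebesgue_measure R).

Lemma bounded_integrable d (T : measurableType d) (m : {measure set T -> \bar R})
    (A : set T) (f : T -> R) B :
  measurable A -> (m A < +oo)%E -> measurable_fun A f ->
  (forall x, A x -> `|f x| <= B) -> m.-integrable A (EFin \o f).
Proof.
move=> mA mAoo mf fB; apply: measurable_bounded_integrable => //.
by exists B; split; [exact: num_real|move=> r Br x Ax; apply: le_trans (fB x Ax) (ltW Br)].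
Qed.

Lemma itv_measure a b : a <= b -> mu `[a, b]%classic = (b - a)%:E.
Proof.
move=> ab; rewrite lebesgue_measure_itv/= lte_fin.
by case: ltP => // ba; rewrite (le_anti (introT andP (conj ab ba))) subrr.
Qed.

Lemma itv_finite a b : (mu `[a, b]%classic < +oo)%E.
Proof.
by rewrite lebesgue_measure_itv/=; case: ifPn => // _; rewrite -EFinB ltry.
Qed.

Lemma itv_integrable a b B (f : R -> R) : measurable_fun `[a, b]%classic f ->
  (forall x, a <= x <= b -> `|f x| <= B) -> mu.-integrable `[a, b]%classic (EFin \o f).
Proof.
by move=> mf fB; apply: (bounded_integrable (B := B)) => //; exact: itv_finite.
Qed.

Lemma itv_cst_integrable a b (c : R) : mu.-integrable `[a, b]%classic (EFin \o (fun=> c)).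
Proof. by apply: (itv_integrable (B := `|c|)) => //; exact: measurable_cst. Qed.

Lemma Rintegral_itv_cst a b (c : R) : a <= b -> \int[mu]_(x in `[a, b]) c = c * (b - a).
Proof. 
move=> ab; rewrite Rintegral_cst//; congr (_ * _).
by have /(congr1 fine) := itv_measure ab.
Qed.

Lemma RintegralE (f : R -> R) a b : mu.-integrable `[a, b]%classic (EFin \o f) ->
  (\int[mu]_(x in `[a, b]) (f x)%:E = (\int[mu]_(x in `[a, b]) f x)%R%:E)%E.
Proof. by move=> fi; rewrite /Rintegral fineK//; exact: integrable_fin_num. Qed.

Lemma integrable_ext (D : set R) (f g : R -> R) : measurable D ->
  (forall x, D x -> f x = g x) ->
  mu.-integrable D (EFin \o f) -> mu.-integrable D (EFin \o g).
Proof.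
move=> mD fg; apply: (@eq_integrable _ _ _ mu D mD (EFin \o f)) => x.
by rewrite inE => Dx /=; rewrite fg.
Qed.

Lemma integrable_add (D : set R) (f g : R -> R) : measurable D ->
  mu.-integrable D (EFin \o f) -> mu.-integrable D (EFin \o g) ->
  mu.-integrable D (EFin \o (fun x => f x + g x)).
Proof.
move=> mD fi gi.
apply: (@eq_integrable _ _ _ mu D mD ((EFin \o f) \+ (EFin \o g))%E) => //.
exact: integrableD.
Qed.

Lemma integrable_scale (D : set R) (f : R -> R) (c : R) : measurable D ->
  mu.-integrable D (EFin \o f) -> mu.-integrable D (EFin \o (fun x => c * f x)).
Proof.
move=> mD fi.
apply: (@eq_integrable _ _ _ mu D mD (fun x => c%:E * (EFin \o f) x)%E) => //.
exact: integrableZl.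
Qed.

Lemma Rintegral_add (D : set R) (f g : R -> R) : measurable D ->
  mu.-integrable D (EFin \o f) -> mu.-integrable D (EFin \o g) ->
  \int[mu]_(x in D) (f x + g x) = \int[mu]_(x in D) f x + \int[mu]_(x in D) g x.
Proof. by move=> mD fi gi; rewrite RintegralD. Qed.

Lemma Rintegral_scale (D : set R) (f : R -> R) (c : R) : measurable D ->
  mu.-integrable D (EFin \o f) ->
  \int[mu]_(x in D) (c * f x) = c * \int[mu]_(x in D) f x.
Proof. by move=> mD fi; rewrite RintegralZl. Qed.

Lemma Rintegral_sum (I : Type) (s : seq I) (D : set R) (f : I -> R -> R) :
  measurable D -> (forall i, mu.-integrable D (EFin \o f i)) ->
  mu.-integrable D (EFin \o (fun x => \sum_(i <- s) f i x)) /\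
  \int[mu]_(x in D) (\sum_(i <- s) f i x) = \sum_(i <- s) \int[mu]_(x in D) f i x.
Proof.
move=> mD fi; elim: s => [|i s [IH1 IH2]].
  split; last by rewrite big_nil; under eq_Rintegral do rewrite big_nil;
    rewrite Rintegral_cst// mul0r.
  apply: (@integrable_ext _ (fun=> 0)) => //; first by move=> x _; rewrite big_nil.
  exact: integrable0.
have E : (fun x => \sum_(j <- i :: s) f j x) = (fun x => f i x + \sum_(j <- s) f j x).
  by apply/funext => x; rewrite big_cons.
split.
  by rewrite E; exact: integrable_add.
by rewrite E RintegralD// IH2 big_cons.
Qed.

Section Iterated.
Variables (f : R -> R -> R) (M B L : R).
Hypothesis mf : measurable_fun setT (fun p : R * R => f p.1 p.2).
Hypothesis M0 : 0 <= M.
Hypothesis L0 : 0 <= L.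
Hypothesis fB : forall x t, 0 <= t -> `|f x t| <= B.
Hypothesis fM : forall x t, M < t -> f x t = 0.

Let A := `[0, L]%classic : set R.

Definition slice_int (t : R) : R := \int[mu]_(x in A) f x t.

Lemma slice_measurable t : measurable_fun setT (f ^~ t).
Proof. exact: (measurableT_comp mf (pair2_measurable t)). Qed.

Lemma slice_integrable t : 0 <= t -> mu.-integrable A (EFin \o f ^~ t).
Proof.
move=> t0; apply: (itv_integrable (B := B)) => [|x _]; last exact: fB.
exact: measurable_funS (slice_measurable t).
Qed.

Lemma slice_intE t : 0 <= t -> (\int[mu]_(x in A) (f x t)%:E = (slice_int t)%:E)%E.
Proof. by move=> t0; rewrite RintegralE//; exact: slice_integrable. Qed.

(** Extension of [f] by zero from a bounded box, with time as first variable: Fubini's theorem for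
    it yields the integrability of [slice_int]. *)
Let g (p : R * R) : R := f p.2 p.1 * \1_(`[0, M]%classic) p.1 * \1_A p.2.

Let g_integrable : (mu \x mu)%E.-integrable setT (EFin \o g).
Proof.
pose E : set (R * R) := `[0, M]%classic `*` A.
have mE := measurableX (measurable_itv `[0, M]) (measurable_itv `[0, L]).
have -> : EFin \o g = ((EFin \o (fun p : R * R => f p.2 p.1)) \_ E)%E.
  apply/funext => -[t x]; rewrite /g /= /patch /=.
  case: ifPn; rewrite /E.
    by move=> /set_mem[/= Et Ex]; rewrite !indicE !mem_set// !mulr1.
  move/negP => H; rewrite !indicE; case: (boolP (t \in _)) => Ht; last by rewrite mulr0 mul0r.
  case: (boolP (x \in _)) => Hx; last by rewrite mulr0.
  by exfalso; apply: H; apply/mem_set; split; exact: set_mem.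
have mkE := @integrable_mkcond _ _ _ (mu \x mu)%E E
  (EFin \o (fun p : R * R => f p.2 p.1)) mE.
apply: (proj1 mkE).
apply: (bounded_integrable (B := B)) => //.
- have E1 := @product_measure1E _ _ _ _ _ mu mu _ _
    (measurable_itv `[0, M]) (measurable_itv `[0, L]).
  have E2 : (mu `[0%R, M]%classic * mu `[0%R, L]%classic < +oo)%E.
    by rewrite !itv_measure// -EFinM ltry.
  by apply: le_lt_trans E2; rewrite le_eqVlt; apply/orP; left; apply/eqP; exact: E1.
- apply: (@measurable_funS _ _ _ _ setT) => //.
  exact: (measurableT_comp mf (@measurable_swap _ _ _ _)).
- by move=> -[t x] [/= + _]; rewrite in_itv/= => /andP[t0 _]; exact: fB.
Qed.

Lemma slice_int_integrable : mu.-integrable `[0, M]%classic (EFin \o slice_int).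
Proof.
have := integrable_fubini_F g_integrable => /(integrableS measurableT).
move=> /(_ `[0, M]%classic (measurable_itv _) (@subsetT _ _)).
apply: eq_integrable => // t; rewrite inE/= in_itv/= => tM.
rewrite /fubini_F/= -slice_intE ?(andP tM).1//.
rewrite [RHS]integral_mkcond/=; apply: eq_integral => x _; rewrite /g /patch.
rewrite !indicE (mem_set (A := `[0, M]%classic)) ?mulr1 /=; last by rewrite in_itv.
by case: ifPn => _; rewrite ?mulr1 ?mulr0.
Qed.

Lemma iterated_intE :
  (\int[mu]_(t in `[0%R, +oo[) \int[mu]_(x in A) (f x t)%:E =
   (\int[mu]_(t in `[0, M]) slice_int t)%R%:E)%E.
Proof.
rewrite -RintegralE; last exact: slice_int_integrable.
rewrite [LHS]integral_mkcond [RHS]integral_mkcond/=.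
apply: eq_integral => t _; rewrite /patch.
case: ifPn => [|H1]; case: ifPn => [|H2] //.
- by rewrite !inE/= !in_itv/= andbT => _ t0; rewrite slice_intE.
- rewrite inE/= in_itv/= andbT => t0; rewrite integral0_eq// => x _.
  rewrite fM// ltNge; apply: contra H2 => tM.
  by rewrite inE/= in_itv/= t0.
- rewrite inE/= in_itv/= => /andP[t0 _]; exfalso.
  by move/negP: H1; apply; rewrite inE/= in_itv/= t0.
Qed.

End Iterated.

End Integration.

Section FrontTracking.
Context {R : realType}.
Implicit Types (x t v : R) (i j : nat).
Variables (T xi : R) (n : nat) (h eta theta : R).
Hypothesis T0 : 0 <= T.
Hypothesis h0 : 0 < h.
Hypothesis hpi : h < 2 * pi.
Hypothesis eta0 : 0 < eta.
Hypothesis etapi : eta <= pi.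
Hypothesis theta0 : 0 < theta.
Hypothesis separated : forall t i j, (i < j)%N ->
  0 < front t (grid n i) -> eta <= front t (grid n j).

Let m j : R := grid n j.
Let X j t : R := pos eta t (m j).
Let V j t : R := vel eta t (m j).
Let beta j : R := sin (m j).

(** The first factor removes the times before -1, where the fronts may cross and a cell would lose
    its sign; on [[0, +oo[] it is 1. *)
Definition cutoff t : R := step (t + 1) * step ((T + theta - t) / theta).

Definition cutoff' t : R := step' (t + 1) * step ((T + theta - t) / theta) +
  step (t + 1) * (step' ((T + theta - t) / theta) * - theta^-1).

Definition right_fn j : R -> R -> R := cell_fn h xi cutoff (X j) (X j.+1).

Definition left_fn j : R -> R -> R :=
  cell_fn h xi cutoff (fun t => - X j.+1 t) (fun t => - X j t).

Definition right_w j x t : R := cell h (X j t) (X j.+1 t) (x - xi).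

Definition left_w j x t : R := cell h (- X j.+1 t) (- X j t) (x - xi).

(** Distance from [v] to the piecewise constant approximation of the exact solution, whose value on
    a cell is the datum at the label of one of its edges, averaged with the weights of the
    partition. *)
Definition front_dist v x t : R :=
  \sum_(j < n.+1) `|v - - sin (grid n j)| * right_w j x t +
  \sum_(j < n.+1) `|v - sin (grid n j)| * left_w j x t.

Lemma der_cutoff t : is_derive t 1 cutoff (cutoff' t).
Proof.
have L1 : is_derive t 1 (fun s => s + 1) 1.
  by apply: der_val (derD (der_id t) (der_cst 1 t)); rewrite addr0.
have L2 : is_derive t 1 (fun s => (T + theta - s) / theta) (- theta^-1).
  apply: der_val (derM (derB (der_cst (T + theta) t) (der_id t)) (der_cst theta^-1 t)).
  by ring.
apply: (@der_ext _ (fun s => step (s + 1) * step ((T + theta - s) / theta))) => //.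
apply: der_val (derM (@der_comp _ step (fun s => s + 1) _ _ _ (der_step _) L1)
 (@der_comp _ step (fun s => (T + theta - s) / theta) _ _ _ (der_step _) L2)).
by rewrite mulr1.
Qed.

Lemma cutoff'_continuous : continuous cutoff'.
Proof.
have L1 : continuous (fun s : R => s + 1).
  by move=> s; apply: cvgD; [exact: cvg_id|exact: cvg_cst].
have L2 : continuous (fun s : R => (T + theta - s) / theta).
  by move=> s; apply: cvgMr_tmp; apply: cvgB; [exact: cvg_cst|exact: cvg_id].
have C (f g : R -> R) : continuous f -> continuous g -> continuous (fun s => f (g s)).
  by move=> cf cg s; apply: (@cvg_comp _ _ _ _ f _ _ _ (cg s)); exact: cf.
move=> t; apply: cvgD; apply: cvgM.
- exact: (C _ _ step'_continuous L1).
- exact: (C _ _ step_continuous L2).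
- exact: (C _ _ step_continuous L1).
- by apply: cvgMr_tmp; exact: (C _ _ step'_continuous L2).
Qed.

Lemma cutoff_bound t : 0 <= cutoff t <= 1.
Proof.
have /andP[? ?] := step_bound (t + 1).
have /andP[? ?] := step_bound ((T + theta - t) / theta).
by rewrite mulr_ge0//= mulr_ile1.
Qed.

Lemma cutoff_support t : cutoff t != 0 -> -1 <= t.
Proof.
move=> c; rewrite leNgt; apply/negP => t1; move: c.
by rewrite /cutoff step_le0 ?mul0r ?eqxx//; lra.
Qed.

Lemma cutoff_end t : T + theta <= t -> cutoff t = 0 /\ cutoff' t = 0.
Proof.
move=> tT; have H : (T + theta - t) / theta <= 0 by rewrite ler_pdivrMr//; lra.
by rewrite /cutoff /cutoff' !(step_le0 H) !(step'_le0 H) !(mul0r, mulr0, addr0).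
Qed.

Lemma cutoff_start t : 0 <= t <= T -> cutoff t = 1 /\ cutoff' t = 0.
Proof.
move=> /andP[t0 tT]; have H : 1 <= (T + theta - t) / theta by rewrite ler_pdivlMr//; lra.
have H1 : 1 <= t + 1 by lra.
by rewrite /cutoff /cutoff' !(step_ge1 H) !(step_ge1 H1) !(step'_ge1 H) !(step'_ge1 H1)
  !(mul0r, mulr0, addr0, mulr1).
Qed.

Lemma cutoff'_le0 t : 0 <= t -> - (2 / theta) <= cutoff' t <= 0.
Proof.
move=> t0; have H1 : 1 <= t + 1 by lra.
rewrite /cutoff' (step_ge1 H1) (step'_ge1 H1) mul0r add0r mul1r mulrN.
have /andP[? ?] := step'_bound ((T + theta - t) / theta).
have ti : 0 < theta^-1 by rewrite invr_gt0.
by apply/andP; split; nra.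
Qed.

Lemma X_homo j t : -1 <= t -> X j t <= X j.+1 t.
Proof.
move=> t1; apply: pos_homo => //.
- by case/andP: (@grid_bound R n j).
- by have := @grid_step R n j => /andP[? _]; rewrite -subr_ge0.
- by case/andP: (@grid_bound R n j.+1).
Qed.

Lemma X0 t : X 0%N t = 0. Proof. by rewrite /X /m grid0 pos0. Qed.

Lemma XN t : X n.+1 t = pi. Proof. by rewrite /X /m gridN pos_pi. Qed.

Lemma V_continuous j : continuous (V j).
Proof. exact: vel_continuous. Qed.

Lemma der_X j t : is_derive t 1 (X j) (V j t).
Proof. exact: der_pos. Qed.

Lemma der_NX j t : is_derive t 1 (fun s => - X j s) (- V j t).
Proof. by apply: derN; exact: der_X. Qed.

Lemma V_bound j t : `|V j t| <= 3.
Proof.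
rewrite /V /vel normrM normrN.
have /andP[? ?] := ramp'_bound (front t (m j)) eta0.
have : `|sin (m j)| <= 1 by rewrite ler_norml sin_geN1 sin_le1.
by rewrite ger0_norm//; have := normr_ge0 (sin (m j)); nra.
Qed.

Let cutoff_ge0 t : 0 <= cutoff t. Proof. by case/andP: (cutoff_bound t). Qed.

Let cutoff_late t : T + theta < t -> cutoff t = 0.
Proof. by move=> /ltW /cutoff_end[]. Qed.

Lemma right_fn_test j : test_fn (right_fn j).
Proof.
have XX t : cutoff t != 0 -> X j t <= X j.+1 t by move=> /cutoff_support; exact: X_homo.
exact: (@test_fn_cell _ h xi cutoff cutoff' (X j) (X j.+1) (V j) (V j.+1) (T + theta)
  h0 hpi (der_X j) (der_X j.+1) der_cutoff cutoff'_continuous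
  (@V_continuous j) (@V_continuous j.+1) cutoff_ge0 cutoff_late XX).
Qed.

Lemma left_fn_test j : test_fn (left_fn j).
Proof.
have NV k : continuous (fun t => - V k t).
  by move=> t; apply: cvgN; exact: V_continuous.
have XX t : cutoff t != 0 -> - X j.+1 t <= - X j t.
  by move=> /cutoff_support t1; rewrite lerN2; exact: X_homo.
exact: (@test_fn_cell _ h xi cutoff cutoff' (fun t => - X j.+1 t) (fun t => - X j t)
  (fun t => - V j.+1 t) (fun t => - V j t) (T + theta) h0 hpi
  (der_NX j.+1) (der_NX j) der_cutoff cutoff'_continuous
  (@NV j.+1) (@NV j) cutoff_ge0 cutoff_late XX).
Qed.

Lemma right_fn_derive j x t :
  dx (right_fn j) x t = cell_dx h xi cutoff (X j) (X j.+1) x t /\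
  dt (right_fn j) x t = cell_dt h xi cutoff cutoff' (X j) (X j.+1) (V j) (V j.+1) x t.
Proof.
exact: (@cell_derive1 _ h xi cutoff cutoff' (X j) (X j.+1) (V j) (V j.+1) x t
  h0 hpi (der_X j) (der_X j.+1) der_cutoff).
Qed.

Lemma left_fn_derive j x t :
  dx (left_fn j) x t = cell_dx h xi cutoff (fun t => - X j.+1 t) (fun t => - X j t) x t /\
  dt (left_fn j) x t = cell_dt h xi cutoff cutoff' (fun t => - X j.+1 t)
     (fun t => - X j t) (fun t => - V j.+1 t) (fun t => - V j t) x t.
Proof.
exact: (@cell_derive1 _ h xi cutoff cutoff' (fun t => - X j.+1 t) (fun t => - X j t)
  (fun t => - V j.+1 t) (fun t => - V j t) x t h0 hpi (der_NX j.+1) (der_NX j) der_cutoff).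
Qed.

Lemma right_w_ge0 j x t : -1 <= t -> 0 <= right_w j x t.
Proof.
by move=> t1; rewrite subr_ge0 pstep_homo//; have := X_homo j t1; lra.
Qed.

Lemma left_w_ge0 j x t : -1 <= t -> 0 <= left_w j x t.
Proof.
by move=> t1; rewrite subr_ge0 pstep_homo//; have := X_homo j t1; lra.
Qed.

(** Both families telescope and meet at 0; what is left is the increment of [pstep] over a full
    turn, from [- pi] to [pi]. *)
Lemma sum_w x t : \sum_(j < n.+1) right_w j x t + \sum_(j < n.+1) left_w j x t = 1.
Proof.
have tel (f : nat -> R) k : \sum_(j < k) (f j - f j.+1) = f 0%N - f k.
  elim: k => [|k IH]; first by rewrite big_ord0 subrr.
  by rewrite big_ord_recr/= IH; ring.
rewrite /right_w /left_w /cell (tel (fun j => pstep h (x - xi - X j t))).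
under eq_bigr do rewrite -opprB.
rewrite sumrN (tel (fun j => pstep h (x - xi - - X j t))) X0 XN.
have -> : x - xi - - pi = (x - xi - pi) + 2 * pi by ring.
by rewrite pstepD2pi !oppr0 !addr0; ring.
Qed.

Lemma right_w_le1 j x t : (j < n.+1)%N -> -1 <= t -> right_w j x t <= 1.
Proof.
move=> jn t1; rewrite -(sum_w x t) (bigD1 (Ordinal jn))//= -addrA lerDl.
by rewrite addr_ge0// sumr_ge0// => i _; rewrite ?right_w_ge0 ?left_w_ge0.
Qed.

Lemma left_w_le1 j x t : (j < n.+1)%N -> -1 <= t -> left_w j x t <= 1.
Proof.
move=> jn t1; rewrite -(sum_w x t) [X in _ <= _ + X](bigD1 (Ordinal jn))//= addrCA lerDl.
by rewrite addr_ge0// sumr_ge0// => i _; rewrite ?right_w_ge0 ?left_w_ge0.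
Qed.

(** [2 / h] is the height of the bumps. The three terms are the moving fronts, the front coming to
    rest and the jump at the antipode. *)
Definition front_err : R := 2 / h * (2 * n%:R * (pi / n.+1%:R) ^+ 2 +
  8 * (pi / n.+1%:R) + (pi / n.+1%:R) ^+ 2).

Lemma beta_bound j : 0 <= beta j <= 1.
Proof. by rewrite sin_ge0_pi ?grid_bound// sin_le1. Qed.

Lemma beta_step j : `|beta j.+1 - beta j| <= pi / n.+1%:R.
Proof.
apply: le_trans (sin_lip _ _) _; have /andP[? ?] := @grid_step R n j.
by rewrite ger0_norm.
Qed.

(** In the integrand summed over all cells, the derivative of the cutoff meets the weights of the
    partition and the motion of the edges gives the sums of [fronts_inequality]. The bound holds for
    every value [v] of the solution. *)
Lemma kruzkov_pointwise v x t : 0 <= t ->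
  \sum_(j < n.+1) (`|v - - beta j| * dt (right_fn j) x t +
                   kflux v (- beta j) * dx (right_fn j) x t) +
  \sum_(j < n.+1) (`|v - beta j| * dt (left_fn j) x t +
                   kflux v (beta j) * dx (left_fn j) x t) <=
  cutoff' t * front_dist v x t + front_err.
Proof.
move=> t0; have t1 : -1 <= t by lra.
have p0 := @pi_gt0 R.
have d0 : 0 <= @pi R / n.+1%:R by rewrite divr_ge0 ?(ltW p0).
pose a j := pstep' h (x - xi - X j t); pose b j := pstep' h (x - xi - - X j t).
have F : \sum_(j < n.+1) (`|v + beta j| * (V j.+1 t * a j.+1 - V j t * a j) +
                 kflux v (- beta j) * (a j - a j.+1)) +
  \sum_(j < n.+1) (`|v - beta j| * (V j.+1 t * b j.+1 - V j t * b j) +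
                 kflux v (beta j) * (b j.+1 - b j)) <=
  2 / h * (2 * n%:R * (pi / n.+1%:R) ^+ 2 + 8 * (pi / n.+1%:R) + beta n ^+ 2).
  apply: (@fronts_inequality _ n v beta (fun j => V j t) a b (2 / h) (pi / n.+1%:R)
    (pstep' h (x - xi)) (fun j => front t (m j) <= 0)
    (fun j => 0 < front t (m j) < eta)) => //.
  - by case/andP: (@pstep'_bound _ h (x - xi) h0).
  - by move=> j; exact: pstep'_bound.
  - by move=> j; exact: pstep'_bound.
  - by move=> j; case/andP: (beta_bound j).
  - by rewrite /beta /m grid0 sin0.
  - exact: beta_step.
  - by rewrite /V /vel /m grid0 sin0 oppr0 mulr0.
  - by rewrite /V /vel /m gridN sinpi oppr0 mulr0.
  - by rewrite /a /b X0 !oppr0.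
  - rewrite /a /b XN (_ : x - xi - - pi = (x - xi - pi) + 2 * pi) ?pstep'D2pi//; ring.
  - move=> j; rewrite !leNgt; apply: contra => Fj.
    have /andP[g0 _] := @grid_bound R n j; have /andP[_ g1] := @grid_bound R n j.+1.
    have /andP[g2 _] := @grid_step R n j; rewrite subr_ge0 in g2.
    exact: front_pos g0 g2 g1 Fj.
  - by move=> i j ij /andP[Fi _]; rewrite negb_and -!leNgt (separated ij Fi) orbT.
  - move=> j Fj; rewrite /V /a /b /X /vel /pos !(ramp_le0 eta0 Fj).1 !(ramp_le0 eta0 Fj).2.
    by rewrite mul0r !oppr0 !addr0.
  - by move=> j _; exact: V_bound.
  - move=> j; rewrite -ltNge => Fj; rewrite Fj/= -leNgt => Fe.
    by rewrite /V /vel (ramp_ge eta0 Fe).2 mul1r.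
  - by move=> j; case/andP: (beta_bound j).
have bn : beta n ^+ 2 <= (pi / n.+1%:R) ^+ 2.
  have := beta_step n; rewrite {1}/beta {1}/m gridN sinpi sub0r normrN => bn.
  by rewrite ler_sqr ?nnegrE//; case/andP: (beta_bound n) => b0 _; rewrite ger0_norm in bn.
set S1 := (X in X + _ <= _) in F; set S2 := (X in _ + X <= _) in F.
have E1 : \sum_(j < n.+1) (`|v - - beta j| * dt (right_fn j) x t +
      kflux v (- beta j) * dx (right_fn j) x t) =
    cutoff' t * (\sum_(j < n.+1) `|v - - beta j| * right_w j x t) + cutoff t * S1.
  rewrite !mulr_sumr -big_split/=; apply: eq_bigr => j _.
  rewrite (right_fn_derive j x t).1 (right_fn_derive j x t).2.
  rewrite /cell_dx /cell_dt -/(right_w j x t) -/(a j) -/(a j.+1) opprK; ring.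
have E2 : \sum_(j < n.+1) (`|v - beta j| * dt (left_fn j) x t +
      kflux v (beta j) * dx (left_fn j) x t) =
    cutoff' t * (\sum_(j < n.+1) `|v - beta j| * left_w j x t) + cutoff t * S2.
  rewrite !mulr_sumr -big_split/=; apply: eq_bigr => j _.
  rewrite (left_fn_derive j x t).1 (left_fn_derive j x t).2.
  rewrite /cell_dx /cell_dt -/(left_w j x t) -/(b j) -/(b j.+1); ring.
rewrite {}E1 {}E2 /front_dist -!/(beta _).
have h2 : 0 < 2 / h by rewrite divr_gt0.
have N0 := ler0n R n.
have F' : S1 + S2 <= front_err.
  apply: le_trans F _; rewrite /front_err ler_pM2l// lerD2l//.
have fe0 : 0 <= front_err.
  have s0 := sqr_ge0 (@pi R / n.+1%:R); have s1 := mulr_ge0 N0 s0.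
  rewrite /front_err; apply: mulr_ge0; first exact: ltW.
  move: (pi / n.+1%:R) d0 s0 s1 => d d0 s0 s1; lra.
have : cutoff t * (S1 + S2) <= front_err.
  have /andP[c0 c1] := cutoff_bound t.
  apply: (@le_trans _ _ (cutoff t * front_err)); first by rewrite ler_wpM2l.
  by rewrite ler_piMl.
by rewrite /beta /m; lra.
Qed.

Lemma front_dist_le v x t (d : R) : -1 <= t ->
  (forall j, (j < n.+1)%N -> right_w j x t != 0 -> `|v - - sin (grid n j)| <= d) ->
  (forall j, (j < n.+1)%N -> left_w j x t != 0 -> `|v - sin (grid n j)| <= d) ->
  front_dist v x t <= d.
Proof.
move=> t1 Hr Hl; rewrite -[d]mulr1 -(sum_w x t) mulrDr !mulr_sumr /front_dist.
apply: lerD; apply: ler_sum => j _.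
  have [->|w0] := eqVneq (right_w j x t) 0; first by rewrite !mulr0.
  by rewrite ler_wpM2r ?right_w_ge0 ?Hr.
have [->|w0] := eqVneq (left_w j x t) 0; first by rewrite !mulr0.
by rewrite ler_wpM2r ?left_w_ge0 ?Hl.
Qed.

Lemma front_dist_tri v v' x t : -1 <= t ->
  `|v - v'| - front_dist v' x t <= front_dist v x t.
Proof.
move=> t1; rewrite lerBlDr -[`|v - v'|]mulr1 -(sum_w x t) mulrDr !mulr_sumr /front_dist.
have tri (k w : R) : 0 <= w -> `|v - v'| * w <= `|v - k| * w + `|v' - k| * w.
  move=> w0; rewrite -mulrDl ler_wpM2r//.
  by have := ler_distD k v v'; rewrite [`|k - v'|]distrC.
have A : \sum_(j < n.+1) `|v - v'| * right_w j x t <=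
    \sum_(j < n.+1) `|v - - sin (grid n j)| * right_w j x t +
    \sum_(j < n.+1) `|v' - - sin (grid n j)| * right_w j x t.
  by rewrite -big_split/=; apply: ler_sum => j _; apply: tri; exact: right_w_ge0.
have B : \sum_(j < n.+1) `|v - v'| * left_w j x t <=
    \sum_(j < n.+1) `|v - sin (grid n j)| * left_w j x t +
    \sum_(j < n.+1) `|v' - sin (grid n j)| * left_w j x t.
  by rewrite -big_split/=; apply: ler_sum => j _; apply: tri; exact: left_w_ge0.
by lra.
Qed.

Lemma cell_support a b y : a <= b -> cell h a b y != 0 ->
  exists k : int, a <= y - 2 * pi * k%:~R <= b + h.
Proof.
move=> ab; rewrite subr_eq0 eq_sym => /pstep_supp[//|//||k [H1 H2]]; first by lra.
by exists k; apply/andP; split; lra.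
Qed.

Lemma front_dist_initial x :
  front_dist (sin_datum xi x) x 0 <= pi / n.+1%:R + h + eta.
Proof.
have t1 : -1 <= (0 : R) by lra.
have e0 := eta0; have h1 := h0.
have sinP (y : R) (k : int) : sin (y - 2 * pi * k%:~R) = sin y.
  have nat_per (l : nat) (z : R) : sin (z + 2 * pi * l%:R) = sin z.
    rewrite mulr_natr mulr_natl.
    exact: (periodicn (@sinD2pi R)).
  case: k => k.
    by rewrite -[in RHS](subrK (2 * pi * k%:R) y) nat_per -pmulrn.
  by rewrite NegzE mulrNz -pmulrn mulrN opprK nat_per.
have Xb j : grid n j - eta <= X j 0 <= grid n j.
  have E : front 0 (grid n j) = grid n j :> R by rewrite /front mul0r subr0.
  rewrite /X /m /pos E ramp_geB//= ramp_le//; by case/andP: (@grid_bound R n j).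
have close j (z : R) : X j 0 - h <= z <= X j.+1 0 + h ->
    `|sin z - sin (grid n j)| <= pi / n.+1%:R + h + eta.
  move=> /andP[z1 z2]; apply: le_trans (sin_lip _ _) _.
  have /andP[g1 g2] := @grid_step R n j.
  have /andP[? ?] := Xb j; have /andP[? ?] := Xb j.+1.
  move: (pi / n.+1%:R) g2 => d g2.
  by rewrite ler_norml; apply/andP; split; lra.
apply: front_dist_le => // j jn wn0.
  have [|k /andP[k1 k2]] := cell_support _ wn0; first exact: X_homo.
  rewrite /sin_datum -(sinP (x - xi) k) -opprD normrN; apply: close.
  by apply/andP; split => //; apply: le_trans k1; rewrite lerBlDr lerDl ltW.
have [|k /andP[k1 k2]] := cell_support _ wn0; first by rewrite lerN2 X_homo.
rewrite /sin_datum -(sinP (x - xi) k) -sinN; apply: close.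
move: (x - xi - _) k1 k2 => y k1 k2.
by apply/andP; split; lra.
Qed.

End FrontTracking.

Section FinalTime.
Context {R : realType}.
Implicit Types (x t v z : R) (i j : nat).
Variables (T xi : R) (w : R -> R) (n : nat) (h eta theta : R).
Hypothesis Tpi : pi < T.
Hypothesis wP : forall z, zmap T (w z) = z.
Hypothesis xi_bound : 0 <= xi <= 2 * pi.
Hypothesis h0 : 0 < h.
Hypothesis hpi : h < pi.
Hypothesis eta0 : 0 < eta.
Hypothesis etapi : eta <= pi.
Hypothesis theta0 : 0 < theta.

(* Representative in [-pi, pi] of [x - xi - pi] modulo [2 * pi]. *)
Definition offset x : R := if x < xi then x - xi + pi else x - xi - pi.

Definition profile x : R := sin (w (offset x)).

Lemma offset_turn x : exists k : int, x - xi = offset x + pi + 2 * pi * k%:~R.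
Proof.
rewrite /offset; case: ltP => _; last by exists 0; rewrite mulr0; ring.
by exists (- 1); rewrite mulrNz; ring.
Qed.

(** Just after the shock, over a length [h], cells from both sides overlap. Elsewhere a cell with
    nonzero weight determines the turn [k], and its label is close to [w (offset x)]. *)
Lemma front_dist_final x t : 0 <= x <= 2 * pi -> - pi + h < offset x < pi ->
  T <= t <= T + theta ->
  front_dist xi n h eta (profile x) x t <= pi / n.+1%:R + h + theta + eta.
Proof.
move=> xb /andP[z1 z2] tT; have p0 := @pi_gt0 R; have hh := h0; have hh' := hpi.
have e0 := eta0; have TT := Tpi.
have T0 : 0 <= T by lra.
have t1 : -1 <= t by case/andP: tT; lra.
have Xb j : 0 <= pos eta t (grid n j) <= pi by apply: pos_bound => //; exact: grid_bound.
have [l El] := offset_turn x.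
have close j z : pos eta t (grid n j) - pi - h <= z <= pos eta t (grid n j.+1) - pi + h ->
    - pi < z -> 0 < pos eta t (grid n j.+1) ->
    `|sin (w z) + sin (grid n j)| <= pi / n.+1%:R + h + theta + eta.
  move=> zb zpi X'.
  have -> : sin (w z) + sin (grid n j) = sin (w z) - sin (grid n j - pi).
    by rewrite -[in LHS](subrK pi (grid n j)) sinDpi.
  apply: le_trans (sin_lip _ _) _.
  have /andP[g0 _] := @grid_bound R n j; have /andP[_ g1] := @grid_bound R n j.+1.
  have /andP[g2 g3] := @grid_step R n j; rewrite subr_ge0 in g2.
  apply: le_trans (winv_between_fronts Tpi wP eta0 (ltW h0) tT g0 g2 g1 zb zpi X') _.
  by rewrite !lerD2r.
have hpi2 : h < 2 * pi by lra.
have int_squeeze (a b : int) (c : R) : c < 2 * pi ->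
    2 * pi * a%:~R <= 2 * pi * b%:~R + c -> a <= b.
  move=> cpi H; rewrite -ltzD1 -(ltr_int R) intrD.
  rewrite -(ltr_pM2l (x := 2 * @pi R)); lra.
have Hom j : pos eta t (grid n j) <= pos eta t (grid n j.+1).
  by have := @X_homo _ n eta eta0 j t t1.
apply: (@front_dist_le _ xi n h eta) => // j jn wn0.
  have [|k /andP[k1 k2]] := @cell_support _ h h0 hpi2 _ _ _ _ wn0; first exact: Hom.
  have /andP[a0 a1] := Xb j; have /andP[b0 b1] := Xb j.+1.
  have Ek : k = l.
    apply/eqP; rewrite eq_le; apply/andP; split.
      by apply: (@int_squeeze _ _ (offset x + pi)); lra.
    by apply: (@int_squeeze _ _ (pi + h - (offset x + pi))); lra.
  have Ey : x - xi - 2 * pi * k%:~R = offset x + pi by rewrite El Ek; ring.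
  by rewrite Ey in k1 k2; rewrite opprK /profile; apply: close; [apply/andP; split|..]; lra.
have [|k /andP[k1 k2]] := @cell_support _ h h0 hpi2 _ _ _ _ wn0.
  by rewrite lerN2; exact: Hom.
have /andP[a0 a1] := Xb j; have /andP[b0 b1] := Xb j.+1.
have Ek : k = (l + 1)%R.
  apply/eqP; rewrite eq_le; apply/andP; split.
    by apply: (@int_squeeze _ _ (offset x)); rewrite ?intrD; lra.
  rewrite lezD1 ltNge; apply/negP => kl.
  have : k%:~R <= l%:~R :> R by rewrite ler_int.
  rewrite -(ler_pM2l (x := 2 * @pi R)); lra.
have Ey : x - xi - 2 * pi * k%:~R = offset x - pi by rewrite El Ek intrD; ring.
rewrite Ey in k1 k2.
(* Left cells are mirror images of right ones, since [w] and the sine are odd. *)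
rewrite /profile -[offset x]opprK (winvN _ T0 wP) sinN.
rewrite -[X in `|X|]opprK opprB opprK addrC normrN.
by apply: close; [apply/andP; split|..]; lra.
Qed.

End FinalTime.

Section MeasurableCells.
Context {R : realType}.
Implicit Types (h xi : R).

Lemma measurable_continuous_comp d (S : measurableType d) (f : R -> R) (g : S -> R) :
  continuous f -> measurable_fun setT g -> measurable_fun setT (fun p => f (g p)).
Proof.
by move=> cf mg; apply: (measurableT_comp (f := f)) => //; exact: continuous_measurable_fun.
Qed.

Lemma measurable_abs d (S : measurableType d) (g : S -> R) :
  measurable_fun setT g -> measurable_fun setT (fun p => `|g p|).
Proof.
apply: (@measurable_continuous_comp _ _ (fun z : R => `|z|)).
by apply: (@lip_continuous _ _ 1) => x y; rewrite mul1r ler_dist_dist.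
Qed.

Section Cells.
Variables (h xi : R) (chi chi' X Y VX VY : R -> R).
Hypothesis h0 : 0 < h.
Hypothesis hpi : h < 2 * pi.
Hypothesis cchi : continuous chi.
Hypothesis cchi' : continuous chi'.
Hypothesis cX : continuous X.
Hypothesis cY : continuous Y.
Hypothesis cVX : continuous VX.
Hypothesis cVY : continuous VY.

Let mshift (Z : R -> R) : continuous Z ->
  measurable_fun setT (fun p : R * R => p.1 - xi - Z p.2).
Proof.
move=> cZ; apply: measurable_funB; last exact: measurable_continuous_comp.
by apply: measurable_funB => //; exact: measurable_cst.
Qed.

Lemma measurable_cell_fn :
  measurable_fun setT (fun p : R * R => cell_fn h xi chi X Y p.1 p.2).
Proof.
apply: measurable_funM; first exact: measurable_continuous_comp.
by apply: measurable_funB; apply: (measurable_continuous_comp (f := pstep h));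
  (exact: pstep_continuous || exact: mshift).
Qed.

Lemma measurable_cell_dx :
  measurable_fun setT (fun p : R * R => cell_dx h xi chi X Y p.1 p.2).
Proof.
apply: measurable_funM; first exact: measurable_continuous_comp.
by apply: measurable_funB; apply: (measurable_continuous_comp (f := pstep' h));
  (exact: pstep'_continuous || exact: mshift).
Qed.

Lemma measurable_cell_dt :
  measurable_fun setT (fun p : R * R => cell_dt h xi chi chi' X Y VX VY p.1 p.2).
Proof.
apply: measurable_funD.
  apply: measurable_funM; first exact: measurable_continuous_comp.
  by apply: measurable_funB; apply: (measurable_continuous_comp (f := pstep h));
    (exact: pstep_continuous || exact: mshift).
apply: measurable_funM; first exact: measurable_continuous_comp.
apply: measurable_funB; apply: measurable_funM;
  (try exact: measurable_continuous_comp);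
  by apply: (measurable_continuous_comp (f := pstep' h));
    (exact: pstep'_continuous || exact: mshift).
Qed.

End Cells.

Lemma measurable_kruzkov (u : R -> R -> R) k (f g : R * R -> R) :
  measurable_fun setT (fun p : R * R => u p.1 p.2) ->
  measurable_fun setT f -> measurable_fun setT g ->
  measurable_fun setT (fun p : R * R => `|u p.1 p.2 - k| * f p + kflux (u p.1 p.2) k * g p).
Proof.
move=> mu_ mf mg.
have mD : measurable_fun setT (fun p : R * R => `|u p.1 p.2 - k|).
  apply: measurable_abs.
  by apply: measurable_funB => //; exact: measurable_cst.
apply: measurable_funD; apply: measurable_funM => //.
rewrite (_ : (fun p => _) = (fun p => `|u p.1 p.2 - k| * (u p.1 p.2 + k) * 2^-1)).
  apply: measurable_funM; last exact: measurable_cst.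
  apply: measurable_funM => //.
  by apply: measurable_funD => //; exact: measurable_cst.
by apply/funext => p; rewrite kfluxE.
Qed.

Lemma cell_bounds h xi (chi chi' X Y VX VY : R -> R) x t (c L : R) :
  0 < h -> 0 <= chi t <= 1 -> `|chi' t| <= c ->
  0 <= cell h (X t) (Y t) (x - xi) <= 1 -> `|VX t| <= L -> `|VY t| <= L ->
  `|cell_dx h xi chi X Y x t| <= 4 / h /\
  `|cell_dt h xi chi chi' X Y VX VY x t| <= c + 4 * L / h.
Proof.
move=> h0 /andP[c0 c1] cc /andP[w0 w1] LX LY; rewrite /cell_dx /cell_dt.
have /andP[a0 a1] := pstep'_bound (x - xi - X t) h0.
have /andP[b0 b1] := pstep'_bound (x - xi - Y t) h0.
have h2 : 0 < h^-1 by rewrite invr_gt0.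
have L0 : 0 <= L by apply: le_trans LX.
split.
  rewrite normrM (ger0_norm c0).
  have : `|pstep' h (x - xi - X t) - pstep' h (x - xi - Y t)| <= 4 / h.
    by rewrite ler_norml; apply/andP; split; lra.
  by have := normr_ge0 (pstep' h (x - xi - X t) - pstep' h (x - xi - Y t)); nra.
have A : `|chi' t * cell h (X t) (Y t) (x - xi)| <= c.
  rewrite normrM (ger0_norm w0).
  by have := normr_ge0 (chi' t); nra.
have bnd (V p : R) : `|V| <= L -> 0 <= p -> p <= 2 / h -> `|V * p| <= 2 * L / h.
  move=> VL p0 p1; rewrite normrM (ger0_norm p0) mulrAC [2 / h * _]mulrC.
  by apply: ler_pM.
have B : `|VY t * pstep' h (x - xi - Y t) - VX t * pstep' h (x - xi - X t)| <= 4 * L / h.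
  apply: le_trans (ler_normB _ _) _.
  by have := bnd _ _ LY b0 b1; have := bnd _ _ LX a0 a1; lra.
apply: le_trans (ler_normD _ _) _; apply: lerD => //.
rewrite normrM (ger0_norm c0).
by apply: le_trans B; rewrite ler_piMl.
Qed.

End MeasurableCells.

(** * Identification of the entropy solution at time [T] *)

Section Identification.
Context {R : realType}.
Implicit Types (x t v : R).
Local Notation mu := (@lebesgue_measure R).
Variables (T xi : R) (w : R -> R) (u : R -> R -> R).
Hypothesis Tpi : pi < T.
Hypothesis wP : forall z, zmap T (w z) = z.
Hypothesis xi_bound : 0 <= xi <= 2 * pi.
Hypothesis uE : entropy_solution (sin_datum xi) u.

Let A := `[0, 2 * pi]%classic : set R.
Let mA : measurable A. Proof. exact: measurable_itv. Qed.
Let pi2_ge0 : 0 <= 2 * @pi R. Proof. by rewrite mulr_ge0// ltW// pi_gt0. Qed.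

Lemma sum_bool_ord n (f : bool * 'I_n.+1 -> R) :
  \sum_(i : bool * 'I_n.+1) f i =
  \sum_(j < n.+1) f (true, j) + \sum_(j < n.+1) f (false, j).
Proof.
rewrite (eq_bigr (fun i => f (i.1, i.2))); last by move=> [].
by rewrite -(pair_bigA _ (fun b j => f (b, j)))/= big_bool.
Qed.

Lemma profile_measurable : measurable_fun setT (profile xi w).
Proof.
have T0 : 0 <= T by have := Tpi; have := @pi_gt0 R; lra.
have -> : profile xi w = (fun x => sin (w (x - xi - pi + 2 * pi * \1_(`]-oo, xi[%classic) x))).
  apply/funext => x; rewrite /profile /offset indicE; congr (sin (w _)).
  case: ltP => xxi.
    by rewrite mem_set ?mulr1/=; [ring|rewrite in_itv].
  by rewrite memNset ?mulr0 ?addr0//= in_itv/= ltNge xxi.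
apply: measurable_continuous_comp; first exact: sin_continuous.
apply: measurable_continuous_comp; first exact: winv_continuous T0 wP.
apply: measurable_funD.
  by apply: continuous_measurable_fun => x; apply: cvgB;
    [apply: cvgB; [exact: cvg_id|exact: cvg_cst]|exact: cvg_cst].
apply: measurable_funM; first exact: measurable_cst.
exact: measurable_indic.
Qed.

Lemma profile_le1 x : `|profile xi w x| <= 1.
Proof. by rewrite /profile ler_norml sin_geN1 sin_le1. Qed.

Let u_measurable t : measurable_fun setT (u ^~ t).
Proof.
case: uE => mu_ _ _ _ _.
exact: (measurableT_comp mu_ (pair2_measurable t)).
Qed.

Lemma A_integrable (f : R -> R) B : measurable_fun setT f -> (forall x, `|f x| <= B) ->
  mu.-integrable A (EFin \o f).
Proof.
move=> mf fB; apply: (itv_integrable (B := B)); last by move=> x _; exact: fB.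
exact: measurable_funS mf.
Qed.

Definition defect : R := \int[mu]_(x in A) `|u x T - profile xi w x|.

(** Small near [T] by continuity in time with values in [L^1]; it carries the information obtained
    on [[T, T + theta]] back to time [T]. *)
Definition drift t : R := \int[mu]_(x in A) `|u x t - u x T|.

Section FrontScales.
Variables (n : nat) (h eta theta e : R).
Hypothesis h0 : 0 < h.
Hypothesis hpi : h < pi.
Hypothesis eta0 : 0 < eta.
Hypothesis etapi : eta <= pi.
Hypothesis theta0 : 0 < theta.
Hypothesis separated : forall t i j, (i < j)%N ->
  0 < front t (grid n i) -> eta <= front t (grid n j).
Hypothesis drift_e : forall t, T <= t <= T + theta -> drift t <= e.

Let I : Type := (bool * 'I_n.+1)%type.

Let phi (i : I) : R -> R -> R :=
  if i.1 then right_fn T xi n h eta theta i.2 else left_fn T xi n h eta theta i.2.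

Let kv (i : I) : R := if i.1 then - sin (grid n i.2) else sin (grid n i.2).

Let f (i : I) x t : R :=
  `|u x t - kv i| * dt (phi i) x t + kflux (u x t) (kv i) * dx (phi i) x t.

Let h2pi : h < 2 * pi. Proof. by have := hpi; have := @pi_gt0 R; lra. Qed.

Let T0 : 0 <= T. Proof. by have := Tpi; have := @pi_gt0 R; lra. Qed.

Let X j t : R := pos eta t (grid n j).
Let V j t : R := vel eta t (grid n j).

Let X_cont j : continuous (X j).
Proof. by move=> t; exact: der_continuous (der_pos _ _ _). Qed.

Let V_cont j : continuous (V j). Proof. exact: vel_continuous. Qed.

Let NX_cont j : continuous (fun t => - X j t).
Proof. by move=> t; apply: cvgN; exact: X_cont. Qed.

Let NV_cont j : continuous (fun t => - V j t).
Proof. by move=> t; apply: cvgN; exact: V_cont. Qed.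

Let chi_cont : continuous (cutoff T theta).
Proof. by move=> t; exact: der_continuous (der_cutoff _ _ _). Qed.

Let chi'_cont : continuous (cutoff' T theta). Proof. exact: cutoff'_continuous. Qed.

Let f_measurable i : measurable_fun setT (fun p : R * R => f i p.1 p.2).
Proof.
case: uE => mu_ _ _ _ _.
apply: (@measurable_kruzkov _ u (kv i) (fun p => dt (phi i) p.1 p.2)
  (fun p => dx (phi i) p.1 p.2)) => //; case: i => -[] j; rewrite /phi/=.
- rewrite (_ : (fun p => _) = (fun p : R * R => cell_dt h xi (cutoff T theta)
    (cutoff' T theta) (X j) (X j.+1) (V j) (V j.+1) p.1 p.2)).
    by apply: measurable_cell_dt.
  by apply/funext => p; rewrite (right_fn_derive T xi n eta theta h0 h2pi j p.1 p.2).2.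
- rewrite (_ : (fun p => _) = (fun p : R * R => cell_dt h xi (cutoff T theta)
    (cutoff' T theta) (fun t => - X j.+1 t) (fun t => - X j t)
    (fun t => - V j.+1 t) (fun t => - V j t) p.1 p.2)).
    by apply: measurable_cell_dt.
  by apply/funext => p; rewrite (left_fn_derive T xi n eta theta h0 h2pi j p.1 p.2).2.
- rewrite (_ : (fun p => _) = (fun p : R * R => cell_dx h xi (cutoff T theta)
    (X j) (X j.+1) p.1 p.2)).
    by apply: measurable_cell_dx.
  by apply/funext => p; rewrite (right_fn_derive T xi n eta theta h0 h2pi j p.1 p.2).1.
- rewrite (_ : (fun p => _) = (fun p : R * R => cell_dx h xi (cutoff T theta)
    (fun t => - X j.+1 t) (fun t => - X j t) p.1 p.2)).
    by apply: measurable_cell_dx.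
  by apply/funext => p; rewrite (left_fn_derive T xi n eta theta h0 h2pi j p.1 p.2).1.
Qed.

Let f_bounded i : exists B, forall x t, 0 <= t -> `|f i x t| <= B.
Proof.
case: uE => _ [M uM] _ _ _.
have M0 : 0 <= M by apply: le_trans (uM 0 0).
exists ((M + 1) * (2 / theta + 4 * 3 / h) + (M + 1) * (M + 1) / 2 * (4 / h)) => x t t0.
have t1 : -1 <= t by lra.
have [bx bt] : `|dx (phi i) x t| <= 4 / h /\ `|dt (phi i) x t| <= 2 / theta + 4 * 3 / h.
  have chi'B : `|cutoff' T theta t| <= 2 / theta.
    have /andP[? c0] := cutoff'_le0 T theta0 t0.
    by rewrite ler0_norm// lerNl.
  have VB j : `|V j t| <= 3 by exact: V_bound.
  have NVB j : `|- V j t| <= 3 by rewrite normrN; exact: VB.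
  case: i => -[] j; rewrite /phi/=.
    have wj : 0 <= cell h (X j t) (X j.+1 t) (x - xi) <= 1.
      apply/andP; split; first exact: (right_w_ge0 xi n h0 h2pi eta0 j x t1).
      exact: (right_w_le1 xi h0 h2pi eta0 etapi x (ltn_ord j) t1).
    have [-> ->] := right_fn_derive T xi n eta theta h0 h2pi j x t.
    exact: cell_bounds (cutoff_bound _ _ _) chi'B wj (VB j) (VB j.+1).
  have wj : 0 <= cell h (- X j.+1 t) (- X j t) (x - xi) <= 1.
    apply/andP; split; first exact: (left_w_ge0 xi n h0 h2pi eta0 j x t1).
    exact: (left_w_le1 xi h0 h2pi eta0 etapi x (ltn_ord j) t1).
  have [-> ->] := left_fn_derive T xi n eta theta h0 h2pi j x t.
  exact: (@cell_bounds _ h xi (cutoff T theta) (cutoff' T theta) (fun t => - X j.+1 t)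
    (fun t => - X j t) (fun t => - V j.+1 t) (fun t => - V j t) x t _ _
    h0 (cutoff_bound _ _ _) chi'B wj (NVB j.+1) (NVB j)).
have k1 : `|kv i| <= 1.
  by rewrite /kv; case: i.1; rewrite ?normrN ler_norml sin_geN1 sin_le1.
have uk : `|u x t - kv i| <= M + 1.
  by apply: le_trans (ler_normB _ _) _; apply: lerD.
have uk' : `|u x t + kv i| <= M + 1.
  by apply: le_trans (ler_normD _ _) _; apply: lerD.
rewrite /f kfluxE; apply: le_trans (ler_normD _ _) _.
apply: lerD; rewrite normrM; apply: ler_pM => //.
  by rewrite normr_id.
rewrite !normrM normr_id (ger0_norm (x := 2^-1))// ler_pM2r//.
exact: ler_pM.
Qed.

Let f_late i x t : T + theta < t -> f i x t = 0.
Proof.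
move=> /ltW/(cutoff_end theta0)[c c'].
have [E1 E2] : dx (phi i) x t = 0 /\ dt (phi i) x t = 0.
  case: i => -[] j; rewrite /phi/=.
    have [-> ->] := right_fn_derive T xi n eta theta h0 h2pi j x t.
    by rewrite /cell_dx /cell_dt c c' !mul0r addr0.
  have [-> ->] := left_fn_derive T xi n eta theta h0 h2pi j x t.
  by rewrite /cell_dx /cell_dt c c' !mul0r addr0.
by rewrite /f E1 E2 !mulr0 addr0.
Qed.

Let Tth : 0 <= T + theta. Proof. by have := T0; have := theta0; lra. Qed.

Let slice_f_integrable i : mu.-integrable `[0, (T + theta)]%classic
  (EFin \o slice_int (f i) (2 * pi)).
Proof.
have [B fB] := f_bounded i.
exact: (@slice_int_integrable _ (f i) (T + theta) B (2 * pi)).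
Qed.

Let g (i : I) x : R := `|sin_datum xi x - kv i| * phi i x 0.

Let cutoff0 : cutoff T theta 0 = 1.
Proof. by apply: (cutoff_start theta0 _).1; rewrite lexx T0. Qed.

Let g_integrable i : mu.-integrable A (EFin \o g i).
Proof.
have sc : continuous (sin_datum xi).
  move=> x; apply: cvgN; apply: continuous_comp; last exact: sin_continuous.
  by apply: cvgB; [exact: cvg_id|exact: cvg_cst].
apply: (@A_integrable _ 2).
  apply: measurable_funM.
    apply: measurable_abs; apply: measurable_funB; last exact: measurable_cst.
    exact: continuous_measurable_fun.
  have mp (Z Z' : R -> R) : continuous Z -> continuous Z' ->
      measurable_fun setT (fun x => cell_fn h xi (cutoff T theta) Z Z' x 0).
    move=> cZ cZ'.
    exact: (measurableT_comp (measurable_cell_fn xi h0 h2pi chi_cont cZ cZ')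
      (pair2_measurable (0 : R))).
  case: i => -[] j; first exact: (mp (X j) (X j.+1) (@X_cont j) (@X_cont j.+1)).
  exact: (mp (fun t => - X j.+1 t) (fun t => - X j t) (@NX_cont j.+1) (@NX_cont j)).
move=> x; rewrite /g normrM -[2]mulr1.
have m1 : -1 <= (0 : R) by lra.
apply: ler_pM => //.
  rewrite normr_id; apply: le_trans (ler_normB _ _) _.
  rewrite (_ : 2 = 1 + 1)//; apply: lerD.
    by rewrite /sin_datum normrN ler_norml sin_geN1 sin_le1.
  by rewrite /kv; case: i.1; rewrite ?normrN ler_norml sin_geN1 sin_le1.
rewrite /phi; case: i => -[] j /=; rewrite /right_fn /left_fn /cell_fn cutoff0 mul1r.
  rewrite ger0_norm; first exact: (right_w_le1 xi h0 h2pi eta0 etapi x (ltn_ord j) m1).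
  exact: (right_w_ge0 xi n h0 h2pi eta0 j x m1).
rewrite ger0_norm; first exact: (left_w_le1 xi h0 h2pi eta0 etapi x (ltn_ord j) m1).
exact: (left_w_ge0 xi n h0 h2pi eta0 j x m1).
Qed.

Let kruzkov_i i : 0 <= \int[mu]_(t in `[0, (T + theta)]) slice_int (f i) (2 * pi) t +
  \int[mu]_(x in A) g i x.
Proof.
have test_i : test_fn (phi i).
  by rewrite /phi; case: i.1; [apply: right_fn_test|apply: left_fn_test].
case: uE => _ _ _ _ /(_ (kv i) (phi i) test_i).
have [B fB] := f_bounded i.
have E1 := @iterated_intE _ (f i) (T + theta) B (2 * pi) (f_measurable i) Tth pi2_ge0 fB
  (f_late i).
rewrite [X in (_ <= X + _)%E -> _]E1.
by rewrite [X in (_ <= _ + X)%E -> _](RintegralE (g_integrable i)) lee_fin.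
Qed.

Lemma kruzkov_sum :
  0 <= \int[mu]_(t in `[0, (T + theta)]) (\sum_(i : I) slice_int (f i) (2 * pi) t) +
  \int[mu]_(x in A) (\sum_(i : I) g i x).
Proof.
rewrite (Rintegral_sum _ _ slice_f_integrable).2// (Rintegral_sum _ mA g_integrable).2.
by rewrite -big_split/=; apply: sumr_ge0 => i _; exact: kruzkov_i.
Qed.

Lemma initial_small :
  \int[mu]_(x in A) (\sum_(i : I) g i x) <= 2 * pi * (pi / n.+1%:R + h + eta).
Proof.
rewrite -[leRHS]mulrC -[X in _ * X](subr0 (2 * pi)) -Rintegral_itv_cst//.
apply: le_Rintegral => //.
- exact: (Rintegral_sum _ mA g_integrable).1.
- exact: itv_cst_integrable.
move=> x _; rewrite sum_bool_ord.
apply: le_trans (front_dist_initial xi n h0 h2pi eta0 etapi x).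
rewrite /front_dist le_eqVlt; apply/orP; left; apply/eqP.
by congr (_ + _); apply: eq_bigr => j _; rewrite /g /phi /kv /= /right_fn /left_fn
  /cell_fn cutoff0 mul1r.
Qed.

(** The smeared zone after the shock and its translates. The last one is there for the single point
    [x = 2 * pi] when [xi = 0], where [offset] equals [pi]. *)
Let bad x : R := \1_(`[xi, (xi + h)]%classic) x +
  \1_(`[(xi - 2 * pi), (xi - 2 * pi + h)]%classic) x +
  \1_(`[(xi + 2 * pi), (xi + 2 * pi + h)]%classic) x.

Let indic01 (B : set R) x : 0 <= (\1_B x : R) <= 1.
Proof. by rewrite indicE; case: (x \in B); rewrite ?lexx ?ler01. Qed.

Let bad_bound x : 0 <= bad x <= 3.
Proof.
have /andP[? ?] := indic01 `[xi, (xi + h)]%classic x.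
have /andP[? ?] := indic01 `[(xi - 2 * pi), (xi - 2 * pi + h)]%classic x.
have /andP[? ?] := indic01 `[(xi + 2 * pi), (xi + 2 * pi + h)]%classic x.
by rewrite /bad; apply/andP; split; lra.
Qed.

Let bad_measurable : measurable_fun setT bad.
Proof. by apply: measurable_funD; [apply: measurable_funD|]; apply: measurable_indic. Qed.

Let bad_ge1 x : 0 <= x <= 2 * pi -> ~~ (- pi + h < offset xi x < pi) -> 1 <= bad x.
Proof.
move=> /andP[x0 x1]; have /andP[xi0 xi1] := xi_bound; have hh := h0.
have /andP[? ?] := indic01 `[xi, (xi + h)]%classic x.
have /andP[? ?] := indic01 `[(xi - 2 * pi), (xi - 2 * pi + h)]%classic x.
have /andP[? ?] := indic01 `[(xi + 2 * pi), (xi + 2 * pi + h)]%classic x.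
have p0 := @pi_gt0 R.
have mem (a : R) : a <= x <= a + h -> \1_(`[a, (a + h)]%classic) x = 1 :> R.
  by move=> ax; rewrite indicE mem_set//= in_itv.
rewrite /bad negb_and -!leNgt /offset; case: ltP => xxi /orP[H|H].
- by rewrite (mem (xi - 2 * pi)); [lra|apply/andP; split; lra].
- by exfalso; lra.
- by rewrite (mem xi); [lra|apply/andP; split; lra].
- by rewrite (mem (xi + 2 * pi)); [lra|apply/andP; split; lra].
Qed.

Let indic_integral_le a : \int[mu]_(x in A) \1_(`[a, (a + h)]%classic) x <= h.
Proof.
pose B : set R := `[a, (a + h)]%classic.
have mB : measurable B by exact: measurable_itv.
have E : mu B = h%:E.
  by rewrite itv_measure; [congr (_%:E); ring|rewrite lerDl ltW].
have le1 : (mu (B `&` A) <= h%:E)%E.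
  rewrite -E; apply: le_measure; rewrite ?inE; [exact: measurableI|exact: mB|].
  exact: subIsetl.
rewrite /Rintegral integral_indic// -lee_fin fineK// ge0_fin_numE; last exact: measure_ge0.
exact: le_lt_trans le1 (ltry _).
Qed.

Let indic_A_integrable (B : set R) : measurable B -> mu.-integrable A (EFin \o \1_B).
Proof.
move=> mB; apply: (@A_integrable _ 1); first exact: measurable_indic.
by move=> x; have /andP[? ?] := indic01 B x; rewrite ger0_norm.
Qed.

Let bad_integrable : mu.-integrable A (EFin \o bad).
Proof.
apply: (@A_integrable _ 3) => // x.
by have /andP[? ?] := bad_bound x; rewrite ger0_norm.
Qed.

Let bad_integral : \int[mu]_(x in A) bad x <= 3 * h.
Proof.
have ind a : mu.-integrable A (EFin \o \1_(`[a, (a + h)]%classic)).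
  by apply: indic_A_integrable; exact: measurable_itv.
have i1 := ind xi; have i2 := ind (xi - 2 * pi); have i3 := ind (xi + 2 * pi).
rewrite (Rintegral_add mA (integrable_add mA i1 i2) i3) (Rintegral_add mA i1 i2).
have := indic_integral_le xi; have := indic_integral_le (xi - 2 * pi).
have := indic_integral_le (xi + 2 * pi); lra.
Qed.

Let delta : R := pi / n.+1%:R + h + theta + eta.

Let profile_front x t : 0 <= x <= 2 * pi -> T <= t <= T + theta ->
  front_dist xi n h eta (profile xi w x) x t <= delta + 2 * bad x.
Proof.
move=> xA tT; have /andP[b0 _] := bad_bound x.
have [good|/negP/negP notgood] := boolP (- pi + h < offset xi x < pi).
  apply: (@le_trans _ _ delta); last by lra.
  exact: (front_dist_final n Tpi wP h0 hpi eta0 etapi xA good tT).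
have b1 := bad_ge1 xA notgood.
have t1 : -1 <= t by have := T0; case/andP: tT => *; lra.
have d0 : 0 <= delta.
  rewrite /delta; have e0 := eta0; have t0 := theta0; have hh := h0.
  have : 0 <= @pi R / n.+1%:R by rewrite divr_ge0 ?ltW ?pi_gt0.
  by move: (pi / n.+1%:R) => d; lra.
have le2 v (s : R) : `|v| <= 1 -> `|s| <= 1 -> `|v - s| <= 2.
  by move=> *; apply: le_trans (ler_normB _ _) _; rewrite (_ : 2 = 1 + 1)// lerD.
have p1 := profile_le1 x.
have s1 (y : R) : `|sin y| <= 1 by rewrite ler_norml sin_geN1 sin_le1.
apply: (@le_trans _ _ 2); last by lra.
apply: (front_dist_le h0 h2pi eta0 etapi t1) => j _ _; apply: le2 => //.
by rewrite normrN.
Qed.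

Let A01 x : A x -> 0 <= x <= 2 * pi. Proof. by rewrite /A/= in_itv. Qed.

Let uB_integrable t : mu.-integrable A (EFin \o (fun x => `|u x t - u x T|)).
Proof.
case: uE => _ [M uM] _ _ _; apply: (@A_integrable _ (M + M)).
  by apply: measurable_abs; apply: measurable_funB; exact: u_measurable.
by move=> x; rewrite normr_id; apply: le_trans (ler_normB _ _) _; apply: lerD.
Qed.

Let uP_integrable : mu.-integrable A (EFin \o (fun x => `|u x T - profile xi w x|)).
Proof.
case: uE => _ [M uM] _ _ _; apply: (@A_integrable _ (M + 1)).
  by apply: measurable_abs; apply: measurable_funB; [exact: u_measurable|exact: profile_measurable].
move=> x; rewrite normr_id; apply: le_trans (ler_normB _ _) _; apply: lerD => //.
exact: profile_le1.
Qed.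

Let kappa : R := defect - e - 2 * pi * delta - 6 * h.

(** As [cutoff'] is nonpositive, [front_dist] has to be bounded below: by the triangle inequality it
    is at least the distance of [u] to the profile at time [T], less the drift and less the distance
    of the profile to the cell constants. The [6 * h] in [kappa] is twice the integral bound [3 * h]
    for [bad]. *)
Lemma slice_sum_le t : 0 <= t <= T + theta ->
  \sum_(i : I) slice_int (f i) (2 * pi) t <=
  2 * pi * front_err n h + cutoff' T theta t * kappa.
Proof.
move=> /andP[t0 tT].
have si i : mu.-integrable A (EFin \o f i ^~ t).
  by have [B fB] := f_bounded i; exact: (slice_integrable _ (f_measurable i) fB t0).
rewrite -(Rintegral_sum _ mA si).2.
pose G x := front_err n h + cutoff' T theta t *
  ((`|u x T - profile xi w x| + (-1) * `|u x t - u x T|) + (- delta + (-2) * bad x)).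
have i1 := integrable_add mA uP_integrable (integrable_scale (-1) mA (uB_integrable t)).
have ic (c : R) : mu.-integrable A (EFin \o (fun=> c)) by exact: itv_cst_integrable.
have i2 := integrable_add mA (ic (- delta)) (integrable_scale (-2) mA bad_integrable).
have i3 := integrable_scale (cutoff' T theta t) mA (integrable_add mA i1 i2).
have icc (c : R) : \int[mu]_(x in A) c = 2 * pi * c.
  by rewrite Rintegral_itv_cst// subr0 mulrC.
have GE : \int[mu]_(x in A) G x = 2 * pi * front_err n h + cutoff' T theta t *
    (defect - drift t - 2 * pi * delta - 2 * \int[mu]_(x in A) bad x).
  rewrite /G (Rintegral_add mA (ic _) i3) (Rintegral_scale _ mA (integrable_add mA i1 i2)).
  rewrite (Rintegral_add mA i1 i2)
    (Rintegral_add mA uP_integrable (integrable_scale _ mA (uB_integrable t))).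
  rewrite (Rintegral_add mA (ic _) (integrable_scale _ mA bad_integrable)).
  rewrite (Rintegral_scale _ mA (uB_integrable t)) (Rintegral_scale _ mA bad_integrable) !icc.
  by rewrite -/defect -/(drift t); ring.
have /andP[_ c0] := cutoff'_le0 T theta0 t0.
have cT : t < T -> cutoff' T theta t = 0.
  by move=> tlt; apply: (cutoff_start theta0 _).2; rewrite t0 ltW.
apply: (@le_trans _ _ (\int[mu]_(x in A) G x)).
  apply: le_Rintegral => //.
  - exact: (Rintegral_sum _ mA si).1.
  - exact: integrable_add.
  move=> x /A01 xA; rewrite sum_bool_ord.
  apply: (le_trans (kruzkov_pointwise T xi theta h0 h2pi eta0 etapi separated (u x t) x t0)).
  rewrite /G addrC lerD2l.
  have [tlt|Tt] := ltP t T; first by rewrite (cT tlt) !mul0r.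
  rewrite ler_wnM2l//.
  have t1 : -1 <= t by lra.
  have := front_dist_tri xi n h0 h2pi eta0 etapi (u x t) (profile xi w x) x t1.
  have := @profile_front x t xA; rewrite Tt tT => /(_ isT).
  have := ler_distD (u x t) (u x T) (profile xi w x).
  by rewrite [`|u x T - u x t|]distrC; lra.
rewrite GE lerD2l; have [tlt|Tt] := ltP t T; first by rewrite (cT tlt) !mul0r.
rewrite ler_wnM2l// /kappa.
have := @drift_e t; rewrite Tt tT => /(_ isT); have := bad_integral; lra.
Qed.

(** The integral of [cutoff'] is -1, so that integrating [slice_sum_le] leaves [- kappa] in
    Kruzkov's inequality; it is then solved for [defect]. *)
Lemma defect_le : defect <= e + 2 * pi * delta + 6 * h +
  2 * pi * front_err n h * (T + theta) + 2 * pi * (pi / n.+1%:R + h + eta).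
Proof.
have T1 : 0 < T + theta by have := T0; have := theta0; lra.
have ci : mu.-integrable `[0, (T + theta)]%classic (EFin \o cutoff' T theta).
  apply: continuous_compact_integrable; first exact: segment_compact.
  exact: continuous_subspaceT.
have FTC : \int[mu]_(t in `[0, (T + theta)]) cutoff' T theta t = -1.
  rewrite /Rintegral (@continuous_FTC2 _ _ (cutoff T theta))//.
  - rewrite (cutoff_end theta0 (lexx _)).1 cutoff0 -EFinB/=; lra.
  - exact: continuous_subspaceT.
  - split.
    + by move=> t _; have := der_cutoff T theta t => ?; apply: ex_derive.
    + by apply: cvg_at_right_filter; exact: chi_cont.
    + by apply: cvg_at_left_filter; exact: chi_cont.
  - by move=> t _; have := der_cutoff T theta t => ?; rewrite derive1E derive_val.
have Ile : \int[mu]_(t in `[0, (T + theta)]) (\sum_(i : I) slice_int (f i) (2 * pi) t) <=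
    2 * pi * front_err n h * (T + theta) - kappa.
  have cst c : mu.-integrable `[0, (T + theta)]%classic (EFin \o (fun=> c)).
    exact: itv_cst_integrable.
  have mI : measurable `[0, (T + theta)]%classic by exact: measurable_itv.
  pose c := 2 * pi * front_err n h.
  apply: (@le_trans _ _ (\int[mu]_(t in `[0, (T + theta)])
      (c + kappa * cutoff' T theta t))).
    apply: le_Rintegral => //.
    - exact: (Rintegral_sum _ mI slice_f_integrable).1.
    - by apply: integrable_add => //; apply: integrable_scale.
    by move=> t; rewrite /= in_itv/= => tI; rewrite [kappa * _]mulrC; exact: slice_sum_le.
  rewrite (Rintegral_add mI (cst c) (integrable_scale kappa mI ci)) (Rintegral_scale _ mI ci) FTC.
  by rewrite Rintegral_itv_cst ?subr0 ?mulrN1//; exact: ltW.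
have := kruzkov_sum; have := initial_small; move: Ile; rewrite /kappa.
move: (2 * pi * (pi / n.+1%:R + h + eta)) (2 * pi * delta)
  (2 * pi * front_err n h * (T + theta)) => a b c.
move: (\int[mu]_(x in A) _) (\int[mu]_(t in _) _) => I1 I2.
by lra.
Qed.

End FrontScales.
End Identification.

Section EntropyProfile.
Context {R : realType}.
Local Notation mu := (@lebesgue_measure R).

Lemma archimedean_step (c : R) : 0 < c -> exists n : nat, @pi R / n.+1%:R <= c.
Proof.
move=> c0; have p0 := @pi_gt0 R.
have xr : pi / c \is Num.real by exact: num_real.
exists (Num.truncn (pi / c)).
have := truncnS_gt (pi / c); rewrite ltr_pdivrMr// => H.
by rewrite ler_pdivrMr ?ltr0n// mulrC ltW.
Qed.

Lemma fine_integral_le (f : R -> R) (D : set R) (e : R) : (forall x, 0 <= f x) ->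
  (\int[mu]_(x in D) (f x)%:E < e%:E)%E -> \int[mu]_(x in D) f x <= e.
Proof.
move=> f0 H; have i0 : (0 <= \int[mu]_(x in D) (f x)%:E)%E.
  by apply: integral_ge0 => x _; rewrite lee_fin.
rewrite -lee_fin /Rintegral fineK; first exact: ltW.
by rewrite ge0_fin_numE//; apply: lt_trans H (ltry _).
Qed.

Lemma entropy_profile (T xi : R) (w : R -> R) (u : R -> R -> R) :
  pi < T -> (forall z, zmap T (w z) = z) -> 0 <= xi <= 2 * pi ->
  entropy_solution (sin_datum xi) u ->
  \int[mu]_(x in `[0, (2 * pi)]) `|u x T - profile xi w x| = 0.
Proof.
move=> Tpi wP xib uE; have p0 := @pi_gt0 R; have p2 := @pi_ge2 R.
apply/eqP; rewrite eq_le; apply/andP; split; last by apply: Rintegral_ge0.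
(* With all scales at most [e]: [7 = 1 + 6] for the drift and the bad set, [14 = 2 * (4 + 3)] for
   the final and initial errors, and the last term for the fronts. *)
pose K : R := 7 + 14 * pi + 2 * pi * (T + 1).
have K0 : 0 < K by rewrite /K; nra.
suff small e : 0 < e -> e < 1 -> defect T xi w u <= K * e.
  rewrite leNgt; apply/negP => D0; set D := (X in 0 < X) in D0.
  pose e := Num.min (1 / 2) (D / (2 * K)).
  have e0 : 0 < e by rewrite lt_min !divr_gt0// mulr_gt0.
  have e1 : e < 1 by rewrite gt_min; apply/orP; left; lra.
  have := small e e0 e1; rewrite /defect -/D leNgt; apply/negP/negPn.
  have : e <= D / (2 * K) by rewrite ge_min lexx orbT.
  rewrite ler_pdivlMr ?mulr_gt0//; lra.
move=> e0 e1.
have [d d0 dP] : exists2 d : R, 0 < d & forall t, 0 <= t -> `|t - T| < d ->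
    drift T u t <= e.
  case: uE => _ _ _ uc _.
  have [|d d0 dP] := uc T _ e e0; first by lra.
  by exists d => // t t0 td; apply: fine_integral_le; [move=> x|exact: dP].
pose theta := Num.min e (d / 2).
have th0 : 0 < theta by rewrite lt_min e0 divr_gt0.
have th1 : theta <= e by rewrite ge_min lexx.
have th2 : theta <= d / 2 by rewrite ge_min lexx orbT.
(* For [h = e] the front error is at most [C / e] times the mesh, since [n] times the mesh is at
   most [pi] and the mesh at most 1; hence a mesh of order [e ^+ 2]. *)
pose C : R := 2 * (2 * pi + 9).
have C0 : 0 < C by rewrite /C; lra.
have ec0 : 0 < e ^+ 2 / C by rewrite divr_gt0 ?exprn_gt0.
have [n nP] := archimedean_step ec0.
(* [eta] has to come after [n]: the separation of the fronts depends on the grid. *)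
have [eta1 eta10 sep] := @grid_separation R n.
pose eta := Num.min eta1 e.
have eta0 : 0 < eta by rewrite lt_min eta10.
have etae : eta <= e by rewrite ge_min lexx orbT.
have etapi : eta <= pi by lra.
have sep' t i j : (i < j)%N -> 0 < front t (grid n i) -> eta <= front t (grid n j).
  by move=> ij F; apply: le_trans (sep t i j ij F); rewrite ge_min lexx.
have epi : e < pi by lra.
have driftP t : T <= t <= T + theta -> drift T u t <= e.
  move=> /andP[t1 t2]; apply: dP; first by lra.
  by rewrite ger0_norm; lra.
have := defect_le Tpi wP xib uE e0 epi eta0 etapi th0 sep' driftP.
have nd : n%:R * (pi / n.+1%:R) <= pi :> R.
  by rewrite mulrCA ler_piMr ?(ltW p0)// ler_pdivrMr ?ltr0n// mul1r ler_nat.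
have dd0 : 0 < @pi R / n.+1%:R by rewrite divr_gt0.
rewrite /front_err; move: (pi / n.+1%:R) (n%:R) nP nd dd0 => dd N dC Nd dd0.
have dC' : dd * C <= e ^+ 2 by rewrite -ler_pdivlMr.
have dde : dd <= e by rewrite /C in dC'; nra.
have err : 2 / e * (2 * N * dd ^+ 2 + 8 * dd + dd ^+ 2) <= e.
  rewrite mulrAC ler_pdivrMr// -expr2.
  apply: le_trans dC'; rewrite /C; nra.
move: (2 / e * _) err => E err.
have : 2 * pi * (dd + e + theta + eta) <= 2 * pi * (4 * e) by rewrite ler_pM2l; lra.
have : 2 * pi * (dd + e + eta) <= 2 * pi * (3 * e) by rewrite ler_pM2l; lra.
have : 2 * pi * E * (T + theta) <= 2 * pi * e * (T + 1).
  rewrite -!mulrA ler_pM2l// ler_pM2l//.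
  have : E * (T + theta) <= e * (T + theta) by rewrite ler_pM2r//; lra.
  have : e * (T + theta) <= e * (T + 1) by rewrite ler_pM2l//; lra.
  by lra.
rewrite /K; lra.
Qed.

End EntropyProfile.

(** * Polynomials with nonnegative coefficients *)

Section Bernstein.
Context {R : realType}.
Implicit Types (b c x y l : R) (f g : R -> R) (n : nat) (p : {poly R}).

(* Functions nonnegative on [0, b] together with all their derivatives. *)
Definition monotone_class b (F : (R -> R) -> Prop) : Prop :=
  forall f, F f -> (forall x, 0 <= x <= b -> 0 <= f x) /\
    exists f', F f' /\ forall x, 0 <= x <= b -> is_derive x 1 f (f' x).

Definition antideriv c p n : {poly R} :=
  \poly_(i < n.+1) (if i is k.+1 then p`_k / k.+1%:R else c).

Lemma antiderivK c p n : (size p <= n)%N -> (antideriv c p n)^`() = p.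
Proof.
move=> pn; apply/polyP => i; rewrite coef_deriv coef_poly ltnS.
have [ni|ni] := ltnP i n.
  by rewrite -[LHS]mulr_natr divfK// pnatr_eq0.
by rewrite mul0rn nth_default// (leq_trans pn).
Qed.

Lemma antideriv0 c p n : (antideriv c p n).[0] = c.
Proof. by rewrite horner_coef0 coef_poly. Qed.

Lemma der_poly p x : is_derive x 1 (fun y => p.[y]) p^`().[x].
Proof. exact: is_derive_poly. Qed.

(* The remainder of order [n] satisfies [l^n r(y) - r(l y) >= 0]: this vanishes at
   [y = 0], and its derivative is [l] times the same quantity of order [n - 1] for
   the derivative of the function. *)
Lemma bernstein b F n f : 0 <= b -> monotone_class b F -> F f ->
  exists p : {poly R}, [/\ (size p <= n)%N, forall i, 0 <= p`_i &
    forall y l, 0 <= y <= b -> 0 <= l <= 1 ->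
      0 <= f y - p.[y] /\ f (l * y) - p.[l * y] <= l ^+ n * (f y - p.[y])].
Proof.
move=> b0 FF; elim: n f => [|n IH] f Ff; have [f0 [f' [Ff' df]]] := FF f Ff.
  exists 0; split; [by rewrite size_poly0|by move=> i; rewrite coef0|].
  move=> y l /andP[y0 yb] /andP[l0 l1]; rewrite !horner0 !subr0 expr0 mul1r.
  split; first by apply: f0; rewrite y0.
  have [f'0 _] := FF f' Ff'.
  have ly : l * y <= y by rewrite ler_piMl.
  have ly0 : 0 <= l * y by rewrite mulr_ge0.
  apply: (@der_ge0_le _ f f' _ _ ly) => z /andP[z0 z1].
    by apply: df; rewrite (le_trans ly0 z0) (le_trans z1 yb).
  by apply: f'0; rewrite (le_trans ly0 z0) (le_trans z1 yb).
have [p' [sp' p'0 Hp']] := IH f' Ff'.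
pose p := antideriv (f 0) p' n.
have dR x : 0 <= x <= b -> is_derive x 1 (fun z => f z - p.[z]) (f' x - p'.[x]).
  by move=> xb; have := derB (df x xb) (der_poly p x); rewrite antiderivK.
have R0 : f 0 - p.[0] = 0 by rewrite antideriv0 subrr.
exists p; split; first exact: size_poly.
  move=> i; rewrite coef_poly; case: ifP => // _; case: i => [|i].
    by apply: f0; rewrite lexx.
  by rewrite divr_ge0.
have R'0 x : 0 <= x <= b -> 0 <= f' x - p'.[x].
  by move=> xb; have [] := Hp' x 1 xb; rewrite ?ler01 ?lexx.
move=> y l /andP[y0 yb] /andP[l0 l1].
have sub z : 0 <= z <= y -> 0 <= z <= b by move=> /andP[-> /le_trans]; apply.
have subl z : 0 <= z <= y -> 0 <= l * z <= b.
  move=> /andP[z0 zy]; rewrite mulr_ge0//= (le_trans _ yb)// (le_trans _ zy)//.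
  by rewrite ler_piMl.
split.
  rewrite -R0; apply: (@der_ge0_le _ (fun z => f z - p.[z]) (fun z => f' z - p'.[z])) => //.
    by move=> z /sub; exact: dR.
  by move=> z /sub; exact: R'0.
rewrite -subr_ge0.
pose D z := l ^+ n.+1 * (f z - p.[z]) - (f (l * z) - p.[l * z]).
have D0 : D 0 = 0 by rewrite /D mulr0 R0 mulr0 subr0.
rewrite -/(D y) -D0.
apply: (@der_ge0_le _ D (fun z => l * (l ^+ n * (f' z - p'.[z]) -
    (f' (l * z) - p'.[l * z])))) => //.
  move=> z zy; have dl : is_derive z 1 (fun s => l * s) l.
    by apply: der_val (derZ l (der_id z)); rewrite mulr1.
  have dRl := @der_comp _ (fun z => f z - p.[z]) (fun s => l * s) _ _ _ (dR _ (subl z zy)) dl.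
  apply: der_val (derB (derZ (l ^+ n.+1) (dR z (sub z zy))) dRl).
  by rewrite exprS; ring.
move=> z zy; rewrite mulr_ge0// subr_ge0.
by have [] := Hp' z l (sub z zy); rewrite ?l0.
Qed.

Section GeneratedClass.
Variables (b : R) (g1 g2 g1' g2' : R -> R).

(** Once it contains the derivatives of its two generators, this algebra is stable under
    differentiation, and nonnegativity of all derivatives reduces to that of the generators. No
    higher derivative is ever computed. *)
Inductive positive_algebra : (R -> R) -> Prop :=
| PosCst c : 0 <= c -> positive_algebra (fun _ => c)
| PosGen1 : positive_algebra g1
| PosGen2 : positive_algebra g2
| PosAdd f g : positive_algebra f -> positive_algebra g ->
    positive_algebra (fun x => f x + g x)
| PosMul f g : positive_algebra f -> positive_algebra g ->
    positive_algebra (fun x => f x * g x).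

Hypothesis g1_ge0 : forall x, 0 <= x <= b -> 0 <= g1 x.
Hypothesis g2_ge0 : forall x, 0 <= x <= b -> 0 <= g2 x.
Hypothesis g1_der : forall x, 0 <= x <= b -> is_derive x 1 g1 (g1' x).
Hypothesis g2_der : forall x, 0 <= x <= b -> is_derive x 1 g2 (g2' x).
Hypothesis g1'_pos : positive_algebra g1'.
Hypothesis g2'_pos : positive_algebra g2'.

Lemma positive_algebra_class (w w' : R -> R) :
  (forall x, 0 <= x <= b -> 0 <= w x) ->
  (forall x, 0 <= x <= b -> is_derive x 1 w (w' x)) -> positive_algebra w' ->
  monotone_class b (fun f => positive_algebra f \/ f = w).
Proof.
move=> w0 dw w'F f; case=> [Ff|->]; last by split => //; exists w'; split => //; left.
suff : (forall x, 0 <= x <= b -> 0 <= f x) /\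
    exists f', positive_algebra f' /\ forall x, 0 <= x <= b -> is_derive x 1 f (f' x).
  by move=> [? [f' [? ?]]]; split => //; exists f'; split => //; left.
elim: Ff => [c c0| | |{}f g _ [f0 [f' [Ff' df]]] _ [g0 [g' [Fg' dg]]]|
  {}f g Ff [f0 [f' [Ff' df]]] Fg [g0 [g' [Fg' dg]]]].
- split => //; exists (fun _ => 0); split; first exact: PosCst.
  by move=> x _; exact: der_cst.
- by split => //; exists g1'.
- by split => //; exists g2'.
- split; first by move=> x xb; rewrite addr_ge0 ?f0 ?g0.
  exists (fun x => f' x + g' x); split; first exact: PosAdd.
  by move=> x xb; exact: derD (df x xb) (dg x xb).
- split; first by move=> x xb; rewrite mulr_ge0 ?f0 ?g0.
  exists (fun x => f' x * g x + f x * g' x); split.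
    by apply: PosAdd; apply: PosMul.
  by move=> x xb; exact: derM (df x xb) (dg x xb).
Qed.

End GeneratedClass.

(** Generators [x] and [r = asin']: the algebra is stable because [r' = x * r ^+ 3]. *)
Lemma asin_class : exists F, monotone_class (9 / 10) F /\ F (@asin R).
Proof.
pose r x : R := (Num.sqrt (1 - x ^+ 2))^-1.
have xlt x : 0 <= x <= 9 / 10 -> 0 < 1 - x ^+ 2.
  by move=> /andP[? ?]; rewrite expr2; nra.
exists (fun f => positive_algebra id r f \/ f = asin); split; last by right.
have g1_ge0 x : 0 <= x <= 9 / 10 -> 0 <= x by case/andP.
have g2_ge0 x : 0 <= x <= 9 / 10 -> 0 <= r x by rewrite invr_ge0 sqrtr_ge0.
have g1_der x : 0 <= x <= 9 / 10 -> is_derive x 1 id 1 by move=> _; exact: der_id.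
pose r' x : R := x * (r x * (r x * r x)).
have g2_der x : 0 <= x <= 9 / 10 -> is_derive x 1 r (r' x).
  move=> /xlt x1; have s0 : Num.sqrt (1 - x ^+ 2) != 0 by rewrite gt_eqF ?sqrtr_gt0.
  have d1 : is_derive x 1 (fun y => 1 - y ^+ 2) (- (2 * x)).
    apply: (@der_ext _ (fun y => 1 - y * y)); first by move=> y; rewrite expr2.
    apply: der_val (derB (der_cst 1 x) (derM (der_id x) (der_id x))); ring.
  have d2 := @der_comp _ Num.sqrt (fun y => 1 - y ^+ 2) _ _ _ (is_derive1_sqrt x1) d1.
  have := @derV _ (fun y => Num.sqrt (1 - y ^+ 2)) x _ s0 d2.
  by apply: der_val; rewrite /r' /r /=; field.
have g1'_pos : positive_algebra id r (fun _ => 1) by exact: PosCst.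
have g2'_pos : positive_algebra id r r'.
  apply: PosMul; first exact: PosGen1.
  by apply: PosMul; [|apply: PosMul]; exact: PosGen2.
have asin_ge0 x : 0 <= x <= 9 / 10 -> 0 <= asin x.
  move=> /andP[x0 x1]; have xI : -1 <= x <= 1 by apply/andP; split; lra.
  have := asinK (x := x); rewrite in_itv/= => /(_ xI) E.
  rewrite leNgt; apply/negP => a0; have : sin (asin x) < sin 0.
    rewrite ltr_sin// in_itv/=; first by rewrite asin_geNpi2 ?asin_lepi2.
    by have := @pi_gt0 R; move=> ?; apply/andP; split; lra.
  by rewrite E sin0 ltNge x0.
have asin_der x : 0 <= x <= 9 / 10 -> is_derive x 1 asin (r x).
  by move=> /andP[? ?]; apply: is_derive1_asin; apply/andP; split; lra.
exact: (positive_algebra_class g1_ge0 g2_ge0 g1_der g2_der g1'_pos g2'_pos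
  asin_ge0 asin_der (PosGen2 _ _)).
Qed.

Section InverseClass.
Variables (T : R) (w : R -> R).
Hypothesis Tpi : pi < T.
Hypothesis wP : forall z, zmap T (w z) = z.

Let T0 : 0 <= T. Proof. by have := Tpi; have := @pi_gt0 R; lra. Qed.

Lemma winvK o : w (zmap T o) = o.
Proof.
by apply/eqP; rewrite eq_le (zmap_le_inv T0 wP)// (zmap_ge_inv T0 wP).
Qed.

(** [w] reaches [pi / 2] only at [pi / 2 + T], beyond [3 / 2 * pi]. The bound [5 / 4 * pi] is chosen
    because 4/5 of it is [pi]. *)
Lemma winv_bound z : 0 <= z <= 5 / 4 * pi -> 0 <= w z < pi / 2.
Proof.
move=> /andP[z0 z1]; have p0 := @pi_gt0 R; have TT := Tpi.
have zmap0 : zmap T 0 = 0 by rewrite /zmap clamp_id ?sin0 ?mulr0 ?addr0//; lra.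
have W0 : w 0 = 0 by rewrite -zmap0 winvK.
have /andP[A _] := winv_lip T0 wP z0; rewrite W0 subr0 in A.
rewrite A/= ltNge; apply/negP => B.
have := zmap_expand T0 B; rewrite wP /zmap clamp_id ?sin_pihalf; first by lra.
by apply/andP; split; lra.
Qed.

Lemma winv0 : w 0 = 0.
Proof.
have p0 := @pi_gt0 R.
by have := winvK 0; rewrite /zmap clamp_id ?sin0 ?mulr0 ?addr0//; lra.
Qed.

Lemma der_winv z : 0 <= z <= 5 / 4 * pi -> is_derive z 1 w (1 + T * cos (w z))^-1.
Proof.
move=> zb; have /andP[w0 w1] := winv_bound zb; have p0 := @pi_gt0 R; have TT := Tpi.
have c0 : 0 < cos (w z) by apply: cos_gt0_pihalf; rewrite w1 andbT; lra.
have dz : is_derive (w z) 1 (zmap T) (1 + T * cos (w z)).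
  apply: (@near_eq_is_derive _ _ _ (fun o => o + T * sin o)).
  have : w z \in `](- (pi / 2)), (pi / 2)[ by rewrite in_itv/= w1 andbT; lra.
  move=> /near_in_itvoo; apply: filterS => o; rewrite in_itv/= => /andP[? ?].
  by rewrite /zmap clamp_id//; apply/andP; split; lra.
rewrite -{1}(wP z); apply: (@is_derive_inverse _ (zmap T)) => //.
- by near=> o; exact: winvK.
- by near=> o; exact: zmap_continuous.
- by rewrite gt_eqF//; nra.
Unshelve. all: by end_near. Qed.

(* In terms of [rho = w' - w'(0)] and [e = w''] one has [rho' = e] and [e'] a
   polynomial in [rho] with nonnegative coefficients. *)
Lemma winv_class : exists F, monotone_class (5 / 4 * pi) F /\ F w.
Proof.
pose r z : R := (1 + T * cos (w z))^-1.
pose r0 : R := (1 + T)^-1.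
pose rho z := r z - r0.
pose e z := T * sin (w z) * r z ^+ 3.
have p0 := @pi_gt0 R; have TT := Tpi; have p2 := @pi_ge2 R.
have T1 : 0 < 1 + T by lra.
have r00 : 0 < r0 by rewrite invr_gt0.
have q0 z : 0 <= z <= 5 / 4 * pi -> 0 < 1 + T * cos (w z).
  move=> zb; have /andP[w0 w1] := winv_bound zb.
  have c0 : 0 < cos (w z) by apply: cos_gt0_pihalf; rewrite w1 andbT; lra.
  by nra.
have dcos z : 0 <= z <= 5 / 4 * pi ->
    is_derive z 1 (fun x => cos (w x)) (- sin (w z) * r z).
  by move=> zb; exact: (@der_comp _ cos w _ _ _ (der_cos _) (der_winv zb)).
have dsin z : 0 <= z <= 5 / 4 * pi ->
    is_derive z 1 (fun x => sin (w x)) (cos (w z) * r z).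
  by move=> zb; exact: (@der_comp _ sin w _ _ _ (der_sin _) (der_winv zb)).
have dr z : 0 <= z <= 5 / 4 * pi -> is_derive z 1 r (e z).
  move=> zb; have qz : 1 + T * cos (w z) != 0 by rewrite gt_eqF ?q0.
  have := @derV _ (fun x => 1 + T * cos (w x)) z _ qz
    (derD (der_cst 1 z) (derZ T (dcos z zb))).
  by apply: der_val; rewrite /e /r; field.
(* Eliminating sine and cosine, [e' = r^3 * (3 * (T^2 - 1) * r^2 + 5 * r - 2)]. The negative
   constant -2 becomes [T / (1 + T)] when expanded at [r = r0 + rho]; this is why the generator is
   [rho] and not [r]. *)
pose de z := ((r0 + rho z) * ((r0 + rho z) * (r0 + rho z))) *
  ((T / (1 + T) + (6 * T - 1) * rho z) + 3 * (T ^+ 2 - 1) * (rho z * rho z)).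
exists (fun f => positive_algebra rho e f \/ f = w); split; last by right.
have rE : (fun z => r0 + rho z) = r by apply/funext => z; rewrite /rho; ring.
have posr : positive_algebra rho e (fun z => r0 + rho z).
  by apply: PosAdd; [apply: PosCst; exact: ltW|exact: PosGen1].
have g1_ge0 z : 0 <= z <= 5 / 4 * pi -> 0 <= rho z.
  move=> /q0 qz; rewrite /rho subr_ge0 /r /r0 lef_pV2//.
  by rewrite lerD2l ler_piMr// ?cos_le1//; lra.
have g2_ge0 z : 0 <= z <= 5 / 4 * pi -> 0 <= e z.
  move=> zb; have /andP[w0 w1] := winv_bound zb.
  have sw : 0 <= sin (w z) by apply: sin_ge0_pi; rewrite w0/=; lra.
  have rz : 0 <= r z by rewrite invr_ge0 ltW// q0.
  by rewrite /e !mulr_ge0// exprn_ge0.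
have g1_der z : 0 <= z <= 5 / 4 * pi -> is_derive z 1 rho (e z).
  by move=> zb; apply: der_val (derB (dr z zb) (der_cst r0 z)); exact: subr0.
have g2_der z : 0 <= z <= 5 / 4 * pi -> is_derive z 1 e (de z).
  move=> zb; have qz : 1 + T * cos (w z) != 0 by rewrite gt_eqF ?q0.
  have dr3 : is_derive z 1 (fun x => r x ^+ 3) (3 * r z ^+ 2 * e z).
    apply: (@der_ext _ (fun x => r x * (r x * r x))); first by move=> x; ring.
    apply: der_val (derM (dr z zb) (derM (dr z zb) (dr z zb))); ring.
  have := derM (derZ T (dsin z zb)) dr3; apply: der_val.
  have E : r0 + rho z = r z by rewrite /rho; ring.
  have rq : r z * (1 + T * cos (w z)) = 1 by rewrite mulVf.
  have cE : T * cos (w z) * r z = 1 - r z by rewrite -[X in X - _]rq; ring.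
  have s2 : (T * sin (w z) * r z) ^+ 2 = (T * r z) ^+ 2 - (1 - r z) ^+ 2.
    by rewrite -cE !exprMn sin2cos2; ring.
  have r0E : T / (1 + T) = 1 - r0 by rewrite /r0; field; rewrite gt_eqF.
  rewrite /de E r0E.
  transitivity ((T * cos (w z) * r z) * r z ^+ 3 +
      3 * (T * sin (w z) * r z) ^+ 2 * r z ^+ 3); first by rewrite /e; ring.
  rewrite cE s2 -E.
  by move: (rho z) => q; rewrite /r0; field; rewrite gt_eqF.
have g2'_pos : positive_algebra rho e de.
  apply: PosMul; first by apply: PosMul => //; apply: PosMul.
  apply: PosAdd; first apply: PosAdd.
  - by apply: PosCst; rewrite divr_ge0; lra.
  - by apply: PosMul; [apply: PosCst; lra|exact: PosGen1].
  - apply: PosMul; [apply: PosCst|by apply: PosMul; exact: PosGen1].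
    by rewrite expr2; nra.
have w_ge0 z : 0 <= z <= 5 / 4 * pi -> 0 <= w z by move=> /winv_bound/andP[].
have w_der z : 0 <= z <= 5 / 4 * pi -> is_derive z 1 w (r0 + rho z).
  by move=> zb; rewrite [_ + _](congr1 (fun g => g z) rE); exact: der_winv.
exact: (positive_algebra_class g1_ge0 g2_ge0 g1_der g2_der (PosGen2 _ _) g2'_pos
  w_ge0 w_der posr).
Qed.

End InverseClass.
End Bernstein.

(** * Networks *)

Section Networks.
Context {R : realType}.
Implicit Types (x y z d e : R) (v : seq R) (L : layer R) (N : network R).

Lemma dot_nil v : dot [::] v = 0.
Proof. by rewrite /dot big_ord0. Qed.

Lemma dot_cons a (r : seq R) x v : dot (a :: r) (x :: v) = a * x + dot r v.
Proof. by rewrite /dot/= big_ord_recl/=. Qed.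

Definition rows (l : seq (seq R * R)) : layer R := (unzip1 l, unzip2 l).

Lemma affine_rows l v : affine (rows l) v = [seq dot rb.1 v + rb.2 | rb <- l].
Proof. by rewrite /affine /rows/= zip_unzip. Qed.

(* Here the ReLU follows every layer, so that composition is concatenation. *)
Definition relu_eval N v : seq R := foldl (fun v L => map (@relu R) (affine L v)) v N.

Fixpoint relu_wf (k : nat) N (l : nat) : bool :=
  if N is L :: N' then layer_wf k L (size L.2) && relu_wf (size L.2) N' l else k == l.

Definition narrow (W : nat) N : bool := all (fun L : layer R => (size L.2 <= W)%N) N.

Lemma relu_eval_cat N1 N2 v : relu_eval (N1 ++ N2) v = relu_eval N2 (relu_eval N1 v).
Proof. by rewrite /relu_eval foldl_cat. Qed.

Lemma relu_wf_cat k l j N1 N2 : relu_wf k N1 l -> relu_wf l N2 j -> relu_wf k (N1 ++ N2) j.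
Proof.
by elim: N1 k => [|L N1 IH] k /=; [move=> /eqP->|move=> /andP[-> /IH H] /H].
Qed.

Lemma nn_eval_rcons N L v : nn_eval (rcons N L) v = affine L (relu_eval N v).
Proof.
elim: N v => [//|L' N IH] v /=; rewrite -IH.
by case: N {IH}.
Qed.

Lemma nn_wf_rcons k l j N L : relu_wf k N l -> layer_wf l L j -> nn_wf k (rcons N L) j.
Proof.
elim: N k => [|L' N IH] k /=; first by move=> /eqP->.
move=> /andP[wL /IH H] /H; case: (rcons N L) (size_rcons N L) => [//|L1 N1] _ wN /=.
by rewrite wL.
Qed.

Lemma nn_depth_rcons N L : nn_depth (rcons N L) = size N.
Proof. by rewrite /nn_depth size_rcons. Qed.

Lemma nn_width_rcons N L W : narrow W N -> (nn_width (rcons N L) <= W)%N.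
Proof.
rewrite /nn_width size_rcons/= -cats1 take_size_cat//.
by elim: N => [//|L' N IH] /= /andP[H /IH]; rewrite geq_max H.
Qed.

(** Carries a register through a layer; the ReLU preserves it as long as it is nonnegative. *)
Definition unit_row (k i : nat) : seq R := mkseq (fun j => (j == i)%:R) k.

Lemma dot_unit k i v : (i < k)%N -> dot (unit_row k i) v = v`_i.
Proof.
move=> ik; rewrite /dot size_mkseq (bigD1 (Ordinal ik))//= nth_mkseq// eqxx mul1r.
rewrite big1 ?addr0// => j /eqP ji; rewrite nth_mkseq//.
by case: eqP => [jE|_]; [exfalso; apply: ji; exact: val_inj|rewrite mul0r].
Qed.

End Networks.

Ltac eval_layer := rewrite ?affine_rows /relu_eval/= ?dot_unit//= ?dot_cons ?dot_nil;
  repeat (apply: (f_equal2 cons); first by try congr relu; ring).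

(** * Approximate multiplication and Horner's scheme *)

Section Multiplication.
Context {R : realType}.
Implicit Types (x y z d e : R) (v : seq R) (L : layer R) (N : network R).

Definition tent x : R := 2 * x - 4 * relu (x - 2^-1).

Lemma tent_bound x : 0 <= x <= 1 -> 0 <= tent x <= 1.
Proof.
move=> /andP[x0 x1]; rewrite /tent; have [H|/ltW H] := leP 0 (x - 2^-1).
  by rewrite relu_pos//; apply/andP; split; lra.
by rewrite relu_neg//; apply/andP; split; lra.
Qed.

(** Iterated, this expands [x * (1 - x)] in the iterates of [tent] with weights [4^-k], with a
    remainder divided by 4 at each step. *)
Lemma tent_parabola x : x * (1 - x) = tent x * (1 - tent x) / 4 + tent x / 4.
Proof.
rewrite /tent; have [H|/ltW H] := leP 0 (x - 2^-1).
  by rewrite relu_pos//; field.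
by rewrite relu_neg//; field.
Qed.

(* Registers [x; a; relu (a - 1/2); b; relu (b - 1/2); f; g; p1; p2; p3; p4]. *)
Definition tent_layer c : layer R := rows [::
  (unit_row 11 0, 0);
  ([:: 0; 2; -4; 0; 0; 0; 0; 0; 0; 0; 0], 0);
  ([:: 0; 2; -4; 0; 0; 0; 0; 0; 0; 0; 0], - 2^-1);
  ([:: 0; 0; 0; 2; -4; 0; 0; 0; 0; 0; 0], 0);
  ([:: 0; 0; 0; 2; -4; 0; 0; 0; 0; 0; 0], - 2^-1);
  ([:: 0; - (2 * c); 4 * c; 0; 0; 1; 0; 0; 0; 0; 0], 0);
  ([:: 0; 0; 0; - (2 * c); 4 * c; 0; 1; 0; 0; 0; 0], 0);
  (unit_row 11 7, 0); (unit_row 11 8, 0); (unit_row 11 9, 0); (unit_row 11 10, 0)].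

Lemma tent_layerE c x a b f g p1 p2 p3 p4 :
  relu_eval [:: tent_layer c]
    [:: x; a; relu (a - 2^-1); b; relu (b - 2^-1); f; g; p1; p2; p3; p4] =
  [:: relu x; relu (tent a); relu (tent a - 2^-1); relu (tent b); relu (tent b - 2^-1);
      relu (f - c * tent a); relu (g - c * tent b); relu p1; relu p2; relu p3; relu p4].
Proof. by rewrite /tent; eval_layer. Qed.

Fixpoint tent_net (s m : nat) : network R :=
  if m is m'.+1 then tent_layer (4^-1 ^+ s.+1) :: tent_net s.+1 m' else [::].

(** In use [A = a ^+ 2] and [s = 0], so the accumulator starts at [a = a ^+ 2 + a * (1 - a)]; the
    layers peel off the tents, and what remains above the square is explicit and at most [4^-m]. Two
    squares are computed in parallel, as a product is a difference of squares. *)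
Lemma tent_netE s m x a b A B p1 p2 p3 p4 :
  0 <= x -> 0 <= a <= 1 -> 0 <= b <= 1 -> 0 <= A -> 0 <= B ->
  0 <= p1 -> 0 <= p2 -> 0 <= p3 -> 0 <= p4 ->
  exists a' b', [/\ 0 <= a' <= 1, 0 <= b' <= 1 &
    relu_eval (tent_net s m)
      [:: x; a; relu (a - 2^-1); b; relu (b - 2^-1);
          A + 4^-1 ^+ s * (a * (1 - a)); B + 4^-1 ^+ s * (b * (1 - b)); p1; p2; p3; p4] =
    [:: x; a'; relu (a' - 2^-1); b'; relu (b' - 2^-1);
        A + 4^-1 ^+ (s + m) * (a' * (1 - a')); B + 4^-1 ^+ (s + m) * (b' * (1 - b'));
        p1; p2; p3; p4]].
Proof.
move=> x0 + + A0 B0 p10 p20 p30 p40.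
elim: m s a b => [|m IH] s a b a01 b01; first by exists a, b; rewrite addn0.
have [a' [b' [a'01 b'01 E]]] := IH s.+1 (tent a) (tent b) (tent_bound a01) (tent_bound b01).
exists a', b'; split => //; rewrite -addSnnS -E.
rewrite (_ : tent_net s m.+1 = [:: tent_layer (4^-1 ^+ s.+1)] ++ tent_net s.+1 m)//.
rewrite relu_eval_cat tent_layerE; congr (relu_eval _ _).
have /andP[ta0 ta1] := tent_bound a01; have /andP[tb0 tb1] := tent_bound b01.
have pow0 : 0 <= 4^-1 ^+ s.+1 :> R by rewrite exprn_ge0.
have upd C z : 0 <= C -> 0 <= tent z <= 1 ->
    relu (C + 4^-1 ^+ s * (z * (1 - z)) - 4^-1 ^+ s.+1 * tent z) =
    C + 4^-1 ^+ s.+1 * (tent z * (1 - tent z)).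
  move=> C0 /andP[t0 t1].
  rewrite (_ : _ - _ = C + 4^-1 ^+ s.+1 * (tent z * (1 - tent z))).
    by rewrite relu_pos// addr_ge0// mulr_ge0// mulr_ge0// subr_ge0.
  by rewrite tent_parabola exprS; field.
by rewrite !upd ?tent_bound// !(relu_pos x0, relu_pos p10, relu_pos p20, relu_pos p30,
  relu_pos p40, relu_pos ta0, relu_pos tb0).
Qed.

Definition mult_in1 : layer R := rows [::
  (unit_row 6 0, 0);
  ([:: 2^-1; 2^-1; 0; 0; 0; 0], 0); ([:: 2^-1; 2^-1; 0; 0; 0; 0], - 2^-1);
  ([:: 1; -1; 0; 0; 0; 0], 0); ([:: -1; 1; 0; 0; 0; 0], 0);
  (unit_row 6 2, 0); (unit_row 6 3, 0); (unit_row 6 4, 0); (unit_row 6 5, 0)].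

Lemma mult_in1E x y p1 p2 p3 p4 : relu_eval [:: mult_in1] [:: x; y; p1; p2; p3; p4] =
  [:: relu x; relu ((x + y) / 2); relu ((x + y) / 2 - 2^-1); relu (x - y); relu (y - x);
    relu p1; relu p2; relu p3; relu p4].
Proof. by eval_layer. Qed.

Definition mult_in2 : layer R := rows [::
  (unit_row 9 0, 0); (unit_row 9 1, 0); (unit_row 9 2, 0);
  ([:: 0; 0; 0; 2^-1; 2^-1; 0; 0; 0; 0], 0);
  ([:: 0; 0; 0; 2^-1; 2^-1; 0; 0; 0; 0], - 2^-1);
  (unit_row 9 1, 0); ([:: 0; 0; 0; 2^-1; 2^-1; 0; 0; 0; 0], 0);
  (unit_row 9 5, 0); (unit_row 9 6, 0); (unit_row 9 7, 0); (unit_row 9 8, 0)].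

Lemma mult_in2E (x a ra u v p1 p2 p3 p4 : R) :
  relu_eval [:: mult_in2] [:: x; a; ra; u; v; p1; p2; p3; p4] =
  [:: relu x; relu a; relu ra; relu ((u + v) / 2); relu ((u + v) / 2 - 2^-1); relu a;
     relu ((u + v) / 2); relu p1; relu p2; relu p3; relu p4].
Proof. by eval_layer. Qed.

(** The biases [d] and [d - 1] prepare the clamping to [[0, 1]] completed by [mult_out2], so that a
    rounding error cannot push the next Horner step out of the domain of the multiplication. *)
Definition mult_out1 d : layer R := rows [::
  (unit_row 11 0, 0);
  ([:: 0; 0; 0; 0; 0; 1; -1; 0; 0; 0; 0], d);
  ([:: 0; 0; 0; 0; 0; 1; -1; 0; 0; 0; 0], d - 1);
  (unit_row 11 7, 0); (unit_row 11 8, 0); (unit_row 11 9, 0); (unit_row 11 10, 0)].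

Lemma mult_out1E d x a ra b rb f g p1 p2 p3 p4 :
  relu_eval [:: mult_out1 d] [:: x; a; ra; b; rb; f; g; p1; p2; p3; p4] =
  [:: relu x; relu (d + f - g); relu (d + f - g - 1); relu p1; relu p2; relu p3; relu p4].
Proof. by eval_layer. Qed.

Definition mult_out2 : layer R := rows [::
  (unit_row 7 0, 0); ([:: 0; 1; -1; 0; 0; 0; 0], 0);
  (unit_row 7 3, 0); (unit_row 7 4, 0); (unit_row 7 5, 0); (unit_row 7 6, 0)].

Lemma mult_out2E (x u v p1 p2 p3 p4 : R) : relu_eval [:: mult_out2] [:: x; u; v; p1; p2; p3; p4] =
  [:: relu x; relu (u - v); relu p1; relu p2; relu p3; relu p4].
Proof. by eval_layer. Qed.

Definition horner_step_net m d : network R :=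
  [:: mult_in1] ++ [:: mult_in2] ++ tent_net 0 m ++ [:: mult_out1 d] ++ [:: mult_out2].

Lemma tent_net_wf s m : relu_wf 11 (tent_net s m) 11 && narrow 11 (tent_net s m).
Proof. by elim: m s => [//|m IH] s /=; have /andP[-> ->] := IH s.+1. Qed.

Lemma size_tent_net s m : size (tent_net s m) = m.
Proof. by elim: m s => [//|m IH] s /=; rewrite IH. Qed.

Lemma horner_step_net_wf m d :
  [/\ relu_wf 6 (horner_step_net m d) 6, narrow 11 (horner_step_net m d) &
      size (horner_step_net m d) = (m + 4)%N].
Proof.
have /andP[w1 w2] := tent_net_wf 0 m; split.
- apply: (@relu_wf_cat _ _ 9) => //; apply: (@relu_wf_cat _ _ 11) => //.
  exact: relu_wf_cat w1 _.
- by rewrite /narrow !all_cat/= !andbT; exact: w2.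
- by rewrite /horner_step_net /= size_cat size_tent_net/= addn2 addn4.
Qed.

Definition clamp01 z : R := relu z - relu (z - 1).

Lemma clamp01_id z : 0 <= z <= 1 -> clamp01 z = z.
Proof. by move=> /andP[? ?]; rewrite /clamp01 relu_pos// relu_neg; lra. Qed.

Lemma clamp01_bound z : 0 <= clamp01 z <= 1.
Proof.
rewrite /clamp01; have [z0|/ltW z0] := leP 0 z; last by rewrite !relu_neg; lra.
have [z1|/ltW z1] := leP 0 (z - 1); rewrite ?(relu_pos z0) ?(relu_pos z1) ?(relu_neg z1);
  apply/andP; split; lra.
Qed.

Lemma clamp01_lip z w : `|clamp01 z - clamp01 w| <= `|z - w|.
Proof.
wlog zw : z w / z <= w.
  by move=> H; have [/H//|/ltW/H] := leP z w; rewrite distrC [leRHS]distrC.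
rewrite distrC [leRHS]distrC [leRHS]ger0_norm ?subr_ge0// /clamp01 ler_norml.
have A := relu_le zw; have B : relu (z - 1) <= relu (w - 1) by apply: relu_le; lra.
have C x y : x <= y -> relu y - relu x <= y - x.
  move=> xy; have [y0|/ltW y0] := leP 0 y; have [x0|/ltW x0] := leP 0 x;
    rewrite ?(relu_pos y0) ?(relu_pos x0) ?(relu_neg y0) ?(relu_neg x0); lra.
have D : relu (w - 1) - relu (z - 1) <= relu w - relu z.
  have [z0|/ltW z0] := leP 0 z.
    have [w0|] := leP 0 w; last by lra.
    rewrite (relu_pos z0) (relu_pos w0); have := @C (z - 1) (w - 1); lra.
  rewrite (relu_neg z0) (@relu_neg _ (z - 1)); last by lra.
  have [w0|/ltW w0] := leP 0 w; last by rewrite !relu_neg; lra.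
  rewrite (relu_pos w0); have [w1|/ltW w1] := leP 0 (w - 1).
    by rewrite (relu_pos w1); lra.
  by rewrite (relu_neg w1); lra.
by have := C z w zw; apply: (fun H => introT andP (conj _ _)); lra.
Qed.

(* [x y = ((x + y) / 2)^2 - (|x - y| / 2)^2] *)
Lemma horner_step_netE m d x y p1 p2 p3 p4 :
  0 <= x <= 1 -> 0 <= y <= 1 -> 0 <= p1 -> 0 <= p2 -> 0 <= p3 -> 0 <= p4 ->
  exists y', [/\ 0 <= y' <= 1,
    relu_eval (horner_step_net m d) [:: x; y; p1; p2; p3; p4] = [:: x; y'; p1; p2; p3; p4] &
    `|y' - clamp01 (d + x * y)| <= 4^-1 ^+ m].
Proof.
move=> /andP[x0 x1] /andP[y0 y1] p10 p20 p30 p40.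
pose a := (x + y) / 2; pose b := (relu (x - y) + relu (y - x)) / 2.
have bE : b = `|x - y| / 2.
  rewrite /b; have [H|/ltW H] := leP 0 (x - y).
    by rewrite relu_pos// relu_neg ?ger0_norm//; lra.
  by rewrite relu_neg// relu_pos ?ler0_norm//; lra.
have a01 : 0 <= a <= 1 by rewrite /a; apply/andP; split; lra.
have b01 : 0 <= b <= 1.
  by rewrite bE divr_ge0//= ler_pdivrMr// ler_norml; apply/andP; split; lra.
have /andP[a0 _] := a01; have /andP[b0 _] := b01.
have sq2 z : z = z ^+ 2 + 4^-1 ^+ 0 * (z * (1 - z)) by ring.
have P z : 0 <= z -> relu z = z by exact: relu_pos.
have [a' [b' [a'01 b'01 E]]] := @tent_netE 0 m x a b (a ^+ 2) (b ^+ 2) p1 p2 p3 p4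
  x0 a01 b01 (sqr_ge0 _) (sqr_ge0 _) p10 p20 p30 p40.
rewrite -(sq2 a) -(sq2 b) add0n in E.
pose q z := 4^-1 ^+ m * (z * (1 - z)) : R.
pose z := d + (a ^+ 2 + q a') - (b ^+ 2 + q b').
exists (clamp01 z); split; first exact: clamp01_bound.
  rewrite /horner_step_net !relu_eval_cat mult_in1E mult_in2E.
  rewrite !(P _ (relu_ge0 _)) (P _ x0) (P _ p10) (P _ p20) (P _ p30) (P _ p40).
  rewrite -/a -/b (P _ a0) (P _ b0) E.
  rewrite mult_out1E mult_out2E !(P _ (relu_ge0 _)).
  rewrite !(P _ x0, P _ p10, P _ p20, P _ p30, P _ p40).
  rewrite -/(q a') -/(q b') -/z -/(clamp01 z) P//.
  by have /andP[] := clamp01_bound z.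
apply: le_trans (clamp01_lip _ _) _.
have -> : z - (d + x * y) = q a' - q b'.
  have b2 : b ^+ 2 = (x - y) ^+ 2 / 4.
    by rewrite bE expr_div_n real_normK ?num_real//; congr (_ / _); ring.
  by rewrite /z b2 /a; field.
have pow0 : 0 <= 4^-1 ^+ m :> R by rewrite exprn_ge0.
have q01 t : 0 <= t <= 1 -> 0 <= q t <= 4^-1 ^+ m.
  move=> /andP[? ?]; rewrite /q mulr_ge0 ?mulr_ge0 ?subr_ge0//= ler_piMr//.
  by nra.
have /andP[? ?] := q01 _ a'01; have /andP[? ?] := q01 _ b'01.
by rewrite ler_norml; apply/andP; split; lra.
Qed.

Fixpoint horner_net m (s : seq R) : network R :=
  if s is d :: s' then horner_net m s' ++ horner_step_net m d else [::].

Lemma horner_net_wf m s :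
  [/\ relu_wf 6 (horner_net m s) 6, narrow 11 (horner_net m s) &
      size (horner_net m s) = (size s * (m + 4))%N].
Proof.
elim: s => [//|d s [IH1 IH2 IH3]] /=; have [H1 H2 H3] := horner_step_net_wf m d.
split; first exact: relu_wf_cat IH1 H1.
- by rewrite /narrow all_cat; apply/andP.
- by rewrite size_cat IH3 H3 mulSn addnC.
Qed.

Lemma horner_rec_bound s x : 0 <= x <= 1 -> all (fun c => 0 <= c) s ->
  0 <= horner_rec s x <= horner_rec s 1.
Proof.
move=> /andP[x0 x1]; elim: s => [|c s IH] /=; first by rewrite lexx.
move=> /andP[c0 /IH/andP[h0 h1]]; rewrite addr_ge0 ?mulr_ge0//= lerD2r mulr1.
by apply: le_trans h1; rewrite ler_piMr.
Qed.

(** Errors add instead of compounding: a Horner step does not expand distances in [y], since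
    [x <= 1] and the clamp is 1-Lipschitz. The exact partial values lie in [[0, 1]], where the clamp
    is the identity. *)
Lemma horner_netE m s x p1 p2 p3 p4 :
  0 <= x <= 1 -> 0 <= p1 -> 0 <= p2 -> 0 <= p3 -> 0 <= p4 ->
  all (fun c => 0 <= c) s -> horner_rec s 1 <= 1 ->
  exists y, [/\ 0 <= y <= 1,
    relu_eval (horner_net m s) [:: x; 0; p1; p2; p3; p4] = [:: x; y; p1; p2; p3; p4] &
    `|y - horner_rec s x| <= (size s)%:R * 4^-1 ^+ m].
Proof.
move=> x01 p10 p20 p30 p40; have /andP[x0 x1] := x01.
elim: s => [_ _|c s IH /= /andP[c0 s0] s1].
  by exists 0; rewrite lexx ler01 subrr normr0 mul0r.
have s01 : 0 <= (1 : R) <= 1 by apply/andP; split; [exact: ler01|exact: lexx].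
have /andP[g0 g1] := horner_rec_bound s01 s0.
have [|y [y01 Ey yE]] := IH s0; first by move: s1; rewrite mulr1; lra.
have [y' [y'01 Ey' y'E]] := @horner_step_netE m c x y p1 p2 p3 p4 x01 y01 p10 p20 p30 p40.
exists y'; split => //; first by rewrite relu_eval_cat Ey.
have /andP[h0 h1] := horner_rec_bound x01 s0.
have t01 : 0 <= horner_rec s x * x + c <= 1.
  by rewrite mulr1 in s1; apply/andP; split; nra.
have L : `|clamp01 (c + x * y) - (horner_rec s x * x + c)| <= `|y - horner_rec s x|.
  rewrite -[X in `|_ - X|](clamp01_id t01); apply: le_trans (clamp01_lip _ _) _.
  rewrite (_ : _ - _ = x * (y - horner_rec s x)); last by ring.
  by rewrite normrM (ger0_norm x0) ler_piMl.
have := ler_distD (clamp01 (c + x * y)) y' (horner_rec s x * x + c).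
rewrite -natr1; lra.
Qed.

End Multiplication.

Section Approximants.
Context {R : realType}.
Implicit Types (b t x z y K : R) (f w : R -> R) (n m : nat).

Lemma pi_le4 : @pi R <= 4.
Proof.
rewrite leNgt; apply/negP => p4; have := @cos2_lt0 R; apply/negP; rewrite -leNgt ltW//.
by apply: cos_gt0_pihalf; apply/andP; split; lra.
Qed.

(* Halving keeps all Horner values in [0, 1], where the multiplication network works. *)
Lemma half_approximant b F f n : 0 < b -> monotone_class b F -> F f -> f b <= 2 ->
  exists s : seq R, [/\ (size s <= n)%N, all (fun c => 0 <= c) s, horner_rec s 1 <= 1 &
    forall t, 0 <= t <= 4 / 5 -> `|2 * horner_rec s t - f (b * t)| <= 2 * (4 / 5) ^+ n].
Proof.
move=> b0 FF Ff fb; have [p [sp p0 Hp]] := bernstein n (ltW b0) FF Ff.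
pose q := \poly_(i < n) (p`_i * b ^+ i / 2).
have qE t : q.[t] = p.[b * t] / 2.
  rewrite horner_poly (horner_coef_wide _ sp) mulr_suml; apply: eq_bigr => i _.
  by rewrite exprMn; ring.
have bb : 0 <= b <= b by rewrite (ltW b0) lexx.
exists (polyseq q); split.
- exact: size_poly.
- apply/(all_nthP 0) => i _; rewrite coef_poly; case: ifP => // _.
  by rewrite divr_ge0// mulr_ge0// exprn_ge0// ltW.
- rewrite -/(horner q 1) qE mulr1.
  have [|+ _] := Hp b 1 bb; first by rewrite ler01 lexx.
  by lra.
- move=> t /andP[t0 t1]; rewrite -/(horner q t) qE.
  have t01 : 0 <= t <= 1 by rewrite t0/=; lra.
  have [A B] := Hp b t bb t01.
  have [||C _] := Hp (b * t) 1.
  - by rewrite mulr_ge0 ?(ltW b0)//= ler_piMr ?(ltW b0)//; lra.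
  - by rewrite ler01 lexx.
  have pb : 0 <= p.[b].
    by rewrite (horner_coef_wide _ sp) sumr_ge0// => i _; rewrite mulr_ge0// exprn_ge0// ltW.
  have tn : t ^+ n <= (4 / 5) ^+ n by apply: lerXn2r => //; rewrite nnegrE; lra.
  have E : t ^+ n * (f b - p.[b]) <= (4 / 5) ^+ n * 2.
    by apply: ler_pM => //; [rewrite exprn_ge0|lra].
  rewrite (mulrC t b) in B.
  by rewrite ler_norml; apply/andP; split; lra.
Qed.

Lemma half_asin n : exists s : seq R,
  [/\ (size s <= n)%N, all (fun c => 0 <= c) s, horner_rec s 1 <= 1 &
    forall t, 0 <= t <= 4 / 5 ->
      `|2 * horner_rec s t - asin (9 / 10 * t)| <= 2 * (4 / 5) ^+ n].
Proof.
have [F [FF Fa]] := @asin_class R; apply: half_approximant FF Fa _; first by lra.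
have : asin (9 / 10 : R) <= pi / 2 by apply: asin_lepi2; apply/andP; split; lra.
by have := pi_le4; lra.
Qed.

Lemma half_winv T w n : pi < T -> (forall z, zmap T (w z) = z) -> exists s : seq R,
  [/\ (size s <= n)%N, all (fun c => 0 <= c) s, horner_rec s 1 <= 1 &
    forall t, 0 <= t <= 4 / 5 ->
      `|2 * horner_rec s t - w (5 / 4 * pi * t)| <= 2 * (4 / 5) ^+ n].
Proof.
move=> Tpi wP; have [F [FF Fw]] := winv_class Tpi wP; have p0 := @pi_gt0 R.
apply: half_approximant FF Fw _; first by lra.
have : 0 <= 5 / 4 * @pi R <= 5 / 4 * pi by apply/andP; split; lra.
by move=> /(winv_bound Tpi wP)/andP[_]; have := pi_le4; lra.
Qed.

(** [n <= 2 ^ n <= (16 / 5) ^ n]: with [n] tent layers per product, the rounding of [n] Horner steps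
    stays below the rate of the polynomial error. *)
Lemma mul_pow4 n : n%:R * 4^-1 ^+ n <= (4 / 5) ^+ n :> R.
Proof.
rewrite (_ : 4 / 5 = (16 / 5) * 4^-1 :> R); last by field.
rewrite exprMn ler_wpM2r ?exprn_ge0//.
have : (n <= 2 ^ n)%N by rewrite ltnW// ltn_expl.
rewrite -(ler_nat R) natrX => /le_trans; apply.
by apply: lerXn2r; rewrite ?nnegrE; lra.
Qed.

Lemma horner_net_close n (s : seq R) x y (v : R) : (size s <= n)%N ->
  `|y - horner_rec s x| <= (size s)%:R * 4^-1 ^+ n ->
  `|2 * horner_rec s x - v| <= 2 * (4 / 5) ^+ n -> `|2 * y - v| <= 4 * (4 / 5) ^+ n.
Proof.
move=> sn A B; have C : (size s)%:R * 4^-1 ^+ n <= n%:R * 4^-1 ^+ n :> R.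
  by rewrite ler_wpM2r ?exprn_ge0// ler_nat.
have D := mul_pow4 n.
rewrite (_ : 2 * y - v = 2 * (y - horner_rec s x) + (2 * horner_rec s x - v)); last by ring.
apply: le_trans (ler_normD _ _) _; rewrite normrM ger0_norm//; lra.
Qed.

(* After these two layers: [z] clamped to [0, pi] and rescaled, a null accumulator,
   the clamped [z], and its excess over [pi], which kills the output beyond [pi]. *)
Definition trunk_in1 : layer R := rows [:: ([:: 1], 0); ([:: 1], - pi)].
Definition trunk_in2 : layer R := rows [::
  ([:: (5 / 4 * pi)^-1; - (5 / 4 * pi)^-1], 0); ([:: 0; 0], 0);
  ([:: 1; -1], 0); ([:: 0; 1], 0); ([:: 0; 0], 0); ([:: 0; 0], 0)].
Definition trunk_out1 T K : layer R := rows [:: ([:: 0; - (2 / T); T^-1; - K; 0; 0], 0)].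
Definition trunk_out2 : layer R := rows (nseq 4 ([:: 1], 0)).

Lemma trunk_in1E z : relu_eval [:: trunk_in1] [:: z] = [:: relu z; relu (z - pi)].
Proof. by eval_layer. Qed.

Lemma trunk_in2E x y : relu_eval [:: trunk_in2] [:: x; y] =
  [:: relu ((x - y) / (5 / 4 * pi)); relu 0; relu (x - y); relu y; relu 0; relu 0].
Proof. by eval_layer. Qed.

Lemma trunk_out1E T K x y c e p3 p4 :
  relu_eval [:: trunk_out1 T K] [:: x; y; c; e; p3; p4] = [:: relu ((c - 2 * y) / T - K * e)].
Proof. by eval_layer. Qed.

Lemma trunk_out2E x : affine trunk_out2 [:: x] = nseq 4 x.
Proof. by eval_layer. Qed.

Lemma trunk_exists T w K n : pi < T -> (forall z, zmap T (w z) = z) -> 0 < K ->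
  exists N (tau : R -> R), [/\ nn_wf 1 N 4, (nn_width N <= 11)%N,
    (nn_depth N <= n * (n + 4) + 7)%N, forall z, nn_eval N [:: z] = nseq 4 (tau z) &
    [/\ forall z, 0 <= tau z <= 1, forall z, z <= 0 -> tau z = 0,
      forall z, 1 <= K * (z - pi) -> tau z = 0 &
      forall z, 0 <= z <= pi -> `|tau z - (z - w z) / T| <= 4 * (4 / 5) ^+ n]].
Proof.
move=> Tpi wP K0; have [s [sn s0 s1 sw]] := half_winv n Tpi wP.
have p0 := @pi_gt0 R; have p2 := @pi_ge2 R; have p4 := pi_le4.
have T0 : 0 < T by lra.
pose M := [:: trunk_in1] ++ [:: trunk_in2] ++ horner_net n s ++ [:: trunk_out1 T K].
pose N := rcons M trunk_out2.
have [w1 w2 w3] := horner_net_wf n s.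
have c0 z : 0 <= relu z - relu (z - pi) <= pi.
  have [zp|/ltW zp] := leP 0 (z - pi); first by rewrite !relu_pos; lra.
  rewrite (relu_neg zp) subr0; have [z0|/ltW z0] := leP 0 z.
    by rewrite relu_pos//; lra.
  by rewrite relu_neg//; lra.
have R00 : relu 0 = 0 :> R by rewrite relu_pos.
have H z : exists y, [/\ 0 <= y <= 1, nn_eval N [:: z] = nseq 4
      (relu ((relu z - relu (z - pi) - 2 * y) / T - K * relu (z - pi))) &
    `|y - horner_rec s ((relu z - relu (z - pi)) / (5 / 4 * pi))| <= (size s)%:R * 4^-1 ^+ n].
  have /andP[cz0 cz1] := c0 z; set c := relu z - relu (z - pi) in cz0 cz1 *.
  have x0 : 0 <= c / (5 / 4 * pi) by rewrite divr_ge0//; lra.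
  have x01 : 0 <= c / (5 / 4 * pi) <= 1 by rewrite x0/= ler_pdivrMr; lra.
  have [y [y01 Ey yE]] := horner_netE n x01 cz0 (relu_ge0 (z - pi)) (lexx 0) (lexx 0) s0 s1.
  exists y; split => //.
  rewrite nn_eval_rcons !relu_eval_cat trunk_in1E trunk_in2E R00 -/c.
  by rewrite (relu_pos x0) (relu_pos cz0) (relu_pos (relu_ge0 _)) Ey trunk_out1E trunk_out2E.
exists N, (fun z => head 0 (nn_eval N [:: z])); split.
- apply: (@nn_wf_rcons _ _ 1) => //; apply: (@relu_wf_cat _ _ 2) => //.
  apply: (@relu_wf_cat _ _ 6) => //; exact: relu_wf_cat w1 _.
- by apply: nn_width_rcons; rewrite /M /narrow !all_cat/= !andbT; exact: w2.
- rewrite nn_depth_rcons /M !size_cat/= w3.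
  have := leq_mul sn (leqnn (n + 4)); rewrite -(leq_add2r 7); apply: leq_trans.
  by rewrite !addnS !addn0 !ltnS; do 4!apply: leqW.
- by move=> z; have [y [_ -> _]] := H z.
have E0 z : 0 <= relu (z - pi) by exact: relu_ge0.
split=> z.
- have [y [/andP[y0 y1] -> _]] := H z; rewrite relu_ge0/=.
  have /andP[_ cz1] := c0 z; move: (E0 z) cz1; move: (relu (z - pi)) => e e0.
  move: (relu z - e) => c cp; rewrite /relu ge_max ler01 andbT.
  have A : (c - 2 * y) / T <= 1 by rewrite ler_pdivrMr//; lra.
  by have B : 0 <= K * e; [rewrite mulr_ge0// ltW|lra].
- move=> z0; have [y [/andP[y0 y1] -> _]] := H z.
  rewrite /= !(@relu_neg _ z, @relu_neg _ (z - pi)) ?subrr; try lra.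
  by rewrite mulr0 subr0 add0r relu_neg// pmulr_lle0 ?invr_gt0//; lra.
- move=> z1; have [y [/andP[y0 y1] -> _]] := H z.
  have zp : 0 <= z - pi by rewrite -(pmulr_rge0 _ K0); lra.
  have z0 : 0 <= z by lra.
  rewrite /= (relu_pos zp) (relu_pos z0).
  rewrite relu_neg// subr_le0; apply: le_trans z1; rewrite ler_pdivrMr//; lra.
- move=> /andP[z0 zp]; have [y [/andP[y0 y1] -> yE]] := H z.
  have zp' : z - pi <= 0 by lra.
  move: yE; rewrite /= (relu_neg zp') (relu_pos z0) !subr0 mulr0 subr0 => yE.
  have W0 := winv0 Tpi wP.
  have /andP[_ wz] := winv_lip (ltW T0) wP z0; rewrite W0 !subr0 in wz.
  have q0 : 0 <= (z - w z) / T by rewrite divr_ge0 ?(ltW T0)// subr_ge0.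
  rewrite -[X in _ - X](relu_pos q0); apply: le_trans (relu_lip _ _) _.
  have /sw/(horner_net_close sn yE) : 0 <= z / (5 / 4 * pi) <= 4 / 5.
    apply/andP; split; first by rewrite divr_ge0//; lra.
    by rewrite ler_pdivrMr; lra.
  rewrite (_ : 5 / 4 * pi * (z / (5 / 4 * pi)) = z); last first.
    by rewrite mulrC divfK// gt_eqF//; lra.
  apply: le_trans; rewrite -mulrBl normrM (gtr0_norm (x := T^-1)) ?invr_gt0//.
  rewrite (_ : z - 2 * y - (z - w z) = - (2 * y - w z)); last by ring.
  rewrite normrN ler_pdivrMr// ler_peMr//; lra.
Qed.
End Approximants.

(** * Recovering an angle from its sine and cosine *)

Section ShiftNet.
Context {R : realType}.
Implicit Types (b t x y z v K xi phi : R) (n m : nat).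

(* [z] with the sign of [v], as soon as [0 <= z <= K |v|]. *)
Definition signed K z v := relu (z - K * relu (- v)) - relu (z - K * relu v).

Lemma signed_lip K z z' v d : `|z - z'| <= d -> `|signed K z v - signed K z' v| <= 2 * d.
Proof.
move=> zd; rewrite /signed.
have A c : `|relu (z - c) - relu (z' - c)| <= d.
  apply: le_trans (relu_lip _ _) _; rewrite (_ : _ - _ = z - z')//; ring.
move: (A (K * relu (- v))) (A (K * relu v)); rewrite !ler_norml.
by move=> /andP[? ?] /andP[? ?]; apply/andP; split; lra.
Qed.

Lemma signed_pos K z v : 0 <= v -> 0 <= z <= K * v -> signed K z v = z.
Proof.
move=> v0 /andP[z0 zv]; rewrite /signed (relu_pos v0) (@relu_neg _ (- v)) ?oppr_le0//.
by rewrite mulr0 subr0 (relu_pos z0) (@relu_neg _ (_ - _)) ?subr0 ?subr_le0.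
Qed.

Lemma signed_neg K z v : v <= 0 -> 0 <= z <= K * - v -> signed K z v = - z.
Proof.
move=> v0 /andP[z0 zv]; rewrite /signed (relu_neg v0) (@relu_pos _ (- v)) ?oppr_ge0//.
by rewrite mulr0 subr0 (relu_pos z0) (@relu_neg _ (_ - _)) ?sub0r ?subr_le0.
Qed.

(* A point of the circle from its sine [s] and cosine [c], given the angle [a]
   between the line through it and the nearest bisector of the axes. *)
Definition recover_angle K s c a :=
  pi - signed K (pi / 2 + signed 2 (pi / 4 - signed 2 a (`|s| - `|c|)) c) s.

Lemma recover_angle_lip K s c a a' (d : R) :
  `|a - a'| <= d -> `|recover_angle K s c a - recover_angle K s c a'| <= 8 * d.
Proof.
move=> ad; rewrite /recover_angle.
pose h x := signed 2 x (`|s| - `|c|); pose k x := signed 2 (pi / 4 - h x) c.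
pose l x := signed K (pi / 2 + k x) s; rewrite -/(h a) -/(h a') -/(k a) -/(k a') -/(l a) -/(l a').
have hh : `|h a - h a'| <= 2 * d by exact: signed_lip.
have kk : `|k a - k a'| <= 2 * (2 * d).
  by apply: signed_lip; rewrite distrC (_ : _ - _ = h a - h a')//; ring.
have ll : `|l a - l a'| <= 2 * (2 * (2 * d)).
  by apply: signed_lip; rewrite (_ : _ - _ = k a - k a')//; ring.
rewrite distrC (_ : pi - l a' - (pi - l a) = l a - l a'); last by ring.
by apply: le_trans ll _; lra.
Qed.

Lemma cos_pi4 : cos (pi / 4) = sin (pi / 4) :> R.
Proof.
by rewrite -cosBpihalf -[LHS]cosN; congr cos; field.
Qed.

Lemma sin_pi4_sqr : sin (pi / 4) ^+ 2 = 2^-1 :> R.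
Proof.
have := cos2Dsin2 (pi / 4 : R); rewrite cos_pi4; lra.
Qed.

(** [18 / 25] is 4/5 of [9 / 10]: the arguments of [asin] that occur lie where its polynomial
    converges. *)
Lemma sin_pi4_bound : 0 < sin (pi / 4 : R) <= 18 / 25.
Proof.
have p0 := @pi_gt0 R; have q0 : 0 < sin (pi / 4) :> R.
  by apply: sin_gt0_pi; apply/andP; split; lra.
rewrite q0/= -(@ler_pXn2r _ 2) ?nnegrE ?sin_pi4_sqr ?(ltW q0)//; lra.
Qed.

Lemma sin_sub_pi4 phi : sin (phi - pi / 4) = sin (pi / 4) * (sin phi - cos phi).
Proof. by rewrite sinB cos_pi4; ring. Qed.

Lemma sin_pihalf_sub phi : sin (pi / 2 - phi) = cos phi.
Proof. by rewrite addrC sinDpihalf cosN. Qed.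

Lemma sin_norm x : `|x| <= pi -> sin `|x| = `|sin x|.
Proof.
have [x0|/ltW x0] := leP 0 x; rewrite ?(ger0_norm x0) ?(ler0_norm x0) => xp.
  by rewrite ger0_norm// sin_ge0_pi// x0.
by rewrite -normrN -sinN ger0_norm// sin_ge0_pi// oppr_ge0 x0.
Qed.

Lemma sgr_sin x : `|x| < pi -> Num.sg (sin x) = Num.sg x.
Proof.
have [x0|x0|<-] := ltgtP 0 x; last by rewrite sin0.
  by rewrite (gtr0_norm x0) => xp; rewrite !gtr0_sg// sin_gt0_pi// x0.
rewrite (ltr0_norm x0) => xp; rewrite !ltr0_sg//.
by rewrite -oppr_gt0 -sinN sin_gt0_pi// oppr_gt0 x0.
Qed.

(** Measuring the angle from the bisector keeps the argument of [asin] below [sin (pi / 4)], away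
    from the singularity at 1. *)
Lemma asin_sub_pi4 phi : 0 <= phi <= pi / 2 ->
  asin (sin (pi / 4) * `|sin phi - cos phi|) = `|phi - pi / 4|.
Proof.
move=> /andP[? ?]; have /andP[q0 _] := sin_pi4_bound; have p0 := @pi_gt0 R.
have N : `|phi - pi / 4| <= pi / 4 by rewrite ler_norml; apply/andP; split; lra.
rewrite -{1}(gtr0_norm q0) -normrM -sin_sub_pi4 -sin_norm; last by lra.
by rewrite sinK// in_itv/=; have := normr_ge0 (phi - pi / 4); move=> ?; apply/andP; split; lra.
Qed.

Lemma fold_angle xi : 0 <= xi <= 2 * pi -> exists phi, 0 <= phi <= pi / 2 /\
  [\/ xi = phi, xi = pi - phi, xi = pi + phi | xi = 2 * pi - phi].
Proof.
move=> /andP[x0 x1].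
have [h1|h1] := leP xi (pi / 2); first by exists xi; rewrite x0 h1; split => //; constructor.
have [h2|h2] := leP xi pi.
  exists (pi - xi); split; [by apply/andP; split; lra|by constructor 2; ring].
have [h3|h3] := leP xi (pi + pi / 2).
  exists (xi - pi); split; [by apply/andP; split; lra|by constructor 3; ring].
by exists (2 * pi - xi); split; [apply/andP; split; lra|constructor 4; ring].
Qed.

(** From the inside out, the three signs undo the absolute value and two reflections. For the inner
    two, the quantity vanishes together with the number that gives its sign, and Jordan's inequality
    makes the slope 2 sufficient. The outermost one, up to [pi <= 4], does not vanish with [s];
    hence the large slope [K] and the condition [4 <= K * |s|]. *)
Lemma recover_angle_fold K s c phi : 0 <= phi <= pi / 2 ->
  `|s| = sin phi -> `|c| = cos phi -> 4 <= K * `|s| ->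
  recover_angle K s c `|phi - pi / 4| =
    pi - Num.sg s * (pi / 2 + Num.sg c * (pi / 2 - phi)).
Proof.
move=> /andP[f0 f1] sE cE Ks; have p0 := @pi_gt0 R; have p4 := @pi_le4 R.
have S K' z v : 0 <= z <= K' * `|v| -> signed K' z v = Num.sg v * z.
  have [v0|v0|<-] := ltgtP 0 v.
  - by rewrite gtr0_sg// mul1r (gtr0_norm v0) => /signed_pos->//; exact: ltW.
  - by rewrite ltr0_sg// mulN1r (ltr0_norm v0) => /signed_neg->//; exact: ltW.
  - by rewrite /signed oppr0 sgr0 mul0r subrr.
have /andP[q0 q1] := sin_pi4_bound.
have J x : 0 <= x <= pi / 2 -> 0 <= x <= 2 * sin x.
  move=> xb; have := jordan xb; have /andP[x0 _] := xb; rewrite x0/= => /le_trans; apply.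
  rewrite ler_wpM2r//; last by lra.
  by apply: sin_ge0_pi; apply/andP; split; lra.
have D : signed 2 `|phi - pi / 4| (`|s| - `|c|) = phi - pi / 4.
  have N : `|phi - pi / 4| <= pi / 4 by rewrite ler_norml; apply/andP; split; lra.
  have sD : sin (phi - pi / 4) = sin (pi / 4) * (`|s| - `|c|) by rewrite sE cE sin_sub_pi4.
  rewrite S.
    rewrite [RHS]numEsg -[in RHS]sgr_sin ?sD ?sgrM ?(gtr0_sg q0) ?mul1r//; lra.
  have /J : 0 <= `|phi - pi / 4| <= pi / 2 by rewrite normr_ge0/=; lra.
  rewrite sin_norm ?sD ?normrM ?(gtr0_norm q0); last by lra.
  move=> /andP[-> /le_trans]; apply; rewrite ler_wpM2l// ler_piMl//; lra.
rewrite /recover_angle D (_ : pi / 4 - _ = pi / 2 - phi); last by field.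
rewrite (S 2); last first.
  by rewrite cE -sin_pihalf_sub; apply: J; apply/andP; split; lra.
rewrite S//.
have : `|Num.sg c * (pi / 2 - phi)| <= pi / 2.
  rewrite normrM (@ger0_norm _ (_ - _)); last by lra.
  rewrite normr_sg; case: (c != 0); rewrite ?mul1r ?mul0r; lra.
by rewrite ler_norml => /andP[? ?]; apply/andP; split; lra.
Qed.

Lemma recover_angleE K xi : 0 <= xi <= 2 * pi -> 4 <= K * `|sin xi| ->
  exists phi, [/\ 0 <= phi <= pi / 2, `|sin xi| - `|cos xi| = sin phi - cos phi &
   recover_angle K (sin xi) (cos xi) `|phi - pi / 4| = xi].
Proof.
move=> xib Ks; have p0 := @pi_gt0 R; have [phi [fb xiE]] := fold_angle xib.
have /andP[f0 f1] := fb.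
have s0 : 0 <= sin phi by apply: sin_ge0_pi; apply/andP; split; lra.
have c0 : 0 <= cos phi by apply: cos_ge0_pihalf; apply/andP; split; lra.
have s1 : sin (pi - phi) = sin phi by rewrite addrC sinDpi sinN opprK.
have c1 : cos (pi - phi) = - cos phi by rewrite addrC cosDpi cosN.
have s2 : sin (pi + phi) = - sin phi by rewrite addrC sinDpi.
have c2 : cos (pi + phi) = - cos phi by rewrite addrC cosDpi.
have s3 : sin (2 * pi - phi) = - sin phi by rewrite addrC mulr_natl sinD2pi sinN.
have c3 : cos (2 * pi - phi) = cos phi by rewrite addrC mulr_natl cosD2pi cosN.
have [sE cE] : `|sin xi| = sin phi /\ `|cos xi| = cos phi.
  by case: xiE => ->; rewrite ?(s1, c1, s2, c2, s3, c3) ?normrN !ger0_norm.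
exists phi; split=> //; first by rewrite sE cE.
rewrite (recover_angle_fold fb sE cE Ks).
have sp : 0 < sin phi.
  by rewrite lt_neqAle s0 andbT eq_sym; apply/eqP => sp; move: Ks; rewrite sE sp; lra.
have [fp|fp] := ltP phi (pi / 2); last first.
  have -> : pi / 2 - phi = 0 by lra.
  have fE : phi = pi / 2 by lra.
  rewrite mulr0 addr0; case: xiE => ->;
    rewrite ?(s1, s2, s3) ?sgrN (gtr0_sg sp); lra.
have cp : 0 < cos phi by apply: cos_gt0_pihalf; rewrite fp andbT; lra.
by case: xiE => ->; rewrite ?(s1, c1, s2, c2, s3, c3) ?sgrN (gtr0_sg sp) (gtr0_sg cp); field.
Qed.

(* The absolute values and signs of [s = sin xi] and [c = cos xi] are carried as
   [relu s; relu (- s); relu c; relu (- c)]. *)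
Definition shift1 : layer R := rows [::
  ([:: 1; 0; 0], 0); ([:: -1; 0; 0], 0); ([:: 0; -1; 0], 0); ([:: 0; 1; 0], 0)].
Definition shift2 : layer R := rows [::
  ([:: 1; 1; -1; -1], 0); ([:: -1; -1; 1; 1], 0);
  (unit_row 4 0, 0); (unit_row 4 1, 0); (unit_row 4 2, 0); (unit_row 4 3, 0)].
Definition shift3 b : layer R := rows [::
  ([:: b; b; 0; 0; 0; 0], 0); ([:: 0; 0; 0; 0; 0; 0], 0);
  (unit_row 6 2, 0); (unit_row 6 3, 0); (unit_row 6 4, 0); (unit_row 6 5, 0)].
Definition shift4 : layer R := rows [::
  (unit_row 6 1, 0); ([:: 0; 0; 1; 1; -1; -1], 0); ([:: 0; 0; -1; -1; 1; 1], 0);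
  (unit_row 6 2, 0); (unit_row 6 3, 0); (unit_row 6 4, 0); (unit_row 6 5, 0)].
Definition shift5 : layer R := rows [::
  ([:: 2; 0; -2; 0; 0; 0; 0], 0); ([:: 2; -2; 0; 0; 0; 0; 0], 0);
  (unit_row 7 3, 0); (unit_row 7 4, 0); (unit_row 7 5, 0); (unit_row 7 6, 0)].
Definition shift6 : layer R := rows [::
  ([:: -1; 1; 0; 0; 0; -2], pi / 4); ([:: -1; 1; 0; 0; -2; 0], pi / 4);
  (unit_row 6 2, 0); (unit_row 6 3, 0)].
Definition shift7 K : layer R := rows [::
  ([:: 1; -1; 0; - K], pi / 2); ([:: 1; -1; - K; 0], pi / 2)].
Definition shift8 : layer R := rows [::
  ([:: 1; -1], - (2 * pi)); ([:: -1; 1], 2 * pi); ([:: 1; -1], 0); ([:: -1; 1], 0)].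

Lemma normr_relu x : `|x| = relu x + relu (- x).
Proof.
have [x0|/ltW x0] := leP 0 x.
  by rewrite ger0_norm// (relu_pos x0) relu_neg ?addr0 ?oppr_le0.
by rewrite ler0_norm// (relu_neg x0) relu_pos ?add0r ?oppr_ge0.
Qed.

Lemma reluK x : relu (relu x) = relu x.
Proof. by rewrite relu_pos// relu_ge0. Qed.

Lemma shift123E b (s c e : R) : relu_eval [:: shift1; shift2; shift3 b] [:: s; - c; e] =
  [:: relu (b * `| `|s| - `|c| |); 0; relu s; relu (- s); relu c; relu (- c)].
Proof.
have E1 : relu_eval [:: shift1] [:: s; - c; e] = [:: relu s; relu (- s); relu c; relu (- c)].
  by eval_layer.
have E2 x y z t : relu_eval [:: shift2] [:: x; y; z; t] = [:: relu (x + y - (z + t));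
    relu (- (x + y - (z + t))); relu x; relu y; relu z; relu t] by eval_layer.
have E3 x y z t u v : relu_eval [:: shift3 b] [:: x; y; z; t; u; v] =
    [:: relu (b * (x + y)); relu 0; relu z; relu t; relu u; relu v] by eval_layer.
rewrite -[[:: _; _; _]]/([:: shift1] ++ [:: shift2] ++ [:: shift3 b]) !relu_eval_cat E1 E2 E3.
by rewrite !reluK -!normr_relu (relu_pos (lexx 0)).
Qed.

Lemma shift4567E K x y (s c : R) :
  relu_eval [:: shift4; shift5; shift6; shift7 K]
    [:: x; y; relu s; relu (- s); relu c; relu (- c)] =
  let e := pi / 2 + signed 2 (pi / 4 - signed 2 (2 * relu y) (`|s| - `|c|)) c in
  [:: relu (e - K * relu (- s)); relu (e - K * relu s)].
Proof.
have E4 z t u v : relu_eval [:: shift4] [:: x; y; z; t; u; v] = [:: relu y;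
    relu (z + t - (u + v)); relu (- (z + t - (u + v))); relu z; relu t; relu u; relu v]
  by eval_layer.
have E5 x1 x2 x3 x4 x5 x6 x7 : relu_eval [:: shift5] [:: x1; x2; x3; x4; x5; x6; x7] =
    [:: relu (2 * x1 - 2 * x3); relu (2 * x1 - 2 * x2); relu x4; relu x5; relu x6; relu x7]
  by eval_layer.
have E6 x1 x2 x3 x4 x5 x6 : relu_eval [:: shift6] [:: x1; x2; x3; x4; x5; x6] =
    [:: relu (pi / 4 - (x1 - x2) - 2 * x6); relu (pi / 4 - (x1 - x2) - 2 * x5); relu x3; relu x4]
  by eval_layer.
have E7 x1 x2 x3 x4 : relu_eval [:: shift7 K] [:: x1; x2; x3; x4] =
    [:: relu (pi / 2 + (x1 - x2) - K * x4); relu (pi / 2 + (x1 - x2) - K * x3)]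
  by eval_layer.
rewrite -[[:: _; _; _; _]]/([:: shift4] ++ [:: shift5] ++ [:: shift6] ++ [:: shift7 K]).
by rewrite !relu_eval_cat E4 E5 E6 E7 !reluK -!normr_relu.
Qed.

Lemma shift8E u v : affine shift8 [:: u; v] =
  let x := pi - (u - v) in [:: - x - pi; x + pi; pi - x; x - pi].
Proof. by eval_layer. Qed.

(** Combined with the scales 1, -1, 1, -1, the four outputs give the arguments [y - x - pi] and
    [y - x + pi] and their opposites. The factor 8 is the Lipschitz constant of three nested
    [signed]. *)
Lemma shift_exists K n : exists N, [/\ nn_wf 3 N 4, (nn_width N <= 11)%N,
    (nn_depth N <= n * (n + 4) + 7)%N &
    forall xi e, 0 <= xi <= 2 * pi -> 4 <= K * `|sin xi| ->
      exists2 x, nn_eval N [:: sin xi; - cos xi; e] = [:: - x - pi; x + pi; pi - x; x - pi] &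
        `|x - xi| <= 8 * (4 * (4 / 5) ^+ n)].
Proof.
have [s [sn s0 s1 sa]] := half_asin (R := R) n; have p0 := @pi_gt0 R.
have /andP[q0 q1] := sin_pi4_bound.
pose b : R := sin (pi / 4) / (9 / 10).
pose M := [:: shift1; shift2; shift3 b] ++ horner_net n s ++ [:: shift4; shift5; shift6; shift7 K].
pose N := rcons M shift8.
have [w1 w2 w3] := horner_net_wf n s.
exists N; split.
- apply: (@nn_wf_rcons _ _ 2) => //; apply: (@relu_wf_cat _ _ 6) => //.
  exact: relu_wf_cat w1 _.
- by apply: nn_width_rcons; rewrite /M /narrow !all_cat/= !andbT; exact: w2.
- rewrite nn_depth_rcons /M !size_cat/= w3.
  have := leq_mul sn (leqnn (n + 4)); rewrite -(leq_add2r 7); apply: leq_trans.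
  by rewrite !addnS !addn0.
move=> xi e xib Ks; have [phi [fb DE rE]] := recover_angleE xib Ks.
have x0 : 0 <= b * `| `|sin xi| - `|cos xi| | by rewrite mulr_ge0// divr_ge0//; lra.
have D1 : `| `|sin xi| - `|cos xi| | <= 1.
  have := sin_max xi; have := cos_max xi; have := normr_ge0 (sin xi); have := normr_ge0 (cos xi).
  by move=> ? ? ? ?; rewrite ler_norml; apply/andP; split; lra.
have xb : 0 <= b * `| `|sin xi| - `|cos xi| | <= 4 / 5.
  rewrite x0/=; apply: (@le_trans _ _ b); last by rewrite /b; lra.
  by rewrite ler_piMr// /b; lra.
have x01 : 0 <= b * `| `|sin xi| - `|cos xi| | <= 1 by case/andP: xb => [-> ?] /=; lra.
have [y [/andP[y0 y1] Ey yE]] := horner_netE n x01 (relu_ge0 (sin xi)) (relu_ge0 (- sin xi))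
  (relu_ge0 (cos xi)) (relu_ge0 (- cos xi)) s0 s1.
have E : asin (9 / 10 * (b * `| `|sin xi| - `|cos xi| |)) = `|phi - pi / 4|.
  by rewrite -asin_sub_pi4// -DE mulrA /b; congr (asin (_ * _)); field.
have := horner_net_close sn yE (sa _ xb); rewrite E => /(recover_angle_lip K (sin xi) (cos xi)).
rewrite rE; move=> close; exists (recover_angle K (sin xi) (cos xi) (2 * y)) => //.
by rewrite nn_eval_rcons !relu_eval_cat shift123E (relu_pos x0) Ey shift4567E (relu_pos y0) shift8E.
Qed.

End ShiftNet.

(** * Error estimate *)

Section ErrorIntegrals.
Context {R : realType}.
Implicit Types (a b c r x y L : R).
Local Notation mu := (@lebesgue_measure R).

(* No measurability is required: the integral of a nonnegative function is a
   supremum over the simple functions below it. *)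
Lemma integral_mono (D : set R) (f g : R -> \bar R) :
  (forall x, D x -> (0 <= f x)%E) -> (forall x, D x -> (f x <= g x)%E) ->
  (\int[mu]_(x in D) f x <= \int[mu]_(x in D) g x)%E.
Proof.
move=> f0 fg; have g0 x : D x -> (0 <= g x)%E by move=> Dx; exact: le_trans (f0 x Dx) (fg x Dx).
rewrite !ge0_integralE//; apply: ereal_sup_le => _ [h hf <-]; exists h => //= x.
apply: le_trans (hf x) _.
by rewrite /patch; case: ifPn => // /set_mem; exact: fg.
Qed.

Lemma integral_box_le L c r : 0 <= r ->
  (\int[mu]_(x in `[0%R, L]) (\1_(`[c - r, c + r]%classic) x)%:E <= (2 * r)%:E)%E.
Proof.
move=> r0; rewrite integral_indic//.
apply: (@le_trans _ _ (mu `[c - r, c + r]%classic)).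
  by apply: le_measure; rewrite ?inE//; exact: measurableI.
by rewrite itv_measure ?lee_fin; lra.
Qed.

(** Serves for the integral in [x], with boxes at the shock and its translates, and for the one in
    [xi], with boxes at the multiples of [pi]. The null summand [g] stands for the distance of the
    solution to the profile, which are equal only almost everywhere. *)
Lemma integral_majorant L (g : R -> R) a b r c1 c2 c3 :
  0 <= L -> 0 <= a -> 0 <= b -> 0 <= r -> (forall x, 0 <= g x) ->
  measurable_fun `[0, L]%classic g -> (\int[mu]_(x in `[0%R, L]) (g x)%:E = 0)%E ->
  (\int[mu]_(x in `[0%R, L]) (g x + (a + b * (\1_(`[c1 - r, c1 + r]%classic) x +
     (\1_(`[c2 - r, c2 + r]%classic) x + \1_(`[c3 - r, c3 + r]%classic) x))))%:E <=
   (a * L + 6 * b * r)%:E)%E.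
Proof.
move=> L0 a0 b0 r0 g0 mg g1.
have mI c : measurable_fun `[0, L]%classic (\1_(`[c - r, c + r]%classic) : R -> R).
  by apply: measurable_indic.
have iI c x : 0 <= (\1_(`[c - r, c + r]%classic) x : R) by [].
under eq_integral do rewrite EFinD.
rewrite ge0_integralD//=; first last.
- by apply/measurable_EFinP; apply: measurable_funD => //; apply: measurable_funM => //;
    apply: measurable_funD => //; apply: measurable_funD.
- by move=> x _; rewrite lee_fin addr_ge0// mulr_ge0// !addr_ge0.
- exact/measurable_EFinP.
- by move=> x _; rewrite lee_fin.
rewrite g1 add0e; under eq_integral do rewrite EFinD.
rewrite ge0_integralD//=; first last.
- by apply/measurable_EFinP; apply: measurable_funM => //;
    apply: measurable_funD => //; apply: measurable_funD.
- by move=> x _; rewrite lee_fin mulr_ge0// !addr_ge0.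
have -> : (\int[mu]_(x in `[0%R, L]) a%:E = (a * L)%:E)%E.
  have -> : (a * L)%:E = (a%:E * mu `[0%R, L]%classic)%E by rewrite itv_measure// subr0.
  exact: integral_cst.
rewrite EFinD; apply: leeD2l.
under eq_integral do rewrite EFinM.
rewrite ge0_integralZl//=; first last.
- by apply/measurable_EFinP; apply: measurable_funD => //; apply: measurable_funD.
rewrite (_ : 6 * b * r = b * (2 * r + (2 * r + 2 * r))); last by ring.
rewrite EFinM; apply: lee_wpmul2l => //.
under eq_integral do rewrite EFinD.
rewrite ge0_integralD//=; first last.
- by apply/measurable_EFinP; apply: measurable_funD.
- exact/measurable_EFinP.
rewrite EFinD; apply: leeD; first exact: integral_box_le.
under eq_integral do rewrite EFinD.
rewrite ge0_integralD//=; first last.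
- exact/measurable_EFinP.
- exact/measurable_EFinP.
by rewrite EFinD; apply: leeD; exact: integral_box_le.
Qed.

End ErrorIntegrals.

Section WaveError.
Context {R : realType}.
Implicit Types (x y z xi d : R).
Variables (T : R) (w tau : R -> R) (K e1 : R).
Hypothesis Tpi : pi < T.
Hypothesis wP : forall z, zmap T (w z) = z.
Hypothesis K0 : 0 < K.
Hypothesis tau_neg : forall z, z <= 0 -> tau z = 0.
Hypothesis tau_far : forall z, 1 <= K * (z - pi) -> tau z = 0.
Hypothesis tau_close : forall z, 0 <= z <= pi -> `|tau z - (z - w z) / T| <= e1.

Let odd_tau z := tau z - tau (- z).

Lemma odd_tauN z : odd_tau (- z) = - odd_tau z.
Proof. by rewrite /odd_tau opprK opprB. Qed.

Lemma winv_odd z : w (- z) = - w z.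
Proof. by have TT := Tpi; have p0 := @pi_gt0 R; have T0 : 0 <= T; [lra|exact: (winvN _ T0 wP)]. Qed.

Lemma odd_tau_close z : `|z| <= pi -> `|odd_tau z - sin (w z)| <= e1.
Proof.
have p0 := @pi_gt0 R; have TT := Tpi; wlog z0 : z / 0 <= z.
  move=> H; have [/H//|/ltW z0] := leP 0 z; rewrite -normrN => /H.
  by rewrite oppr_ge0 => /(_ z0); rewrite odd_tauN winv_odd sinN -opprD normrN.
rewrite ger0_norm// => zp; rewrite /odd_tau (@tau_neg (- z)) ?oppr_le0// subr0.
have zb : 0 <= z <= 5 / 4 * pi by rewrite z0/=; lra.
have /andP[w0 w1] := winv_bound Tpi wP zb.
have E : (z - w z) / T = sin (w z).
  have := wP z; rewrite /zmap clamp_id; last by apply/andP; split; lra.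
  by move=> {1}<-; field; rewrite gt_eqF//; lra.
by rewrite -E; apply: tau_close; rewrite z0.
Qed.

Lemma odd_tau_far z : 1 <= K * (`|z| - pi) -> odd_tau z = 0.
Proof.
wlog z0 : z / 0 <= z.
  move=> H; have [/H//|/ltW z0] := leP 0 z; rewrite -normrN => /H.
  by rewrite oppr_ge0 odd_tauN => /(_ z0)/eqP; rewrite oppr_eq0 => /eqP.
by rewrite ger0_norm// => /tau_far; rewrite /odd_tau => ->; rewrite tau_neg ?subr0// oppr_le0.
Qed.

(* As a function of [z], the wave on a period is the odd function [sin (w z)] cut off
   outside [-pi, pi]; the two terms are its translates on either side of the shock. *)
Definition wave x y := odd_tau (y - x - pi) + odd_tau (y - x + pi).

Lemma odd_tau_profile z z' d : `|z| <= pi -> `|z - z'| <= d ->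
  `|odd_tau z - sin (w z')| <= e1 + d.
Proof.
move=> zp zd; apply: le_trans (ler_distD (sin (w z)) _ _) _.
apply: lerD; first exact: odd_tau_close.
apply: le_trans (sin_lip _ _) _; apply: le_trans zd.
have TT := Tpi; have p0 := @pi_gt0 R; have T0 : 0 <= T by lra.
wlog zz : z z' {zp} / z' <= z.
  by move=> H; have [/H//|/ltW/H] := leP z' z; rewrite distrC [leRHS]distrC.
by have /andP[? ?] := winv_lip T0 wP zz; rewrite !ger0_norm// subr_ge0.
Qed.

(** At distance [d + K^-1] from the shock only one translate is alive: the argument of the other one
    exceeds [pi] by at least [K^-1], the length of the cutoff. *)
Lemma wave_close x xi y d : `|x - xi| <= d ->
  d + K^-1 <= `|y - xi| <= 2 * pi - (d + K^-1) ->
  `|wave x y - profile xi w y| <= e1 + d.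
Proof.
move=> xd; have p0 := @pi_gt0 R; have k0 : 0 < K^-1 by rewrite invr_gt0.
have far z : K^-1 <= z -> 1 <= K * z.
  by move=> kz; rewrite -(mulfV (lt0r_neq0 K0)) ler_pM2l.
have /andP[x1 x2] : - d <= x - xi <= d by rewrite -ler_norml.
rewrite /profile /offset /wave; have [yx|yx] := ltP y xi.
  rewrite ltr0_norm ?subr_lt0// => /andP[h1 h2].
  rewrite (@odd_tau_far (y - x - pi)) ?add0r; last first.
    by apply: far; rewrite ltr0_norm; lra.
  apply: odd_tau_profile.
    by rewrite ler_norml; apply/andP; split; lra.
  by rewrite (_ : _ - _ = - (x - xi)) ?normrN//; ring.
rewrite ger0_norm ?subr_ge0// => /andP[h1 h2].
rewrite (@odd_tau_far (y - x + pi)) ?addr0; last first.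
  by apply: far; rewrite gtr0_norm; lra.
apply: odd_tau_profile.
  by rewrite ler_norml; apply/andP; split; lra.
by rewrite (_ : _ - _ = - (x - xi)) ?normrN//; ring.
Qed.

End WaveError.

Section DeepONet.
Context {R : realType}.
Implicit Types (x y z xi e : R).
Local Notation mu := (@lebesgue_measure R).

(** Serves as branch and as scale: the signs turn the single trunk function into two differences
    [tau z - tau (- z)], and the datum acts through the shift alone. *)
Definition alternating_net : network R := [:: rows [::
  ([:: 0; 0; 0], 1); ([:: 0; 0; 0], -1); ([:: 0; 0; 0], 1); ([:: 0; 0; 0], -1)]].

Lemma alternating_netE x y z : nn_eval alternating_net [:: x; y; z] = [:: 1; -1; 1; -1].
Proof. by rewrite /= affine_rows/= !dot_cons !dot_nil !mul0r !add0r. Qed.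

(* The sensors at [0] and [pi / 2] give [sin xi] and [- cos xi]; the third is ignored. *)
Definition burgers_net (N S : network R) : sdon R :=
  SDON [:: 0; pi / 2; pi] 4 alternating_net N alternating_net S.

Lemma burgers_netE N S (tau : R -> R) xi y (gamma : seq R) :
  (forall z, nn_eval N [:: z] = nseq 4 (tau z)) ->
  nn_eval S [:: sin xi; - cos xi; sin_datum xi pi] = gamma ->
  sdon_eval (burgers_net N S) (sin_datum xi) y =
    (tau (y + gamma`_0) - tau (- y + gamma`_1)) + (tau (y + gamma`_2) - tau (- y + gamma`_3)).
Proof.
move=> NE SE; rewrite /sdon_eval/=.
have s0 : sin_datum xi 0 = sin xi by rewrite /sin_datum sub0r sinN opprK.
have s1 : sin_datum xi (pi / 2) = - cos xi.
  by rewrite /sin_datum sin_pihalf_sub.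
rewrite s0 s1 SE -/alternating_net -[affine _ _]/(nn_eval alternating_net _) alternating_netE.
by rewrite !big_ord_recl big_ord0/= !NE/= /bump/= !mul1r !mulN1r addr0 !addrA.
Qed.

End DeepONet.

Section BurgersError.
Context {R : realType}.
Implicit Types (x y z xi e : R).
Local Notation mu := (@lebesgue_measure R).
Local Notation box c r := (\1_(`[(c - r)%R, (c + r)%R]%classic)).

Lemma box_in (c r x : R) : `|x - c| <= r -> box c r x = 1 :> R.
Proof.
rewrite ler_norml => /andP[h1 h2]; rewrite indicE mem_set//= in_itv/=; apply/andP; split; lra.
Qed.

Lemma box_ge0 (c r x : R) : 0 <= (box c r x : R).
Proof. by rewrite indicE. Qed.

Lemma entropy_profile_integral (T xi : R) (w : R -> R) (u : R -> R -> R) :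
  pi < T -> (forall z, zmap T (w z) = z) -> 0 <= xi <= 2 * pi ->
  entropy_solution (sin_datum xi) u ->
  measurable_fun `[0, (2 * pi)]%classic (fun x => `|u x T - profile xi w x|) /\
  (\int[mu]_(x in `[0%R, (2 * pi)%R]) (`|u x T - profile xi w x|)%:E = 0)%E.
Proof.
move=> Tpi wP xib uE; have [mu1 [M uM] _ _ _] := uE.
have m1 : measurable_fun setT (fun x => `|u x T - profile xi w x|).
  apply: measurable_abs; apply: measurable_funB.
    exact: (slice_measurable mu1).
  exact: profile_measurable Tpi wP.
have m2 : measurable_fun `[0, (2 * pi)]%classic (fun x => `|u x T - profile xi w x|).
  exact: measurable_funS m1.
split=> //; rewrite RintegralE ?(entropy_profile Tpi wP xib uE)//.
apply: (itv_integrable (B := M + 1)) => // x _; rewrite normr_id.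
by apply: le_trans (ler_normB _ _) _; rewrite lerD// profile_le1.
Qed.

(** By Jordan's inequality the distance to the nearest multiple of [pi] is at most
    [pi / 2 * |sin xi|], and [pi / 2 <= 2]. *)
Lemma sin_small (K xi : R) : 0 < K -> 0 <= xi <= 2 * pi -> K * `|sin xi| < 4 ->
  [\/ `|xi - 0| <= 8 / K, `|xi - pi| <= 8 / K | `|xi - 2 * pi| <= 8 / K].
Proof.
move=> K0 xib Ks; have p0 := @pi_gt0 R; have p4 := @pi_le4 R.
have [phi [fb xiE]] := fold_angle xib; have /andP[f0 f1] := fb.
have s0 : 0 <= sin phi by apply: sin_ge0_pi; apply/andP; split; lra.
have sE : `|sin xi| = sin phi.
  case: xiE => ->; last by rewrite addrC mulr_natl sinD2pi sinN normrN ger0_norm.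
  - exact: ger0_norm.
  - by rewrite addrC sinDpi sinN opprK ger0_norm.
  - by rewrite addrC sinDpi normrN ger0_norm.
have J := jordan fb.
have fK : phi <= 8 / K.
  rewrite sE in Ks; rewrite ler_pdivlMr//.
  have : phi * K <= pi / 2 * sin phi * K by rewrite ler_pM2r.
  have : pi / 2 * (K * sin phi) <= 2 * (K * sin phi).
    by rewrite ler_wpM2r ?mulr_ge0 ?(ltW K0)//; lra.
  lra.
case: xiE => ->.
- by constructor 1; rewrite subr0 ger0_norm.
- by constructor 2; rewrite (_ : _ - _ = - phi) ?normrN ?ger0_norm//; ring.
- by constructor 2; rewrite (_ : _ - _ = phi) ?ger0_norm//; ring.
- by constructor 3; rewrite (_ : _ - _ = - phi) ?normrN ?ger0_norm//; ring.
Qed.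

Lemma burgers_error_le (T : R) (U : R -> R -> R -> R) (w tau : R -> R) (N S : network R)
    (K e1 : R) :
  pi < T -> (forall z, zmap T (w z) = z) ->
  (forall xi, entropy_solution (sin_datum xi) (U xi)) ->
  0 < K -> 0 <= e1 ->
  (forall z, nn_eval N [:: z] = nseq 4 (tau z)) ->
  (forall z, 0 <= tau z <= 1) -> (forall z, z <= 0 -> tau z = 0) ->
  (forall z, 1 <= K * (z - pi) -> tau z = 0) ->
  (forall z, 0 <= z <= pi -> `|tau z - (z - w z) / T| <= e1) ->
  (forall xi e, 0 <= xi <= 2 * pi -> 4 <= K * `|sin xi| ->
    exists2 x, nn_eval S [:: sin xi; - cos xi; e] = [:: - x - pi; x + pi; pi - x; x - pi] &
      `|x - xi| <= 8 * e1) ->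
  (sdon_burgers_error U T (burgers_net N S) <= (216 * e1 + 162 / K)%:E)%E.
Proof.
move=> Tpi wP UE K0 e10 NE tau01 tau_neg tau_far tau_close SE.
have p0 := @pi_gt0 R; have p4 := @pi_le4 R.
have k0 : 0 < K^-1 by rewrite invr_gt0.
pose F xi y := sdon_eval (burgers_net N S) (sin_datum xi) y.
have F2 xi y : `|F xi y| <= 2.
  rewrite /F (burgers_netE _ NE erefl).
  move: (nn_eval S _) => g; move: (tau01 (y + g`_0)) (tau01 (- y + g`_1))
    (tau01 (y + g`_2)) (tau01 (- y + g`_3)).
  by move=> /andP[? ?] /andP[? ?] /andP[? ?] /andP[? ?]; rewrite ler_norml; apply/andP; split; lra.
have P1 xi y : `|profile xi w y| <= 1 by exact: profile_le1.
have FP xi y : `|F xi y - profile xi w y| <= 3.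
  by apply: le_trans (ler_normB _ _) _; have := F2 xi y; have := P1 xi y; lra.
(* [r] is the uncertainty of the shock plus the length of the cutoff. Away from the shock the error
   is [e1 + 8 * e1]; near it, at most [2 + 1 = 3], on three boxes of length [2 * r]. *)
pose r := 8 * e1 + K^-1; pose A := 9 * e1 * (2 * pi) + 6 * 3 * r.
have r0 : 0 <= r by rewrite /r; lra.
have tri xi y : `|U xi y T - F xi y| <= `|U xi y T - profile xi w y| + `|F xi y - profile xi w y|.
  by rewrite (distrC (F xi y)); exact: ler_distD.
have L0 : 0 <= 2 * pi :> R by lra.
have A0 : 0 <= A by rewrite /A addr_ge0// ?mulr_ge0//; lra.
have inner xi : 0 <= xi <= 2 * pi ->
    (\int[mu]_(x in `[0%R, (2 * pi)%R]) (`|U xi x T - F xi x|)%:E <=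
    (0 + (A + 6 * pi * (box 0 (8 / K) xi + (box pi (8 / K) xi + box (2 * pi) (8 / K) xi))))%:E)%E.
  move=> xib; have [mg g0] := entropy_profile_integral Tpi wP xib (UE xi).
  have b1 := box_ge0 0 (8 / K) xi; have b2 := box_ge0 pi (8 / K) xi.
  have b3 := box_ge0 (2 * pi) (8 / K) xi.
  have [Ks|Ks] := leP 4 (K * `|sin xi|).
    have [x Ex xd] := SE xi (sin_datum xi pi) xib Ks.
    apply: (@le_trans _ _ A%:E); last by rewrite lee_fin add0r lerDl mulr_ge0// ?addr_ge0//; lra.
    apply: le_trans (integral_majorant (a := 9 * e1) (b := 3) xi (xi + 2 * pi) (xi - 2 * pi)
      L0 _ _ r0 (fun=> normr_ge0 _) mg g0) => //; first 1 last.
      by lra.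
    apply: integral_mono => [y _|y yb]; rewrite lee_fin//.
    apply: le_trans (tri xi y) _; rewrite lerD2l.
    have b4 := box_ge0 xi r y; have b5 := box_ge0 (xi + 2 * pi) r y.
    have b6 := box_ge0 (xi - 2 * pi) r y; have fp := FP xi y.
    move: (xib) (yb); rewrite /= in_itv/= => /andP[x0 x1] /andP[y0 y1].
    have [h1|/ltW h1] := leP r `|y - xi|; last by rewrite (box_in h1); lra.
    have [h2|/ltW h2] := leP `|y - xi| (2 * pi - r).
      have H : r <= `|y - xi| <= 2 * pi - r by rewrite h1.
      have := wave_close Tpi wP K0 tau_neg tau_far tau_close xd H.
      rewrite /F (burgers_netE _ NE Ex) /wave/=.
      have -> : - y + (x + pi) = - (y - x - pi) by ring.
      have -> : - y + (x - pi) = - (y - x + pi) by ring.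
      have -> : y + (- x - pi) = y - x - pi by ring.
      have -> : y + (pi - x) = y - x + pi by ring.
      by lra.
    have [yx|yx] := leP xi y.
      rewrite ger0_norm ?subr_ge0// in h2.
      have /box_in bE : `|y - (xi + 2 * pi)| <= r by rewrite ler_norml; apply/andP; split; lra.
      by rewrite bE; lra.
    rewrite ltr0_norm ?subr_lt0// in h2.
    have /box_in bE : `|y - (xi - 2 * pi)| <= r by rewrite ler_norml; apply/andP; split; lra.
    by rewrite bE; lra.
  (* Near the multiples of [pi] the shift is not controlled; the crude bound 3 over a period gives
     the [6 * pi] in front of the boxes in [xi]. *)
  apply: (@le_trans _ _ (3 * (2 * pi) + 6 * 0 * 0)%:E).
    apply: le_trans (integral_majorant (a := 3) 0 0 0
      L0 _ (lexx 0) (lexx 0) (fun=> normr_ge0 _) mg g0) => //.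
    apply: integral_mono => [y _|y _]; rewrite lee_fin//.
    by apply: le_trans (tri xi y) _; rewrite lerD2l mul0r addr0.
  rewrite lee_fin add0r.
  have : 1 <= box 0 (8 / K) xi + (box pi (8 / K) xi + box (2 * pi) (8 / K) xi) :> R.
    by have [/box_in E|/box_in E|/box_in E] := sin_small K0 xib Ks; move: b1 b2 b3; rewrite E; lra.
  move: (_ + _) => B B1; have : 6 * pi <= 6 * pi * B by rewrite ler_peMr//; lra.
  lra.
rewrite /sdon_burgers_error.
(* After division by [2 * pi] the bound is [(18 * pi + 144) * e1 + (18 + 144) / K], and
   [pi <= 4]. *)
set B := (216 * _ + _).
have -> : B%:E = ((2 * pi)^-1%:E * (2 * pi * B)%:E)%E.
  by rewrite -EFinM mulKf// gt_eqF//; lra.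
apply: lee_wpmul2l; first by rewrite lee_fin invr_ge0.
apply: (@le_trans _ _ (A * (2 * pi) + 6 * (6 * pi) * (8 / K))%:E).
  have c0 : 0 <= 8 / K by rewrite divr_ge0// ltW.
  have g0 : (\int[mu]_(x in `[0%R, (2 * pi)%R]) ((fun=> 0 : R) x)%:E = 0)%E.
    by rewrite integral0.
  apply: le_trans (integral_majorant 0 pi (2 * pi) L0 A0 _ c0 (fun=> lexx 0)
    (measurable_cst _) g0); last by lra.
  apply: integral_mono => [xi _|xi]; first by apply: integral_ge0 => y _; rewrite lee_fin.
  by rewrite /= in_itv/= => /inner.
rewrite lee_fin /B /A /r; move: (K^-1) k0 => k k0.
rewrite (_ : _ + _ = 2 * pi * ((18 * pi + 144) * e1 + 162 * k)); last by ring.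
rewrite ler_pM2l; last by lra.
rewrite lerD2r ler_wpM2r//; lra.
Qed.
End BurgersError.

(** * Choice of the parameters *)

Section AccuracyChoice.
Context {R : realType}.
Implicit Types (eps : R).

(** Keeps the logarithm away from 0, so that its square absorbs lower order terms. *)
Lemma ln_inv_ge eps : 0 < eps <= 2^-1 -> 2^-1 <= ln (eps^-1).
Proof.
move=> /andP[e0 e1]; rewrite -ler_expR lnK ?posrE ?invr_gt0//.
rewrite -[leLHS]invrK lef_pV2 ?posrE ?invr_gt0 ?expR_gt0// -expRN.
by apply: le_trans e1 _; have := expR_ge1Dx (- 2^-1 : R); lra.
Qed.

(** [4 / 5 <= expR (- 1 / 5)], so 60 logarithms give [eps ^+ 12]. Eleven of these factors are at
    most [2^-11], which beats the constant [216 * 4 * 2 = 1728]. *)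
Lemma pow45_le eps n : 0 < eps <= 2^-1 -> 60 * ln (eps^-1) <= n%:R ->
  216 * (4 * (4 / 5) ^+ n) <= eps / 2.
Proof.
move=> /andP[e0 e1] Ln; set L := ln _ in Ln.
have eE : expR (- L) = eps by rewrite expRN lnK ?invrK// posrE invr_gt0.
have A : (4 / 5) ^+ n <= expR (- 5^-1 * n%:R) :> R.
  rewrite (mulrC _ n%:R) expRM_natl; apply: lerXn2r; rewrite ?nnegrE ?expR_ge0//.
  by have := expR_ge1Dx (- 5^-1 : R); lra.
have B : expR (- 5^-1 * n%:R) <= expR (12%:R * - L) by rewrite ler_expR; lra.
rewrite expRM_natl eE exprS in B.
have C : eps ^+ 11 <= 2^-1 ^+ 11 by apply: lerXn2r; rewrite ?nnegrE ?(ltW e0).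
have D : (2^-1 ^+ 11 : R) <= 1 / (864 * 2) by rewrite !exprS expr0; lra.
have : eps * eps ^+ 11 <= eps * (1 / (864 * 2)) by rewrite ler_pM2l// (le_trans C).
by move=> /(le_trans (le_trans A B)); lra.
Qed.

End AccuracyChoice.

Unset Implicit Arguments.
Set Strict Implicit.
Set Printing Implicit Defensive.

Theorem theorem3p5 (R : realType) (T : R) (U : R -> R -> R -> R) :
  pi < T ->
  (forall xi : R, entropy_solution (sin_datum xi) (U xi)) ->
  exists C : R, 0 < C /\
    forall eps : R, 0 < eps -> eps <= 2^-1 ->
      exists D : sdon R,
        sdon_wf 3 D /\
        (sdon_p D)%:R <= C /\
        (sdon_burgers_error U T D <= eps%:E)%E /\
        (sdon_width D)%:R <= C /\
        (sdon_depth D)%:R <= C * ln (eps^-1) ^+ 2 /\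
        (sdon_size D)%:R <= C * ln (eps^-1) ^+ 2.
Proof.
(* Dictated by the size: [22^2 * 5000] from [width^2 * depth], and [7 * 22], absorbed thanks to
   [L ^+ 2 >= 1 / 4]. *)
move=> Tpi UE; exists (3 * 1000 * 1000); split; first by lra.
move=> eps e0 e1; have p0 := @pi_gt0 R.
have e01 : 0 < eps <= 2^-1 by rewrite e0.
have L0 := ln_inv_ge e01; set L := ln _ in L0 *.
pose n := (Num.truncn (60 * L)).+1.
have Ln : 60 * L <= n%:R by rewrite ltW// truncnS_gt.
have nL : n%:R <= 62 * L.
  have : (Num.truncn (60 * L))%:R <= 60 * L by rewrite truncn_le; lra.
  by rewrite /n -natr1; lra.
(* Makes the term [162 / K] of the error equal to [eps / 2]. *)
pose K := 324 / eps; have K0 : 0 < K by rewrite divr_gt0.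
have T0 : 0 <= T by lra.
have [w wP] := zmap_inverse T0.
have [N [tau [Nwf Nw Nd NE [tau01 tau_neg tau_far tau_close]]]] := trunk_exists n Tpi wP K0.
have [S [Swf Sw Sd SE]] := shift_exists K n.
have e10 : 0 <= 4 * (4 / 5) ^+ n :> R by rewrite mulr_ge0// exprn_ge0.
have width_le : (sdon_width (burgers_net N S) <= 22)%N.
  by rewrite /sdon_width/= /nn_width/= add0n addn0 (leq_add Nw Sw).
(* From [n <= 62 * L] the depth is at most [3844 * L^2 + 248 * L + 7], and [L >= 1 / 2]. *)
have depth_le : (sdon_depth (burgers_net N S))%:R <= 5 * 1000 * L ^+ 2.
  have : (sdon_depth (burgers_net N S) <= n * (n + 4) + 7)%N.
    by rewrite /sdon_depth/= max0n max0n geq_max Nd Sd.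
  rewrite -(ler_nat R) natrD natrM natrD => /le_trans; apply.
  have n0 : 0 <= n%:R :> R by [].
  nra.
exists (burgers_net N S); do 5?split.
- by rewrite /sdon_wf /= Nwf Swf.
- by rewrite /=; lra.
- apply: le_trans (burgers_error_le Tpi wP UE K0 e10 NE tau01 tau_neg tau_far tau_close SE) _.
  rewrite lee_fin; have := pow45_le e01 Ln.
  have -> : 162 / K = eps / 2 by rewrite /K; field; rewrite gt_eqF.
  lra.
- by move: width_le; rewrite -(ler_nat R); lra.
- by apply: le_trans depth_le _; rewrite ler_wpM2r ?sqr_ge0//; lra.
- rewrite (_ : sdon_size _ = 7 * sdon_width (burgers_net N S) +
    sdon_width (burgers_net N S) ^ 2 * sdon_depth (burgers_net N S))%N//.
  move: width_le depth_le; rewrite natrD 2!natrM natrX -(ler_nat R).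
  move: (ler0n R (sdon_width (burgers_net N S))) (ler0n R (sdon_depth (burgers_net N S))).
  move: (sdon_width _)%:R (sdon_depth _)%:R => W d W0 d0 W22 dL.
  have W2 : W ^+ 2 <= 484 by rewrite expr2; nra.
  have : W ^+ 2 * d <= 484 * d by rewrite ler_wpM2r.
  have : 4^-1 <= L ^+ 2 by rewrite expr2; nra.
  lra.
Qed.
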